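(* Assume (A1)–(A4) and that for some $\epsilon_0>0$ $$\sum_{i=0}^{\infty}\sup_{|\epsilon|\le\epsilon_0}\big\|E[\psi(e_i+\epsilon)\mid\mathcal F_0]-E[\psi(e_i^*+\epsilon)\mid\mathcal F_0^*]\big\|<\infty. \tag{7}$$ Then $$\varphi'(0)\hat\theta_n-\sum_{i=1}^n\psi(e_i)\mathbf z_{i,n}=o_{\mathbb P}(1)\quad\text{and}\quad \hat\theta_n=O_{\mathbb P}(1).$$ If in addition, for each $k\in\mathbb Z$, the limit $\Delta_k=\lim_{n\to\infty}\sum_{i=1}^{n-|k|}\mathbf z_{i,n}\mathbf z_{i+k,n}'$ exists, then $$\varphi'(0)\hat\theta_n\Rightarrow N(0,\Delta),\qquad \Delta=\sum_{k\in\mathbb Z}E[\psi(e_0)\psi(e_k)]\Delta_k.$$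
   Context: Let $(\varepsilon_k)_{k\in\mathbb Z}$ be i.i.d. random variables, $\mathcal F_k=(\dots,\varepsilon_{k-1},\varepsilon_k)$, and $e_i=G(\mathcal F_i)$ for a measurable function $G$ such that $e_i$ is a well-defined random variable. Let $(\varepsilon_k')_{k\in\mathbb Z}$ be an i.i.d. copy of $(\varepsilon_k)$ independent of it, $\mathcal F_k^*=(\dots,\varepsilon_{-1},\varepsilon_0',\varepsilon_1,\dots,\varepsilon_k)$ for $k\ge 0$, $\mathcal F_k^*=\mathcal F_k$ for $k<0$, and $e_k^*=G(\mathcal F_k^* )$. Conditioning on $\mathcal F_k$ (resp. $\mathcal F_k^*$) means conditioning on the σ-field it generates. For a random vector $V$, $\|V\|=(E|V|^2)^{1/2}$ with $|\cdot|$ the Euclidean norm. Consider the linear model $y_i=\mathbf x_i'\beta+e_i$, $1\le i\le n$, with nonstochastic $\mathbf x_i\in\mathbb R^p$ and true parameter $\beta_0=0$. Let $\Sigma_n=\sum_{i=1}^n\mathbf x_i\mathbf x_i'$ (assumed nonsingular for large $n$) and $\mathbf z_{i,n}=\Sigma_n^{-1/2}\mathbf x_i$, so $\sum_{i=1}^n\mathbf z_{i,n}\mathbf z_{i,n}'=I_p$. Let $\rho$ be convex with derivative $\psi$ (for nondifferentiable convex $\rho$, $\psi$ is a fixed nondecreasing version of the derivative, e.g. $\psi(x)=\alpha-\mathbf 1_{x\le0}$ for $\rho_\alpha(x)=\alpha x^++(1-\alpha)(-x)^+$). Let $\hat\beta_n$ be any minimizer of $\sum_{i=1}^n\rho(y_i-\mathbf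 x_i'\beta)$ and $\hat\theta_n=\Sigma_n^{1/2}\hat\beta_n$. Let $\varphi(t)=E[\psi(e_1+t)]$, $m(t)=\|\psi(e_1+t)-\psi(e_1)\|$, $r_n=\max_{i\le n}|\mathbf z_{i,n}|$. Conditions: (A1) $\rho$ is convex, $E[\psi(e_1)]=0$ and $0<\|\psi(e_1)\|<\infty$. (A2) $\varphi$ has a strictly positive derivative at $t=0$. (A3) $m$ is continuous at $t=0$. (A4) $r_n=\max_{i\le n}(\mathbf x_i'\Sigma_n^{-1}\mathbf x_i)^{1/2}\to 0$.
   Formalization: For k<0 the printed sum defining Δ_k involves z_{i+k,n} with i+k≤0, which is undefined; the sum is taken over all i with 1≤i≤n and 1≤i+k≤n (the printed formula when k≥0). The series for Δ is taken as the limit of its sums over |k|≤K, and the minimizer is assumed measurable. *)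

(* Defs.v *)
From HB Require Import structures.
From mathcomp Require Import all_boot all_order all_algebra.
From mathcomp Require Import all_classical all_reals all_analysis.
Set Implicit Arguments.
Unset Strict Implicit.
Unset Printing Implicit Defensive.
Import Order.TTheory GRing.Theory Num.Theory.
Import numFieldNormedType.Exports.
Local Open Scope classical_set_scope.
Local Open Scope ring_scope.

Section Defs.
Context {dT : measure_display} {T : measurableType dT} {R : realType}.

Definition mutually_independent {I : eqType} {dS : measure_display}
  {S : measurableType dS} (P : probability T R) (X : I -> T -> S) : Prop :=
  (forall i, measurable_fun setT (X i)) /\
  forall (J : seq I) (B : I -> set S), uniq J -> (forall i, measurable (B i)) ->
    P (\bigcap_(i in [set` J]) (X i @^-1` B i)) =
    (\prod_(i <- J) P (X i @^-1` B i))%E.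

Definition identically_distributed {I : Type} {dS : measure_display}
  {S : measurableType dS} (P : probability T R) (X : I -> T -> S) : Prop :=
  forall i j (B : set S), measurable B -> P (X i @^-1` B) = P (X j @^-1` B).

Definition gen_sigma {I : Type} {dS : measure_display} {S : measurableType dS}
  (X : I -> T -> S) (J : set I) : set (set T) :=
  <<s setT, [set A | exists j (B : set S), [/\ J j, measurable B & A = X j @^-1` B]] >>.

Definition is_cond_exp (P : probability T R) (F : set (set T)) (X Y : T -> R) : Prop :=
  [/\ P.-integrable setT (EFin \o X),
      (forall B : set R, measurable B -> F (Y @^-1` B)),
      P.-integrable setT (EFin \o Y) &
      forall A, F A -> (\int[P]_(x in A) (Y x)%:E = \int[P]_(x in A) (X x)%:E)%E].

Definition L2norm (P : probability T R) (V : T -> R) : \bar R :=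
  Lnorm P 2%:E (EFin \o V).

End Defs.

Section Shift.
Context {dS : measure_display} {S : measurableType dS} {R : realType}.

(** G is measurable for the product sigma-field on S^nat (generated by cylinders);
    a sequence f : nat -> S encodes (..., s_{k-1}, s_k) as f j = s_{k-j}. *)
Definition seq_measurable (G : (nat -> S) -> R) : Prop :=
  forall B : set R, measurable B ->
    <<s setT, [set A | exists j (C : set S),
                 measurable C /\ A = (fun f : (nat -> S) => f j) @^-1` C] >> (G @^-1` B).

Definition shift_proc {T : Type} (G : (nat -> S) -> R) (eps : int -> T -> S)
  (i : int) : T -> R := fun w => G (fun j : nat => eps (i - j%:Z) w).

Definition star_innov {T : Type} (eps eps' : int -> T -> S) : int -> T -> S :=
  fun j => if j == 0 then eps' 0 else eps j.

End Shift.

Section Vec.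
Context {R : realType} {p : nat}.
Definition dotv (u v : 'cV[R]_p) : R := \sum_i u i 0 * v i 0.
Definition vnorm (v : 'cV[R]_p) : R := Num.sqrt (dotv v v).

Definition is_psd_sqrt (S M : 'M[R]_p) : Prop :=
  [/\ S^T = S, (forall v : 'cV[R]_p, 0 <= dotv v (S *m v)) & S *m S = M].

Context {dT : measure_display} {T : measurableType dT}.

Definition cvg_prob0 (P : probability T R) (V : nat -> T -> 'cV[R]_p) : Prop :=
  forall delta : R, 0 < delta ->
    P [set w | delta < vnorm (V n w)] @[n --> \oo] --> 0%E.

Definition bounded_prob (P : probability T R) (V : nat -> T -> 'cV[R]_p) : Prop :=
  forall eta : R, 0 < eta -> exists M : R, exists N : nat, forall n, (N <= n)%N ->
    (P [set w | (M < vnorm (V n w))%R] < eta%:E)%E.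

(** V_n => N(0, D): N(0,D) is the law of A W with A A^T = D and W a vector of
    i.i.d. standard normal variables (on any probability space). *)
Definition cvg_normal (P : probability T R) (V : nat -> T -> 'cV[R]_p)
  (D : 'M[R]_p) : Prop :=
  forall (A : 'M[R]_p), A *m A^T = D ->
  forall (dO : measure_display) (O : measurableType dO) (Q : probability O R)
         (W : 'I_p -> O -> R),
    mutually_independent Q W ->
    (forall j (B : set R), measurable B -> Q (W j @^-1` B) = normal_prob 0 1 B) ->
  forall g : 'cV[R]_p -> R, continuous g -> (exists M : R, forall v, `|g v| <= M) ->
    Rintegral P setT (fun w => g (V n w)) @[n --> \oo] -->
    Rintegral Q setT (fun o => g (A *m \col_j W j o)).

End Vec.

(* Main.v *)
(** Let U be the shift on L2 of the law of the past (..., eps_(-1), eps_0) and K its adjoint, the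
    conditional expectation given the previous past. Every mean zero f splits into the
    orthogonal innovations U^j (1 - U K) K^j f, so the L2 norm of sum_i U^i g_i is at most
    sum_j (sum_i p_j(g_i)^2)^(1/2), where p_j(g) is the norm of (1 - U K) K^j g. Coupling eps_0
    with eps'_0 bounds p_j(psi(e + t)) by the j-th term of (7).

    Writing rho(e - tau) - rho(e) + tau psi(e) as a limit of Riemann sums of differences of
    translates of psi, its coefficient p_j is at most |tau| times a bound that is both summable
    in j and small in tau, while its mean is phi'(0) tau^2 / 2 + o(tau^2). Hence the convex
    objective is, pointwise in theta, the quadratic - theta' S_n + phi'(0) |theta|^2 / 2 up to
    o_P(1); by convexity this holds uniformly on compact sets, and the minimizer is
    S_n / phi'(0) + o_P(1).

    For c' S_n, the score is approximated by a mean zero function of finitely many innovations,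
    so that the sum becomes m-dependent and t -> E cos(t S + b) almost solves f' = - s t f.
    Convergence of these expectations together with tightness gives weak convergence, because
    Bernstein polynomials in sines approximate bounded continuous functions on boxes. *)

Require Import Defs.
From HB Require Import structures.
From mathcomp Require Import all_boot all_order all_algebra.
From mathcomp Require Import all_classical all_reals all_analysis.
From mathcomp Require Import measurable_realfun zify ring lra.
Import Order.TTheory GRing.Theory Num.Theory.
Import numFieldNormedType.Exports.
Local Open Scope classical_set_scope.
Local Open Scope ring_scope.

Set Implicit Arguments.
Unset Strict Implicit.
Unset Printing Implicit Defensive.

(** * Square-integrable functions *)


(** Condition (7) bounds conditional expectations of translates of [psi]; it speaks neither of [rho]
    nor of sums. Two devices answer this. Pythagoras is used only among innovations of the same age
    [j], which belong to different times, and the triangle inequality only across ages: the weights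
    are then summed in squares, with total [|theta|^2] for every large [n], while the coefficients
    [p_j] are summed without squares, as (7) allows. The bound for the coefficients of
    [psi(e) - psi(e + t)] that is both small and summable is a compromise: below some [J] it is the
    norm, small by continuity of [m] at 0; from [J] on it is twice the term of (7), whose tail is
    small.

    Passing to the law of the past makes [K] an explicit integral over one coordinate, so that
    conditioning becomes Fubini's theorem. The splitting into innovations leaves no remainder in the
    limit because the remote past is trivial: [K^j f] tends to 0 in L2 for every mean zero [f]. *)

Definition square_integrable {d} {T : measurableType d} {R : realType}
    (P : {measure set T -> \bar R}) (f : T -> R) : Prop :=
  measurable_fun setT f /\ P.-integrable setT (EFin \o (fun x => f x ^+ 2)).
Definition inner {d} {T : measurableType d} {R : realType}
    (P : {measure set T -> \bar R}) (f g : T -> R) : R := \int[P]_x (f x * g x).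
Definition norm2 {d} {T : measurableType d} {R : realType}
    (P : {measure set T -> \bar R}) (f : T -> R) : R := Num.sqrt (inner P f f).
Notation sqi := square_integrable.
Notation integ P f := (P.-integrable setT (EFin \o f)).

Section SquareIntegrable.
Context d (T : measurableType d) (R : realType) (P : probability T R).
Implicit Types f g h : T -> R.

Lemma integ_measurable f : integ P f -> measurable_fun setT f.
Proof. by move=> /integrableP[/measurable_EFinP]. Qed.

Lemma integ_le f g : measurable_fun setT f -> (forall x, `|f x| <= g x) ->
  integ P g -> integ P f.
Proof.
move=> mf fg ig; apply: (le_integrable measurableT _ _ ig).
  exact/measurable_EFinP.
by move=> x _ /=; rewrite lee_fin (le_trans (fg x)) ?ler_norm.
Qed.

Lemma integD f g : integ P f -> integ P g -> integ P (fun x => f x + g x).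
Proof. by move=> fi gi; exact: (integrableD measurableT fi gi). Qed.

Lemma integZ c f : integ P f -> integ P (fun x => c * f x).
Proof. by move=> fi; exact: (integrableZl measurableT c fi). Qed.

Lemma integN f : integ P f -> integ P (fun x => - f x).
Proof. by move=> /(integZ (-1)); congr integrable; apply/funext => x /=; rewrite mulN1r. Qed.

Lemma integB f g : integ P f -> integ P g -> integ P (fun x => f x - g x).
Proof. by move=> fi gi; apply: integD => //; exact: integN. Qed.

Lemma integ_cst c : integ P (fun _ => c).
Proof. exact: (finite_measure_integrable_cst P c measurableT). Qed.

Lemma integ_bounded f C : measurable_fun setT f -> (forall x, `|f x| <= C) -> integ P f.
Proof. by move=> mf fC; exact: (integ_le mf fC (integ_cst C)). Qed.

Lemma integ_sum (I : Type) (s : seq I) (Q : pred I) (F : I -> T -> R) :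
  (forall i, Q i -> integ P (F i)) -> integ P (fun x => \sum_(i <- s | Q i) F i x).
Proof.
move=> h; have := integrable_sum measurableT s h.
by congr integrable; apply/funext => x /=; rewrite sumEFin.
Qed.

Lemma Rint_sum (I : Type) (s : seq I) (Q : pred I) (F : I -> T -> R) :
  (forall i, Q i -> integ P (F i)) ->
  \int[P]_x (\sum_(i <- s | Q i) F i x) = \sum_(i <- s | Q i) \int[P]_x F i x.
Proof.
move=> h; elim: s => [|a s IH].
  under eq_Rintegral do rewrite big_nil.
  by rewrite Rintegral_cst// mul0r big_nil.
rewrite big_cons -IH; under eq_Rintegral do rewrite big_cons.
by case: ifPn => // Qa; rewrite RintegralD//; [exact: h|exact: integ_sum].
Qed.

Lemma Rint_cst (c : R) : \int[P]_x c = c.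
Proof. by rewrite Rintegral_cst// [X in fine X]probability_setT mulr1. Qed.

Lemma Rint_le f g : integ P f -> integ P g -> (forall x, f x <= g x) ->
  \int[P]_x f x <= \int[P]_x g x.
Proof. by move=> fi gi fg; apply: le_Rintegral. Qed.

Lemma Rint_norm_le f g : measurable_fun setT f -> integ P g -> (forall x, `|f x| <= g x) ->
  `|\int[P]_x f x| <= \int[P]_x g x.
Proof.
move=> mf gi fg; have fi := integ_le mf fg gi.
apply: (le_trans (le_normr_Rintegral measurableT fi)).
apply: Rint_le => //; apply: (integ_le _ _ gi) => [|x]; last by rewrite normr_id.
exact: measurableT_comp.
Qed.

Lemma Rint_norm_le_cst f C : measurable_fun setT f -> (forall x, `|f x| <= C) ->
  `|\int[P]_x f x| <= C.
Proof. by move=> mf fC; have := Rint_norm_le mf (integ_cst C) fC; rewrite Rint_cst. Qed.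

Lemma sqi_measurable f : sqi P f -> measurable_fun setT f. Proof. by case. Qed.

Lemma sqi_mul_integ f g : sqi P f -> sqi P g -> integ P (fun x => f x * g x).
Proof.
move=> [mf f2] [mg g2]; apply: (@integ_le _ (fun x => f x ^+ 2 + g x ^+ 2)).
- exact: measurable_funM.
- move=> x; rewrite normrM -(real_normK (num_real (f x))) -(real_normK (num_real (g x))).
  by have := sqr_ge0 (`|f x| - `|g x|); have := normr_ge0 (f x); have := normr_ge0 (g x); nra.
- exact: integD.
Qed.

Lemma sqi_bounded f C : measurable_fun setT f -> (forall x, `|f x| <= C) -> sqi P f.
Proof.
move=> mf fC; split=> //; apply: (@integ_bounded _ (C ^+ 2)) => [|x].
  exact: measurable_funX.
by rewrite normrX lerXn2r// nnegrE ?(le_trans _ (fC x)).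
Qed.

Lemma sqi_cst c : sqi P (fun _ => c).
Proof. exact: (@sqi_bounded _ `|c|). Qed.

Lemma sqi_integ f : sqi P f -> integ P f.
Proof.
move=> /sqi_mul_integ /(_ (sqi_cst 1)).
by congr integrable; apply/funext => x /=; rewrite mulr1.
Qed.

Lemma sqi_le f g : measurable_fun setT f -> (forall x, `|f x| <= g x) -> sqi P g -> sqi P f.
Proof.
move=> mf fg [mg g2]; split=> //; apply: (integ_le _ _ g2) => [|x].
  exact: measurable_funX.
by rewrite normrX lerXn2r// nnegrE ?(le_trans _ (fg x)).
Qed.

Lemma sqiZ c f : sqi P f -> sqi P (fun x => c * f x).
Proof.
move=> [mf f2]; split; first exact: measurable_funM.
have := integZ (c ^+ 2) f2.
by congr integrable; apply/funext => x /=; rewrite exprMn.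
Qed.

Lemma sqiD f g : sqi P f -> sqi P g -> sqi P (fun x => f x + g x).
Proof.
move=> fi gi; have [mf f2] := fi; have [mg g2] := gi; split; first exact: measurable_funD.
have := integD (integD f2 g2) (integZ 2 (sqi_mul_integ fi gi)).
by congr integrable; apply/funext => x /=; congr EFin; ring.
Qed.

Lemma sqiN f : sqi P f -> sqi P (fun x => - f x).
Proof.
by move=> /(sqiZ (-1)); congr square_integrable; apply/funext => x /=; rewrite mulN1r.
Qed.

Lemma sqiB f g : sqi P f -> sqi P g -> sqi P (fun x => f x - g x).
Proof. by move=> fi gi; apply: sqiD => //; exact: sqiN. Qed.

Lemma sqi_sum (I : Type) (s : seq I) (Q : pred I) (F : I -> T -> R) :
  (forall i, Q i -> sqi P (F i)) -> sqi P (fun x => \sum_(i <- s | Q i) F i x).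
Proof.
move=> h; elim: s => [|a s IH].
  have := sqi_cst 0; congr square_integrable; apply/funext => x /=.
  by rewrite big_nil.
case Qa: (Q a).
  have := sqiD (h _ Qa) IH; congr square_integrable; apply/funext => x /=.
  by rewrite big_cons Qa.
by move: IH; congr square_integrable; apply/funext => x /=; rewrite big_cons Qa.
Qed.

Lemma innerC f g : inner P f g = inner P g f.
Proof. by apply: eq_Rintegral => x _; rewrite mulrC. Qed.

Lemma innerDl f g h : sqi P f -> sqi P g -> sqi P h ->
  inner P (fun x => f x + g x) h = inner P f h + inner P g h.
Proof.
move=> fi gi hi; rewrite -RintegralD//; last 2 first.
- exact: sqi_mul_integ.
- exact: sqi_mul_integ.
by apply: eq_Rintegral => x _; rewrite mulrDl.
Qed.

Lemma innerZl c f h : sqi P f -> sqi P h ->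
  inner P (fun x => c * f x) h = c * inner P f h.
Proof.
move=> fi hi; rewrite -RintegralZl//; last exact: sqi_mul_integ.
by apply: eq_Rintegral => x _; rewrite mulrA.
Qed.

Lemma innerBl f g h : sqi P f -> sqi P g -> sqi P h ->
  inner P (fun x => f x - g x) h = inner P f h - inner P g h.
Proof.
move=> fi gi hi; rewrite -RintegralB//; last 2 first.
- exact: sqi_mul_integ.
- exact: sqi_mul_integ.
by apply: eq_Rintegral => x _; rewrite mulrBl.
Qed.

Lemma inner_suml (I : Type) (s : seq I) (Q : pred I) (F : I -> T -> R) h :
  (forall i, Q i -> sqi P (F i)) -> sqi P h ->
  inner P (fun x => \sum_(i <- s | Q i) F i x) h = \sum_(i <- s | Q i) inner P (F i) h.
Proof.
move=> Fi hi; rewrite -Rint_sum => [|i Qi]; last exact: sqi_mul_integ (Fi _ Qi) hi.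
by apply: eq_Rintegral => x _; rewrite mulr_suml.
Qed.

Lemma inner_ge0 f : 0 <= inner P f f.
Proof. by apply: Rintegral_ge0 => x _; rewrite -expr2 sqr_ge0. Qed.

Lemma norm2_ge0 f : 0 <= norm2 P f. Proof. exact: sqrtr_ge0. Qed.

Lemma norm2_sqr f : norm2 P f ^+ 2 = inner P f f.
Proof. by rewrite sqr_sqrtr// inner_ge0. Qed.

Lemma norm2Z c f : sqi P f -> norm2 P (fun x => c * f x) = `|c| * norm2 P f.
Proof.
move=> fi; rewrite /norm2 innerZl//; last exact: sqiZ.
by rewrite innerC innerZl// mulrA -expr2 sqrtrM ?sqr_ge0// sqrtr_sqr.
Qed.

Lemma quadratic_discriminant (a b c : R) : 0 <= c ->
  (forall t, 0 <= a - 2 * t * b + t ^+ 2 * c) -> b ^+ 2 <= a * c.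
Proof.
rewrite le_eqVlt => /orP[/eqP <-|c0] h.
  rewrite mulr0; have [->|b0] := eqVneq b 0; first by rewrite expr0n.
  (* With [c = 0] the expression is affine in [t] and equals -1 at this point. *)
  have := h ((a + 1) / (2 * b)).
  rewrite mulr0 addr0 (_ : 2 * _ * b = a + 1); last by field.
  lra.
have := h (b / c).
have -> : a - 2 * (b / c) * b + (b / c) ^+ 2 * c = (a * c - b ^+ 2) / c.
  by field; rewrite gt_eqF.
by rewrite pmulr_lge0 ?invr_gt0// subr_ge0.
Qed.

Lemma inner_le f g : sqi P f -> sqi P g -> `|inner P f g| <= norm2 P f * norm2 P g.
Proof.
move=> fi gi; rewrite /norm2 -sqrtrM ?inner_ge0// -sqrtr_sqr ler_wsqrtr//.
apply: quadratic_discriminant (inner_ge0 _) _ => t.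
have := inner_ge0 (fun x => f x - t * g x).
have bgi := sqiZ t gi.
rewrite innerBl//; last exact: sqiB.
rewrite innerZl//; last exact: sqiB.
rewrite (innerC f) (innerC g) !innerBl// !innerZl// (innerC g f).
by move=> h; apply: (le_trans h); rewrite le_eqVlt; apply/orP; left; apply/eqP; ring.
Qed.

Lemma norm2_le f C : 0 <= C -> inner P f f <= C ^+ 2 -> norm2 P f <= C.
Proof. by move=> C0 h; rewrite -(ger0_norm C0) -sqrtr_sqr ler_wsqrtr. Qed.

(** Bounds on operators are obtained by testing against [h] and moving the operator to [h] by
    adjunction; the choice [h = f] gives the norm back. *)
Lemma norm2_le_dual f C : 0 <= C -> sqi P f ->
  (forall h, sqi P h -> inner P f h <= C * norm2 P h) -> norm2 P f <= C.
Proof.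
move=> C0 fi /(_ _ fi); rewrite -norm2_sqr expr2.
have [/eqP|] := eqVneq (norm2 P f) 0; first by move=> /eqP ->.
by move=> fn0; rewrite ler_pM2r// lt_def fn0 norm2_ge0.
Qed.

Lemma norm2_sum (I : Type) (s : seq I) (Q : pred I) (F : I -> T -> R) :
  (forall i, Q i -> sqi P (F i)) ->
  norm2 P (fun x => \sum_(i <- s | Q i) F i x) <= \sum_(i <- s | Q i) norm2 P (F i).
Proof.
move=> Fi; apply: norm2_le_dual => [||h hi].
- by apply: sumr_ge0 => i _; exact: norm2_ge0.
- exact: sqi_sum.
- rewrite inner_suml// mulr_suml; apply: ler_sum => i Qi.
  exact: le_trans (ler_norm _) (inner_le (Fi _ Qi) hi).
Qed.

Lemma norm2D f g : sqi P f -> sqi P g ->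
  norm2 P (fun x => f x + g x) <= norm2 P f + norm2 P g.
Proof.
move=> fi gi; apply: norm2_le_dual => [||h hi].
- by rewrite addr_ge0// norm2_ge0.
- exact: sqiD.
- rewrite innerDl// mulrDl lerD//; exact: le_trans (ler_norm _) (inner_le _ _).
Qed.

Lemma norm2N f : sqi P f -> norm2 P (fun x => - f x) = norm2 P f.
Proof.
move=> fi; rewrite -[RHS]mul1r -(normr1 R) -normrN -norm2Z//.
by congr norm2; apply/funext => x; rewrite mulN1r.
Qed.

Lemma norm2B f g : sqi P f -> sqi P g ->
  norm2 P (fun x => f x - g x) <= norm2 P f + norm2 P g.
Proof. by move=> fi gi; rewrite -(norm2N gi); apply: norm2D => //; exact: sqiN. Qed.

Lemma norm2_dist f g : sqi P f -> sqi P g ->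
  `|norm2 P f - norm2 P g| <= norm2 P (fun x => f x - g x).
Proof.
move=> fi gi; rewrite ler_norml; have hi := sqiB fi gi; apply/andP; split.
  have := norm2B fi hi.
  have -> : (fun x => f x - (f x - g x)) = g by apply/funext => x; ring.
  lra.
have := norm2D hi gi.
have -> : (fun x => (f x - g x) + g x) = f by apply/funext => x; ring.
lra.
Qed.

Lemma norm2_mono f g : measurable_fun setT f -> sqi P g -> (forall x, `|f x| <= g x) ->
  norm2 P f <= norm2 P g.
Proof.
move=> mf gi fg; have fi := sqi_le mf fg gi.
rewrite ler_wsqrtr//; apply: Rint_le; [exact: sqi_mul_integ..|move=> x].
rewrite -!expr2 -(real_normK (num_real (f x))) lerXn2r// nnegrE.
by rewrite (le_trans _ (fg x)).
Qed.

Lemma norm2_cst c : norm2 P (fun _ => c) = `|c|.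
Proof. by rewrite /norm2 /inner Rint_cst -expr2 sqrtr_sqr. Qed.

Lemma Rint_le_norm2 f : sqi P f -> `|\int[P]_x f x| <= norm2 P f.
Proof.
move=> fi; have := inner_le fi (sqi_cst 1); rewrite norm2_cst normr1 mulr1.
by congr (`| _ | <= _); apply: eq_Rintegral => x _; rewrite mulr1.
Qed.

Lemma Rint_abs_le_norm2 f : sqi P f -> \int[P]_x `|f x| <= norm2 P f.
Proof.
move=> fi; have mf : measurable_fun setT (fun x => `|f x|).
  by apply: measurableT_comp => //; case: fi.
have fi' : sqi P (fun x => `|f x|).
  case: fi => _ f2; split=> //; move: f2; congr integrable; apply/funext => x /=.
  by rewrite real_normK ?num_real.
rewrite (le_trans (ler_norm _))// (le_trans (Rint_le_norm2 fi'))//.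
rewrite le_eqVlt; apply/orP; left; apply/eqP; rewrite /norm2; congr Num.sqrt.
by apply: eq_Rintegral => x _; rewrite -!expr2 real_normK ?num_real.
Qed.

End SquareIntegrable.

(** * Laws of random elements and Fubini's theorem for independent pairs *)

Section Law.
Context d d' (T : measurableType d) (T' : measurableType d') (R : realType).
Variable (P : probability T R) (X : T -> T') (mX : measurable_fun setT X).

Definition law : probability T' R :=
  distribution P (HB.pack X (isMeasurableFun.Build _ _ _ _ X mX) : {mfun T >-> T'}).

Lemma law_integral (f : T' -> \bar R) : measurable_fun setT f ->
  (\int[law]_y f y = \int[P]_x f (X x))%E.
Proof.
move=> mf; rewrite -[RHS]/(\int[P]_x (f \o X) x)%E integralE [RHS]integralE.
rewrite (funepos_comp f X) (funeneg_comp f X); congr (_ - _)%E.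
  by rewrite (ge0_integral_pushforward mX)//; last exact: measurable_funepos.
by rewrite (ge0_integral_pushforward mX)//; last exact: measurable_funeneg.
Qed.

Lemma integ_law (f : T' -> R) : measurable_fun setT f ->
  integ law f <-> integ P (f \o X).
Proof.
move=> mf; have mfX : measurable_fun setT (f \o X) by exact: measurableT_comp.
split=> /integrableP[_ h]; apply/integrableP; split; do ?exact/measurable_EFinP.
  move: h; rewrite (@law_integral (fun y => `|(f y)%:E|%E))//.
  by apply: measurableT_comp => //; exact/measurable_EFinP.
rewrite (@law_integral (fun y => `|(f y)%:E|%E))//.
by apply: measurableT_comp => //; exact/measurable_EFinP.
Qed.

Lemma law_Rint (f : T' -> R) : measurable_fun setT f ->
  \int[law]_y f y = \int[P]_x f (X x).
Proof. by move=> mf; rewrite /Rintegral law_integral//; exact/measurable_EFinP. Qed.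

Lemma sqi_law (f : T' -> R) : measurable_fun setT f -> sqi law f <-> sqi P (f \o X).
Proof.
move=> mf; split=> -[m i]; split=> //; first exact: measurableT_comp.
  by move/integ_law : i; apply; exact: measurable_funX.
by apply/integ_law => //; exact: measurable_funX.
Qed.

End Law.

Section PairLaw.
Context d d1 d2 (T : measurableType d) (T1 : measurableType d1)
  (T2 : measurableType d2) (R : realType) (P : probability T R).
Variables (X : T -> T1) (Y : T -> T2).
Hypotheses (mX : measurable_fun setT X) (mY : measurable_fun setT Y).
Hypothesis XY : forall A B, measurable A -> measurable B ->
  P (X @^-1` A `&` Y @^-1` B) = (P (X @^-1` A) * P (Y @^-1` B))%E.
Let mXY : measurable_fun setT (fun w => (X w, Y w)).
Proof. exact: measurable_fun_pair. Qed.

Lemma pair_lawE A : measurable A ->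
  (law P mX \x law P mY)%E A = law P mXY A.
Proof.
by move=> mA; apply: product_measure_unique => // B C mB mC.
Qed.

Variable F : T1 * T2 -> R.
Hypotheses (mF : measurable_fun setT F) (iF : integ P (fun w => F (X w, Y w))).

Lemma pair_integ : integ (law P mX \x law P mY)%E F.
Proof.
have /integrableP[m h] : integ (law P mXY) F by exact/integ_law.
apply/integrableP; split=> //; rewrite (eq_measure_integral (law P mXY))// => A mA _.
exact: pair_lawE.
Qed.

(** The inner integral in Fubini's theorem is extended-real and finite only almost everywhere;
    [fine] alters it on a null set. *)
Lemma fine_integrable (g : T2 -> \bar R) (m : {measure set T2 -> \bar R}) :
  m.-integrable setT g ->
  integ m (fun x => fine (g x)) /\ \int[m]_x (fine (g x)) = fine (\int[m]_x g x)%E.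
Proof.
move=> ig; have mg : measurable_fun setT g by exact: measurable_int ig.
have mfg : measurable_fun setT (fun x => fine (g x)) by exact: measurableT_comp.
split.
  apply: (le_integrable measurableT _ _ ig); first exact/measurable_EFinP.
  by move=> x _ /=; case: (g x) => [r||]//=; rewrite ?normr0 ?leey.
rewrite /Rintegral; congr fine; apply: ae_eq_integral => //.
  exact/measurable_EFinP.
have := integrable_ae measurableT ig.
by apply: filterS => x /= h _; rewrite fineK//; exact: h.
Qed.

Lemma pair_integrable_G :
  (law P mY).-integrable setT (fubini_G (law P mX) (EFin \o F)).
Proof.
have mEF : measurable_fun setT (EFin \o F) by exact/measurable_EFinP.
have maF : measurable_fun setT (abse \o (EFin \o F)) by exact: measurableT_comp.
apply/integrableP; split; first exact: measurable_fubini_G pair_integ.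
have h := (@integrable21ltyP _ _ _ _ _ (law P mX) (law P mY) _ mEF).1 pair_integ.
apply: le_lt_trans h.
apply: ge0_le_integral => //.
- have mG := measurable_fubini_G pair_integ.
  exact: (measurableT_comp (@abse_measurable R setT) mG).
- apply: (@measurable_fun_fubini_tonelli_G _ _ _ _ _ (law P mX) _ maF) => z.
  exact: abse_ge0.
- move=> y _; apply: le_abse_integral => //.
  apply: measurableT_comp => //; exact: measurable_fun_pair1.
Qed.

Lemma pair_fubini : integ (law P mY) (fun y => \int[law P mX]_x F (x, y)) /\
  \int[P]_w F (X w, Y w) = \int[law P mY]_y \int[law P mX]_x F (x, y).
Proof.
have [h1 h2] := fine_integrable pair_integrable_G.
split=> //; rewrite [RHS]h2 integral21_prod_meas1; last exact: pair_integ.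
rewrite (eq_measure_integral (law P mXY)) => [|A mA _]; last exact: pair_lawE.
by rewrite -[RHS]/(\int[law P mXY]_z F z) law_Rint.
Qed.

End PairLaw.

(** * Independence of sigma-fields generated by disjoint families *)

Section Independence.
Context d (T : measurableType d) (R : realType) (P : probability T R).

Lemma indep_setC (A B : set T) : measurable A -> measurable B ->
  P (A `&` B) = (P A * P B)%E -> P (~` A `&` B) = (P (~` A) * P B)%E.
Proof.
move=> mA mB PA; rewrite setIC -setDE.
have -> : P (B `\` A) = (P B - P (B `&` A))%E.
  by apply: measureD => //; rewrite (le_lt_trans (probability_le1 P mB)) ?ltry.
rewrite (setIC B A) PA probability_setC// muleBl ?mul1e// ?fin_num_measure//.
Qed.

Lemma indep_bigcup (F : (set T)^nat) (B : set T) : (forall n, measurable (F n)) ->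
  measurable B -> trivIset setT F -> (forall n, P (F n `&` B) = (P (F n) * P B)%E) ->
  P (\bigcup_k F k `&` B) = (P (\bigcup_k F k) * P B)%E.
Proof.
have sum_bigcup (E : (set T)^nat) : (forall n, measurable (E n)) -> trivIset setT E ->
    P (\bigcup_k E k) = (\sum_(k <oo) P (E k))%E.
  move=> mE tE; transitivity (\sum_(0 <= k <oo | k \in setT) P (E k))%E.
    exact: measure_bigcup.
  by apply: eq_eseriesl => k; rewrite in_setT.
move=> mF mB tF PF; rewrite setI_bigcupl sum_bigcup; last 2 first.
- by move=> i; exact: measurableI.
- exact: trivIset_setIr.
rewrite sum_bigcup//.
have PBE : P B = (fine (P B))%:E by rewrite fineK// fin_num_measure.
under eq_eseriesr do rewrite PF muleC PBE.
by rewrite nneseriesZl// PBE muleC.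
Qed.

(** For fixed [B], the events independent of [B] form a Dynkin system. *)
Lemma indep_dynkin (G : set (set T)) (B : set T) : setI_closed G ->
  G `<=` measurable -> measurable B ->
  (forall A, G A -> P (A `&` B) = (P A * P B)%E) ->
  forall A, <<s G >> A -> P (A `&` B) = (P A * P B)%E.
Proof.
move=> GI Gm mB GB.
have sGm : <<s G >> `<=` (measurable : set (set T)).
  apply: smallest_sub => //; exact: sigma_algebra_measurable.
apply: (@dynkin_induction _ (g_sigma_algebraType G) G
  (fun A => P (A `&` B) = (P A * P B)%E)) => //.
- by rewrite setTI probability_setT mul1e.
- by move=> A /sGm mA; exact: indep_setC.
- by move=> F mF tF PF; apply: indep_bigcup => // n; exact: sGm (mF n).
Qed.

Context (I : eqType) dS (S : measurableType dS) (X : I -> T -> S).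
Hypothesis mXf : forall i, measurable_fun setT (X i).

(** Requiring [C i = setT] off [s] allows two cylinders to be rewritten over a common list of
    indices, which is what intersections and the product formula need. *)
Definition cyl_events (J : set I) : set (set T) :=
  [set A | exists (s : seq I) (C : I -> set S), [/\ uniq s, (forall i, i \in s -> J i),
     (forall i, measurable (C i)), (forall i, i \notin s -> C i = setT) &
     A = \bigcap_(i in [set` s]) (X i @^-1` C i)] ].

Let mX i (C : set S) : measurable C -> measurable (X i @^-1` C).
Proof. by move=> mC; rewrite -[X in measurable X]setTI; exact: mXf. Qed.

Lemma bigcap_widen (s s' : seq I) (C : I -> set S) : {subset s <= s'} ->
  (forall i, i \notin s -> C i = setT) ->
  \bigcap_(i in [set` s]) (X i @^-1` C i) = \bigcap_(i in [set` s']) (X i @^-1` C i).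
Proof.
move=> ss CT; apply/seteqP; split=> w h i /= is_.
  by have [/h//|/CT ->] := boolP (i \in s).
exact/h/ss.
Qed.

Lemma cyl_events_measurable J : cyl_events J `<=` measurable.
Proof.
move=> _ [s [C [_ _ mC _ ->]]]; elim: s => [|i s IH].
  rewrite (_ : \bigcap_(i in _) _ = setT); first exact: measurableT.
  by apply/seteqP; split.
rewrite (_ : \bigcap_(j in _) _ =
    X i @^-1` C i `&` \bigcap_(j in [set` s]) X j @^-1` C j).
  by apply: measurableI => //; exact: mX.
apply/seteqP; split=> w.
  by move=> h; split; [|move=> j /= js]; apply: h => /=; rewrite inE ?eqxx// js orbT.
by move=> [h1 h2] j /=; rewrite inE => /orP[/eqP -> //|]; exact: h2.
Qed.

Lemma cyl_events_setI J : setI_closed (cyl_events J).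
Proof.
move=> _ _ [s [C [us sJ mC CT ->]]] [s' [C' [us' sJ' mC' CT' ->]]].
exists (undup (s ++ s')), (fun i => C i `&` C' i); split.
- exact: undup_uniq.
- by move=> i; rewrite mem_undup mem_cat => /orP[/sJ|/sJ'].
- by move=> i; exact: measurableI.
- by move=> i; rewrite mem_undup mem_cat negb_or => /andP[/CT -> /CT' ->]; rewrite setTI.
rewrite (@bigcap_widen s (undup (s ++ s')))//; last first.
  by move=> i is_; rewrite mem_undup mem_cat is_.
rewrite (@bigcap_widen s' (undup (s ++ s')))//; last first.
  by move=> i is_; rewrite mem_undup mem_cat is_ orbT.
by rewrite -bigcapI; apply: eq_bigcapr => i _; rewrite preimage_setI.
Qed.

Lemma gen_sigma_cyl J : gen_sigma X J `<=` <<s cyl_events J >>.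
Proof.
apply: sub_smallest2r; first exact: smallest_sigma_algebra.
move=> _ [j [C [Jj mC ->]]].
exists [:: j], (fun i => if i == j then C else setT); split => //.
- by move=> i; rewrite inE => /eqP ->.
- by move=> i; case: ifP.
- by move=> i; rewrite inE => /negbTE ->.
apply/seteqP; split=> w /=; first by move=> Cw i /=; rewrite inE => /eqP ->; rewrite eqxx.
by move=> /(_ j); rewrite /= eqxx; apply; rewrite inE.
Qed.

Lemma gen_sigma_measurable J : gen_sigma X J `<=` measurable.
Proof.
apply: smallest_sub; first exact: sigma_algebra_measurable.
by move=> _ [j [C [Jj mC ->]]]; exact: mX.
Qed.

Hypothesis HX : mutually_independent P X.

Lemma cyl_events_indep J1 J2 A B : (forall i, J1 i -> ~ J2 i) ->
  cyl_events J1 A -> cyl_events J2 B -> P (A `&` B) = (P A * P B)%E.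
Proof.
move=> J12 [s [C [us sJ mC CT ->]]] [s' [C' [us' sJ' mC' CT' ->]]].
have sF i : i \in s -> i \notin s' by move=> /sJ /J12 h; apply/negP => /sJ'.
have sF' i : i \in s' -> i \notin s by move=> is'; apply/negP => /sF; rewrite is'.
rewrite HX.2// HX.2//.
rewrite (@bigcap_widen s (s ++ s'))//; last by move=> i is_; rewrite mem_cat is_.
rewrite (@bigcap_widen s' (s ++ s'))//; last by move=> i is_; rewrite mem_cat is_ orbT.
rewrite -bigcapI.
rewrite (eq_bigcapr (G := fun i => X i @^-1` (C i `&` C' i))); last first.
  by move=> i _; rewrite preimage_setI.
rewrite HX.2; last 2 first.
- rewrite cat_uniq us us' andbT; apply/hasPn => i /=; exact: sF'.
- by move=> i; exact: measurableI.
rewrite big_cat/=; congr (_ * _)%E; apply: eq_big_seq => i is_.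
  by rewrite CT' ?sF// setIT.
by rewrite CT ?sF'// setTI.
Qed.

(** The pi-lambda argument is run twice, freeing one event at a time, down to cylinders over
    disjoint sets of indices. *)
Lemma gen_sigma_indep J1 J2 A B : (forall i, J1 i -> ~ J2 i) ->
  gen_sigma X J1 A -> gen_sigma X J2 B -> P (A `&` B) = (P A * P B)%E.
Proof.
move=> J12 GA GB.
apply: (@indep_dynkin (cyl_events J1)) (gen_sigma_cyl GA) => //.
- exact: cyl_events_setI.
- exact: cyl_events_measurable.
- exact: gen_sigma_measurable GB.
move=> A' CA'; rewrite setIC muleC.
apply: (@indep_dynkin (cyl_events J2)) (gen_sigma_cyl GB) => //.
- exact: cyl_events_setI.
- exact: cyl_events_measurable.
- exact: cyl_events_measurable CA'.
by move=> B' CB'; rewrite setIC muleC; exact: (cyl_events_indep J12 CA' CB').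
Qed.

End Independence.

(** * The shift and its adjoint on the space of pasts *)

Section SequenceSpace.
Context {dS : measure_display} (S : measurableType dS).

Definition cylinders : set (set (nat -> S)) :=
  [set A | exists j (C : set S), measurable C /\ A = (fun f : (nat -> S) => f j) @^-1` C].
(** A past is read backwards: coordinate 0 is the latest innovation, so [scons] lets one time step
    pass and [stail] forgets the latest innovation. The sigma-field is the one for which [G] is
    assumed measurable. *)
Definition seqspace := g_sigma_algebraType cylinders.
Definition coord (j : nat) (x : seqspace) : S := x j.
Definition scons (s : S) (x : seqspace) : seqspace :=
  fun j => if j is j'.+1 then x j' else s.
Definition stail (x : seqspace) : seqspace := fun j => x j.+1.

Lemma stail_cons s x : stail (scons s x) = x. Proof. by []. Qed.

Lemma iter_stail n x j : iter n stail x j = x (n + j)%N.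
Proof. by elim: n j => //= n IH j; rewrite /stail IH addnS addSn. Qed.

Lemma measurable_coord j : measurable_fun setT (coord j).
Proof. by move=> _ C mC; rewrite setTI; apply: sub_sigma_algebra; exists j, C. Qed.

Lemma measurable_seqspace d (T : measurableType d) (f : T -> seqspace) :
  (forall j, measurable_fun setT (fun w => f w j)) -> measurable_fun setT f.
Proof.
move=> h; apply: (@measurability _ _ _ _ _ f cylinders) => //.
by move=> _ [_ [j [C [mC ->]]] <-]; exact: h.
Qed.

Lemma measurable_stail : measurable_fun setT stail.
Proof. by apply: measurable_seqspace => j; exact: measurable_coord. Qed.

Lemma measurable_iter_stail n : measurable_fun setT (iter n stail).
Proof.
elim: n => [|n IH]; first exact: measurable_id.
exact: (measurableT_comp measurable_stail IH).
Qed.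

Lemma measurable_scons : measurable_fun setT (fun z : S * seqspace => scons z.1 z.2).
Proof.
apply: measurable_seqspace => -[|j] /=; first exact: measurable_fst.
exact: (measurableT_comp (measurable_coord j) measurable_snd).
Qed.

Lemma coord_gen_sigma (A : set seqspace) : measurable A -> gen_sigma coord setT A.
Proof.
apply: sub_smallest2r; first exact: smallest_sigma_algebra.
by move=> _ [j [C [mC ->]]]; exists j, C.
Qed.

Lemma seqspace_law_unique (R : realType) (m1 m2 : probability seqspace R) :
  (forall (s : seq nat) (C : nat -> set S), uniq s -> (forall i, measurable (C i)) ->
     m1 (\bigcap_(i in [set` s]) (coord i @^-1` C i)) =
     m2 (\bigcap_(i in [set` s]) (coord i @^-1` C i))) ->
  forall A, measurable A -> m1 A = m2 A.
Proof.
move=> m12 A mA.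
have cT : cyl_events coord setT (setT : set seqspace).
  by exists [::], (fun _ => setT); split => //; apply/seteqP; split.
apply: (@g_sigma_algebra_measure_unique _ _ _ (cyl_events coord setT) _
  (fun _ => setT) _ _ m1 m2) => //.
- by apply: cyl_events_measurable; exact: measurable_coord.
- by rewrite bigcup_const.
- exact: cyl_events_setI.
- by move=> _ [s [C [us _ mC _ ->]]]; exact: m12.
- by move=> k; rewrite [X in (X < _)%E]probability_setT ltry.
- exact: (gen_sigma_cyl (coord_gen_sigma mA)).
Qed.

End SequenceSpace.

(** * Pasts of an i.i.d. process *)

Section Process.
Context {dS : measure_display} (S : measurableType dS) (R : realType).
Context d (T : measurableType d) (P : probability T R).

Definition iid_law (I : eqType) (mu : probability S R) (X : I -> T -> S) :=
  mutually_independent P X /\ forall i B, measurable B -> P (X i @^-1` B) = mu B.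

Lemma iid_law_reindex (I J : eqType) mu (X : I -> T -> S) (h : J -> I) :
  injective h -> iid_law mu X -> iid_law mu (fun j => X (h j)).
Proof.
move=> hinj [[mX iX] lX]; split; last by move=> j B; exact: lX.
split=> [j|s B us mB]; first exact: mX.
(* [B'] transports the sets along [h]: injectivity makes its value at [h j] equal to [B j], and
   [setT] is the default elsewhere. *)
pose B' i := nth setT (map B s) (index i (map h s)).
have BB' j : j \in s -> B' (h j) = B j.
  by move=> js; rewrite /B' index_map// (nth_map j) ?index_mem// nth_index.
have mB' i : measurable (B' i).
  have [sz|sz] := ltnP (index i (map h s)) (size (map B s)); last first.
    by rewrite /B' nth_default.
  by rewrite /B'; have /mapP[j _ ->] := mem_nth setT sz; exact: mB.
have -> : \bigcap_(j in [set` s]) (X (h j) @^-1` B j) =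
    \bigcap_(i in [set` map h s]) (X i @^-1` B' i).
  apply/seteqP; split=> w H; last first.
    by move=> j js; rewrite -BB'//; apply: H; exact: map_f.
  by move=> _ /mapP[j js ->]; rewrite BB'//; exact: H.
rewrite iX ?map_inj_uniq// big_map; apply: eq_big_seq => j js.
by rewrite BB'.
Qed.

Definition past (X : int -> T -> S) (k : int) (w : T) : seqspace S :=
  fun j => X (k - j%:Z) w.

Variables (mu : probability S R) (X : int -> T -> S).
Hypothesis HX : iid_law mu X.

Lemma measurable_past k : measurable_fun setT (past X k).
Proof. by apply: measurable_seqspace => j; exact: HX.1.1. Qed.

Lemma past_consE k w : past X k w = scons (X k w) (past X (k - 1) w).
Proof.
apply/funext => -[|j]; rewrite /past/= ?subr0//.
by congr (X _ w); rewrite -addn1 PoszD; ring.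
Qed.

Lemma stail_past k w : stail (past X k w) = past X (k - 1) w.
Proof. by rewrite past_consE. Qed.

Lemma iter_stail_past n k w : iter n (@stail _ S) (past X k w) = past X (k - n%:Z) w.
Proof.
by apply/funext => j; rewrite iter_stail /past PoszD opprD addrA.
Qed.

Lemma past_gen_sigma k (B : set (seqspace S)) : measurable B ->
  gen_sigma X [set j | j <= k] (past X k @^-1` B).
Proof.
move: B; apply: smallest_sub.
  have := @sigma_algebra_image _ _ setT (past X k) (gen_sigma X [set j | j <= k]).
  move=> /(_ (smallest_sigma_algebra _ _)).
  by rewrite /image_set_system; congr sigma_algebra; apply/funext => B /=; rewrite setTI.
move=> _ [j [C [mC ->]]]; apply: sub_sigma_algebra.
exists (k - j%:Z), C; split => //=; lia.
Qed.

Lemma gen_sigma_past k (A : set T) : gen_sigma X [set j | j <= k] A ->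
  exists2 B : set (seqspace S), measurable B & A = past X k @^-1` B.
Proof.
move=> GA.
have : preimage_set_system setT (past X k) measurable A.
  move: A GA; apply: smallest_sub.
    apply: sigma_algebra_preimage; exact: sigma_algebra_measurable.
  move=> _ [j [C [/= jk mC ->]]]; exists (coord (absz (k - j)) @^-1` C).
    by rewrite -[X in measurable X]setTI; exact: measurable_coord.
  rewrite setTI; apply/funext => w; rewrite /coord /past /preimage /=.
  by rewrite gez0_abs ?subr_ge0// opprB addrC subrK.
by move=> [B mB <-]; exists B => //; rewrite setTI.
Qed.

Lemma past_indep k (A : set S) (B : set (seqspace S)) : measurable A -> measurable B ->
  P (X k @^-1` A `&` past X (k - 1) @^-1` B) = (P (X k @^-1` A) * P (past X (k - 1) @^-1` B))%E.
Proof.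
move=> mA mB.
apply: (@gen_sigma_indep _ _ _ _ _ _ _ X HX.1.1 HX.1 [set k] [set j | j <= k - 1]).
- by move=> i /= ->; lia.
- by apply: sub_sigma_algebra; exists k, A.
- exact: past_gen_sigma.
Qed.

End Process.


Section PastLaw.
Context {dS : measure_display} (S : measurableType dS) (R : realType).

Lemma past_cyl d (T : measurableType d) (P : probability T R) (mu : probability S R)
    (X : int -> T -> S) (HX : iid_law P mu X) k (s : seq nat) (C : nat -> set S) :
  uniq s -> (forall i, measurable (C i)) ->
  P (past X k @^-1` (\bigcap_(i in [set` s]) (coord i @^-1` C i))) =
  (\prod_(i <- s) mu (C i))%E.
Proof.
move=> us mC.
have hinj : injective (fun i : nat => k - i%:Z) by move=> i j /addrI /oppr_inj [].
have [[_ h1] h2] := iid_law_reindex hinj HX.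
rewrite -[LHS]/(P (\bigcap_(i in [set` s]) ((fun j => X (k - j%:Z)) i @^-1` C i))).
by rewrite h1//; apply: eq_bigr => i _; rewrite h2.
Qed.

Lemma past_law_eq d (T : measurableType d) (P : probability T R) (mu : probability S R)
    (X : int -> T -> S) (HX : iid_law P mu X) k
    d' (T' : measurableType d') (P' : probability T' R)
    (X' : int -> T' -> S) (HX' : iid_law P' mu X') k' A : measurable A ->
  law P (measurable_past HX k) A = law P' (measurable_past HX' k') A.
Proof.
apply: seqspace_law_unique => s C us mC.
exact: etrans (past_cyl HX k us mC) (esym (past_cyl HX' k' us mC)).
Qed.

End PastLaw.

(** * The transition operator and the shift in L2 *)

Section Transition.
Context {dS : measure_display} (S : measurableType dS) (R : realType).
Context d (T : measurableType d) (P : probability T R).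
Variables (mu : probability S R) (X : int -> T -> S).
Hypothesis HX : iid_law P mu X.

Definition past_law : probability (seqspace S) R := law P (measurable_past HX 0).
Notation nu := past_law.

Lemma past_lawE k A : measurable A -> law P (measurable_past HX k) A = nu A.
Proof. exact: past_law_eq. Qed.

Lemma past_integral k (f : seqspace S -> \bar R) : measurable_fun setT f ->
  (\int[P]_w f (past X k w) = \int[nu]_x f x)%E.
Proof.
move=> mf; rewrite -(law_integral _ (measurable_past HX k))//.
by apply: eq_measure_integral => A mA _; exact: past_lawE.
Qed.

Lemma past_Rint k (f : seqspace S -> R) : measurable_fun setT f ->
  \int[P]_w f (past X k w) = \int[nu]_x f x.
Proof.
move=> mf; rewrite /Rintegral; congr fine.
rewrite -(past_integral k (f := EFin \o f))//; exact/measurable_EFinP.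
Qed.

Lemma past_integ k (f : seqspace S -> R) : measurable_fun setT f ->
  integ P (f \o past X k) <-> integ nu f.
Proof.
move=> mf; have mF : measurable_fun setT (EFin \o f) by exact/measurable_EFinP.
have mfX : measurable_fun setT (f \o past X k).
  by apply: measurableT_comp => //; exact: measurable_past HX k.
have maF : measurable_fun setT (fun x => `|(f x)%:E|%E).
  by apply: (measurableT_comp (@abse_measurable R setT) mF).
split=> /integrableP[_ h]; apply/integrableP; split => //; do ?exact/measurable_EFinP.
  by move: h; rewrite (past_integral k (f := fun x => `|(f x)%:E|%E)).
by rewrite (past_integral k (f := fun x => `|(f x)%:E|%E)).
Qed.

Lemma past_sqi k (f : seqspace S -> R) : measurable_fun setT f ->
  sqi P (f \o past X k) <-> sqi nu f.
Proof.
move=> mf; split=> -[m i]; split=> //.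
- by apply: (past_integ k (f := fun x => f x ^+ 2) _).1 i; exact: measurable_funX.
- by apply: measurableT_comp => //; exact: measurable_past HX k.
- by apply: (past_integ k (f := fun x => f x ^+ 2) _).2 i; exact: measurable_funX.
Qed.

Lemma past_inner k (f g : seqspace S -> R) :
  measurable_fun setT f -> measurable_fun setT g ->
  inner P (f \o past X k) (g \o past X k) = inner nu f g.
Proof. by move=> mf mg; rewrite /inner -(past_Rint k)//; exact: measurable_funM. Qed.

Lemma past_norm2 k (f : seqspace S -> R) : measurable_fun setT f ->
  norm2 P (f \o past X k) = norm2 nu f.
Proof. by move=> mf; rewrite /norm2 past_inner. Qed.

Lemma mu_lawE A : measurable A -> law P (HX.1.1 1) A = mu A.
Proof. by move=> mA; rewrite -(HX.2 1). Qed.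

(** A version of the conditional expectation given the previous past, fixed at every point. Where
    the integral diverges its value is the default 0, so linearity in [f] is available only almost
    everywhere, or for bounded [f]. *)
Definition transition (f : seqspace S -> R) (x : seqspace S) : R :=
  \int[mu]_s f (scons s x).
Notation K := transition.

Let K_law (f : seqspace S -> R) x : \int[law P (HX.1.1 1)]_s f (scons s x) = K f x.
Proof.
rewrite /K /Rintegral; congr fine.
by apply: eq_measure_integral => A mA _; exact: mu_lawE.
Qed.

Let past_scons w : past X 1 w = scons (X 1 w) (past X 0 w).
Proof. by rewrite past_consE subrr. Qed.

Let cons_indep A B : measurable A -> measurable B ->
  P (X 1 @^-1` A `&` past X 0 @^-1` B) = (P (X 1 @^-1` A) * P (past X 0 @^-1` B))%E.
Proof. exact: (past_indep HX 1). Qed.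

Lemma transition_integ f : integ nu f ->
  integ nu (K f) /\ \int[nu]_x K f x = \int[nu]_x f x.
Proof.
move=> fi; have mf := integ_measurable fi.
pose F (z : S * seqspace S) := f (scons z.1 z.2).
have mF : measurable_fun setT F by exact (measurableT_comp mf (@measurable_scons _ S)).
have iF : integ P (fun w => F (X 1 w, past X 0 w)).
  have /(past_integ 1 mf) := fi; congr integrable; apply/funext => w /=.
  by rewrite past_scons.
have [h1 h2] := pair_fubini (HX.1.1 1) (measurable_past HX 0) cons_indep mF iF.
have KE : (fun y => \int[law P (HX.1.1 1)]_x F (x, y)) = K f.
  by apply/funext => x; rewrite -K_law.
rewrite KE in h1; split=> //.
rewrite -(past_Rint 1 mf); under [RHS]eq_Rintegral do rewrite past_scons.
by rewrite h2; apply: eq_Rintegral => x _; rewrite -K_law.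
Qed.

Lemma transition_ae_integ f : integ nu f ->
  {ae nu, forall x, integ mu (fun s => f (scons s x))}.
Proof.
move=> fi; have mf := integ_measurable fi.
pose F (z : S * seqspace S) := f (scons z.1 z.2).
have mF : measurable_fun setT F by exact (measurableT_comp mf (@measurable_scons _ S)).
have iF : integ P (fun w => F (X 1 w, past X 0 w)).
  have /(past_integ 1 mf) := fi; congr integrable; apply/funext => w /=.
  by rewrite past_scons.
have := ae_integrable2 (pair_integ (HX.1.1 1) (measurable_past HX 0) cons_indep mF iF).
apply: filterS => x /integrableP[m h]; apply/integrableP; split=> //.
rewrite (eq_measure_integral (law P (HX.1.1 1)))// => A mA _.
exact/esym/mu_lawE.
Qed.

Lemma Rint_ae_eq (f g : seqspace S -> R) : measurable_fun setT f -> measurable_fun setT g ->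
  {ae nu, forall x, f x = g x} -> \int[nu]_x f x = \int[nu]_x g x.
Proof.
move=> mf mg h; rewrite /Rintegral; congr fine; apply: ae_eq_integral => //.
- exact/measurable_EFinP.
- exact/measurable_EFinP.
- by apply: filterS h => x -> _.
Qed.

(** Jensen's inequality on almost every fibre gives [(K f)^2 <= K (f^2)], and [K] preserves
    integrals. *)
Lemma transition_sqi f : sqi nu f -> sqi nu (K f).
Proof.
move=> fi; have mf := sqi_measurable fi.
have [iK _] := transition_integ (sqi_integ fi).
split; first exact: integ_measurable iK.
have [iK2 _] := transition_integ fi.2.
have mK2 : measurable_fun setT (fun x => K f x ^+ 2).
  by apply: measurable_funX; exact: integ_measurable iK.
apply/integrableP; split; first exact/measurable_EFinP.
have /integrableP[_] := iK2; apply: le_lt_trans.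
apply: ae_ge0_le_integral => //.
- by apply: (measurableT_comp (@abse_measurable R setT)); exact/measurable_EFinP.
- apply: (measurableT_comp (@abse_measurable R setT)); apply/measurable_EFinP.
  exact: integ_measurable iK2.
have h2 := transition_ae_integ fi.2.
apply: filterS h2 => x h2 _ /=; rewrite lee_fin.
have fxi : sqi mu (fun s => f (scons s x)).
  split=> //; apply: measurableT_comp mf _.
  exact: (measurable_fun_pair1 x (@measurable_scons _ S)).
have := Rint_le_norm2 fxi; rewrite -/(K f x) => h3.
have h4 : K f x ^+ 2 <= inner mu (fun s => f (scons s x)) (fun s => f (scons s x)).
  by rewrite -norm2_sqr -(real_normK (num_real (K f x))) lerXn2r ?nnegrE ?norm2_ge0.
by rewrite ger0_norm ?sqr_ge0// (le_trans h4)// (le_trans _ (ler_norm _))//.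
Qed.

Definition shift (f : seqspace S -> R) : seqspace S -> R := f \o @stail _ S.
Notation U := shift.

Lemma shift_measurable f : measurable_fun setT f -> measurable_fun setT (U f).
Proof. by move=> mf; exact: measurableT_comp mf (@measurable_stail _ S). Qed.

Let U_past k f : U f \o past X k = f \o past X (k - 1).
Proof. by apply/funext => w /=; rewrite /U /= stail_past. Qed.

Lemma shift_sqi f : sqi nu f -> sqi nu (U f).
Proof.
move=> fi; have mf := sqi_measurable fi.
apply/(past_sqi 0); first exact: shift_measurable.
by rewrite U_past; apply/past_sqi.
Qed.

Lemma shift_inner f g : sqi nu f -> sqi nu g -> inner nu (U f) (U g) = inner nu f g.
Proof.
move=> fi gi; have mf := sqi_measurable fi; have mg := sqi_measurable gi.
rewrite -(past_inner 0); [|exact: shift_measurable..].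
by rewrite !U_past past_inner.
Qed.

(** When [f * U g] is integrated over the newest coordinate, the factor [U g] does not involve it
    and comes out as [g]. *)
Lemma transition_adjoint f g : sqi nu f -> sqi nu g ->
  inner nu (K f) g = inner nu f (U g).
Proof.
move=> fi gi; have Ugi := shift_sqi gi.
have fgi := sqi_mul_integ fi Ugi.
have [iK eK] := transition_integ fgi.
rewrite /inner -eK; apply: Rint_ae_eq.
- by apply: measurable_funM; [exact: sqi_measurable (transition_sqi fi)|exact: sqi_measurable gi].
- exact: integ_measurable iK.
have := transition_ae_integ (sqi_integ fi); apply: filterS => x fx.
by rewrite -RintegralZr.
Qed.

Lemma transition_shift f x : K (U f) x = f x.
Proof. by rewrite /K /U /=; under eq_Rintegral do rewrite stail_cons; rewrite Rint_cst. Qed.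

End Transition.

(** * Orthogonal decomposition into innovations *)

Section Innovations.
Context {dS : measure_display} (S : measurableType dS) (R : realType).
Context d (T : measurableType d) (P : probability T R).
Variables (mu : probability S R) (X : int -> T -> S).
Hypothesis HX : iid_law P mu X.
Local Notation nu := (past_law HX).
Local Notation K := (transition mu).
Local Notation U := (@shift _ S R).
Implicit Types f g h : seqspace S -> R.

Lemma iter_transition_sqi j f : sqi nu f -> sqi nu (iter j K f).
Proof. by move=> fi; elim: j => //= j IH; exact: transition_sqi. Qed.

Lemma iter_shift_sqi j f : sqi nu f -> sqi nu (iter j U f).
Proof. by move=> fi; elim: j => //= j IH; exact: shift_sqi. Qed.

Lemma iter_shiftE j f x : iter j U f x = f (iter j (@stail _ S) x).
Proof. by elim: j f x => // j IH f x; rewrite iterSr IH /= /shift /=. Qed.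

Lemma iter_shift_inner j f g : sqi nu f -> sqi nu g ->
  inner nu (iter j U f) (iter j U g) = inner nu f g.
Proof.
move=> fi gi; elim: j => //= j IH.
by rewrite shift_inner//; exact: iter_shift_sqi.
Qed.

Lemma iter_shift_norm2 j f : sqi nu f -> norm2 nu (iter j U f) = norm2 nu f.
Proof. by move=> fi; rewrite /norm2 iter_shift_inner. Qed.

Lemma iter_transition_adjoint j f g : sqi nu f -> sqi nu g ->
  inner nu (iter j K f) g = inner nu f (iter j U g).
Proof.
move=> fi gi; elim: j g gi => //= j IH g gi.
rewrite transition_adjoint//; last exact: iter_transition_sqi.
rewrite IH; last exact: shift_sqi.
by congr inner; exact: esym (iterSr j U g).
Qed.

(** The contraction property is stated for differences because [K] is not linear at every point.
    Duality moves the power of [K] to the isometry [U^j] acting on the test function. *)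
Lemma iter_transition_lip j f g : sqi nu f -> sqi nu g ->
  norm2 nu (fun x => iter j K f x - iter j K g x) <= norm2 nu (fun x => f x - g x).
Proof.
move=> fi gi; apply: norm2_le_dual => [||h hi].
- exact: norm2_ge0.
- by apply: sqiB; exact: iter_transition_sqi.
have Uhi := iter_shift_sqi j hi.
rewrite innerBl ?iter_transition_adjoint//; [|exact: iter_transition_sqi..].
rewrite -innerBl// -(iter_shift_norm2 j hi).
by apply: le_trans (ler_norm _) (inner_le _ _) => //; exact: sqiB.
Qed.

Lemma iter_transition_cst j (c : R) : iter j K (fun _ => c) = fun _ => c.
Proof. by elim: j => //= j ->; apply/funext => x; rewrite /transition Rint_cst. Qed.

Lemma iter_transition_norm2 j f : sqi nu f -> norm2 nu (iter j K f) <= norm2 nu f.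
Proof.
move=> fi; have := iter_transition_lip j fi (sqi_cst _ 0).
rewrite iter_transition_cst.
have sub0 g : (fun x => g x - 0) = g by apply/funext => x; rewrite subr0.
by rewrite !sub0.
Qed.

(** The orthogonal projection onto the complement of the range of [U], that is, the part of [f]
    contributed by the newest innovation. *)
Definition innov f : seqspace S -> R := fun x => f x - U (K f) x.
Local Notation Q := innov.

Lemma innov_sqi f : sqi nu f -> sqi nu (Q f).
Proof. by move=> fi; apply: sqiB => //; apply: shift_sqi; exact: transition_sqi. Qed.

Lemma innov_adjoint f h : sqi nu f -> sqi nu h -> inner nu (Q f) h = inner nu f (Q h).
Proof.
move=> fi hi; have Kf := transition_sqi fi; have Kh := transition_sqi hi.
have UKf := shift_sqi Kf; have UKh := shift_sqi Kh.
rewrite innerBl// (innerC _ f (Q h)) innerBl// (innerC _ h f).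
rewrite (innerC _ (U (K f)) h) -transition_adjoint// (innerC _ (U (K h)) f).
by rewrite -(transition_adjoint fi Kh) (innerC _ (K h)).
Qed.

Lemma innov_orth f h : sqi nu f -> sqi nu h -> inner nu (Q f) (U h) = 0.
Proof.
move=> fi hi; have Kf := transition_sqi fi.
have UKf := shift_sqi Kf; have Uh := shift_sqi hi.
by rewrite innerBl// shift_inner// transition_adjoint// subrr.
Qed.

Lemma innov_norm2 f : sqi nu f -> norm2 nu (Q f) <= norm2 nu f.
Proof.
move=> fi; have Qi := innov_sqi fi; have UKi := shift_sqi (transition_sqi fi).
apply: norm2_le; first exact: norm2_ge0.
have Ki := transition_sqi fi; rewrite norm2_sqr.
have -> : inner nu (Q f) (Q f) = inner nu f f - inner nu (K f) (K f).
  rewrite {1}/innov innerBl// (innerC _ (U (K f))) innov_orth// subr0.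
  rewrite innerC innerBl// (innerC _ (U (K f))) -transition_adjoint//.
by rewrite gerBl inner_ge0.
Qed.

(* With [f] evaluated at the past of time [j], this is the norm of
   E[f | F_0] - E[f | F_(-1)], the projection of [f] on the innovation at time 0. *)
Definition innov_coef j f : R := norm2 nu (Q (iter j K f)).

Lemma innov_coef_ge0 j f : 0 <= innov_coef j f. Proof. exact: norm2_ge0. Qed.

Lemma innov_coef_le j f : sqi nu f -> innov_coef j f <= norm2 nu f.
Proof.
move=> fi; rewrite (le_trans (innov_norm2 _))// ?iter_transition_norm2//.
exact: iter_transition_sqi.
Qed.

(** Once all operators act on the test function, the pairing is linear in [f]; sublinearity of
    [innov_coef] follows without pointwise linearity of [K]. *)
Lemma innov_coef_dual j f h : sqi nu f -> sqi nu h ->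
  inner nu (Q (iter j K f)) h = inner nu f (iter j U (Q h)).
Proof.
move=> fi hi; have Qh := innov_sqi hi; rewrite innov_adjoint//; last exact: iter_transition_sqi.
by rewrite iter_transition_adjoint.
Qed.

Lemma innov_coef_sum j (I : Type) (s : seq I) (c : I -> R) (f : I -> seqspace S -> R) :
  (forall i, sqi nu (f i)) ->
  innov_coef j (fun x => \sum_(i <- s) c i * f i x) <= \sum_(i <- s) `|c i| * innov_coef j (f i).
Proof.
move=> fi; have cfi i : sqi nu (fun x => c i * f i x) by exact: sqiZ.
have si : sqi nu (fun x => \sum_(i <- s) c i * f i x) by apply: sqi_sum => i _.
apply: norm2_le_dual => [||h hi].
- by apply: sumr_ge0 => i _; rewrite mulr_ge0// innov_coef_ge0.
- by apply: innov_sqi; exact: iter_transition_sqi.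
have hi' := iter_shift_sqi j (innov_sqi hi).
rewrite innov_coef_dual// inner_suml// mulr_suml; apply: ler_sum => i _.
rewrite innerZl// -innov_coef_dual// (le_trans (ler_norm _))// normrM -mulrA ler_wpM2l//.
by apply: inner_le => //; apply: innov_sqi; exact: iter_transition_sqi.
Qed.

Lemma innov_coefZ j c f : sqi nu f -> innov_coef j (fun x => c * f x) <= `|c| * innov_coef j f.
Proof.
move=> fi; have := @innov_coef_sum j unit [:: tt] (fun _ => c) (fun _ => f) (fun _ => fi).
rewrite big_seq1.
have -> : (fun x => \sum_(i <- [:: tt]) c * f x) = (fun x => c * f x) by
  apply/funext => x; rewrite big_seq1.
by [].
Qed.

Lemma innov_coefB j f g : sqi nu f -> sqi nu g ->
  innov_coef j (fun x => f x - g x) <= innov_coef j f + innov_coef j g.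
Proof.
move=> fi gi; pose c (b : bool) : R := if b then 1 else -1.
have E (w : bool -> R) : \sum_(b <- [:: true; false]) `|c b| * w b = w true + w false.
  by rewrite !big_cons big_nil /= normr1 normrN1 !mul1r addr0.
have fg (b : bool) : sqi nu (if b then f else g) by case: b.
have := innov_coef_sum j [:: true; false] c fg; rewrite (E (fun b => innov_coef j (if b then f else g))).
have -> : (fun x => \sum_(i <- [:: true; false]) c i * (if i then f else g) x) =
    (fun x => f x - g x).
  by apply/funext => x; rewrite !big_cons big_nil /= mul1r mulN1r addr0.
by [].
Qed.

Lemma innov_telescope J f x :
  f x = \sum_(j < J) iter j U (Q (iter j K f)) x + iter J U (iter J K f) x.
Proof.
elim: J => [|J IH]; first by rewrite big_ord0 add0r.
rewrite big_ord_recr /= {1}IH -addrA; congr (_ + _).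
by rewrite !iter_shiftE -iterS -[in RHS]iter_shiftE iterSr !iter_shiftE /innov /= subrK.
Qed.

(** After the smaller power of the isometry [U] is removed from both sides, an innovation is paired
    with a function in the range of [U]. *)
Lemma innov_sum_orth (n j : nat) (g : nat -> seqspace S -> R) : (forall i, sqi nu (g i)) ->
  norm2 nu (fun x => \sum_(i < n) iter (i + j) U (Q (g i)) x) =
  Num.sqrt (\sum_(i < n) norm2 nu (Q (g i)) ^+ 2).
Proof.
move=> gi; rewrite {1}/norm2; congr Num.sqrt.
have Qi i : sqi nu (Q (g i)) by exact: innov_sqi.
have UQi i k : sqi nu (iter k U (Q (g i))) by exact: iter_shift_sqi.
have ort a b (i k : nat) : (a < b)%N ->
    inner nu (iter a U (Q (g i))) (iter b U (Q (g k))) = 0.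
  move=> ab; rewrite -(subnKC ab) addSnnS iterD iter_shift_inner//.
  by rewrite iterS innov_orth.
rewrite inner_suml; [|by []|by apply: sqi_sum].
apply: eq_bigr => i _; rewrite innerC inner_suml//.
rewrite (bigD1 i)//= big1 ?addr0; first by rewrite iter_shift_inner// norm2_sqr.
move=> k ki; have [ik|ik] : (k < i)%N \/ (i < k)%N.
- by apply/orP; rewrite -neq_ltn.
- by rewrite ort ?ltn_add2r.
- by rewrite innerC ort ?ltn_add2r.
Qed.

(** The terms are regrouped by the age [j] of the innovation. At a fixed age the summands sit at
    distinct times and are orthogonal; the triangle inequality is spent only on the sum over [j] and
    on the remainders. *)
Lemma innov_sum_bound (n J : nat) (g : nat -> seqspace S -> R) : (forall i, sqi nu (g i)) ->
  norm2 nu (fun x => \sum_(i < n) iter i U (g i) x) <=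
  \sum_(j < J) Num.sqrt (\sum_(i < n) innov_coef j (g i) ^+ 2) +
  \sum_(i < n) norm2 nu (iter J K (g i)).
Proof.
move=> gi.
have Ki i j : sqi nu (iter j K (g i)) by exact: iter_transition_sqi.
have -> : (fun x => \sum_(i < n) iter i U (g i) x) =
  (fun x => (\sum_(j < J) \sum_(i < n) iter (i + j) U (Q (iter j K (g i))) x)
            + \sum_(i < n) iter (i + J) U (iter J K (g i)) x).
  apply/funext => x; rewrite exchange_big -big_split; apply: eq_bigr => i _ /=.
  rewrite iter_shiftE (innov_telescope J); congr (_ + _).
    by apply: eq_bigr => j _; rewrite iterD [RHS]iter_shiftE.
  by rewrite iterD [RHS]iter_shiftE.
have i1 : sqi nu (fun x => \sum_(j < J) \sum_(i < n) iter (i + j) U (Q (iter j K (g i))) x).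
  by apply: sqi_sum => j _; apply: sqi_sum => i _; apply: iter_shift_sqi; exact: innov_sqi.
have i2 i k : sqi nu (iter k U (iter J K (g i))) by exact: iter_shift_sqi.
rewrite (le_trans (norm2D _ _))//; first by apply: sqi_sum.
rewrite lerD//.
  rewrite (le_trans (norm2_sum _ _))//.
    by move=> j _; apply: sqi_sum => i _; apply: iter_shift_sqi; exact: innov_sqi.
  by apply: ler_sum => j _; rewrite (innov_sum_orth _ _ (fun i => Ki i j)).
rewrite (le_trans (norm2_sum _ _))//.
by apply: ler_sum => i _; rewrite iter_shift_norm2.
Qed.

End Innovations.

Import HBNNSimple.

(** * Density of bounded functions of finitely many innovations *)

Section L2Approximation.
Context d (T : measurableType d) (R : realType) (P : probability T R).
Implicit Types f g h : T -> R.

Lemma cvg_norm_le (u : nat -> R) l C : u n @[n --> \oo] --> l ->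
  (forall n, `|u n| <= C) -> `|l| <= C.
Proof.
move=> /cvg_norm ul uC; rewrite -(cvg_lim _ ul)//.
by apply: limr_le; [apply/cvg_ex; exists (`|l|)|exact: nearW].
Qed.

Lemma Rint_dominated (f_ : nat -> T -> R) f g :
  (forall n, measurable_fun setT (f_ n)) -> (forall x, f_ n x @[n --> \oo] --> f x) ->
  integ P g -> (forall n x, `|f_ n x| <= g x) ->
  \int[P]_x f_ n x @[n --> \oo] --> \int[P]_x f x.
Proof.
move=> mf cf ig fg.
have mlim : measurable_fun setT f by apply: measurable_fun_cvg => // x _; exact: cf.
have fle x : `|f x| <= g x by exact: cvg_norm_le (cf x) (fg^~ x).
have ifi : integ P f by exact: integ_le mlim fle ig.
apply: fine_cvg; rewrite fineK; last exact: integrable_fin_num.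
apply: (@dominated_cvg _ _ _ P setT measurableT _ _ (EFin \o g)) => //.
- by move=> n; exact/measurable_EFinP.
- by move=> x _; apply: cvg_EFin; [exact: nearW|exact: cf].
- by move=> n x _ /=; rewrite lee_fin.
Qed.

Lemma norm2_dominated (f_ : nat -> T -> R) f g :
  (forall n, measurable_fun setT (f_ n)) -> (forall x, f_ n x @[n --> \oo] --> f x) ->
  sqi P g -> (forall n x, `|f_ n x| <= g x) ->
  norm2 P (fun x => f x - f_ n x) @[n --> \oo] --> (0 : R).
Proof.
move=> mf cf ig fg.
have mlim : measurable_fun setT f by apply: measurable_fun_cvg => // x _; exact: cf.
have fle x : `|f x| <= g x by exact: cvg_norm_le (cf x) (fg^~ x).
rewrite -(sqrtr0 R); apply: continuous_cvg; first exact: sqrt_continuous.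
have -> : (0 : R) = \int[P]_x (0 : R) by rewrite Rint_cst.
apply: (@Rint_dominated _ _ (fun x => (2 * g x) ^+ 2)).
- by move=> n; apply: measurable_funM; apply: measurable_funB.
- move=> x; rewrite -(mulr0 (0 : R)); apply: cvgM;
    by rewrite -(subrr (f x)); apply: cvgB; [exact: cvg_cst|exact: cf].
- exact: (sqiZ 2 ig).2.
- move=> n x; rewrite -expr2 normrX lerXn2r ?nnegrE//.
    by rewrite mulr_ge0// (le_trans _ (fle x)).
  by rewrite (le_trans (ler_normB _ _))// mulr2n mulrDl mul1r lerD.
Qed.

Lemma sqi_indic B : measurable B -> sqi P (\1_B : T -> R).
Proof.
move=> mB; apply: (@sqi_bounded _ _ _ _ _ 1); first exact: measurable_indic.
by move=> x; rewrite indicE; case: (_ \in _); rewrite ?normr1 ?normr0.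
Qed.

(** Closure in L2 norm plays the part of monotone limits: the simple functions increasing to a
    nonnegative [f] are dominated by [f] and hence converge to it in L2. *)
Lemma sqi_induction (A : (T -> R) -> Prop) :
  (forall B, measurable B -> A (\1_B)) ->
  (forall f g, sqi P f -> sqi P g -> A f -> A g -> A (fun x => f x + g x)) ->
  (forall c f, sqi P f -> A f -> A (fun x => c * f x)) ->
  (forall f, sqi P f ->
     (forall e, 0 < e -> exists g, [/\ sqi P g, A g & norm2 P (fun x => f x - g x) <= e]) ->
     A f) ->
  forall f, sqi P f -> A f.
Proof.
move=> A1 AD AZ Acl.
have Asum (s : seq R) (F : R -> T -> R) : (forall i, sqi P (F i)) -> (forall i, A (F i)) ->
    A (fun x => \sum_(i <- s) F i x).
  move=> Fi AF; elim: s => [|r s IH].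
    have := AZ 0 _ (sqi_indic measurableT) (A1 _ measurableT).
    by congr A; apply/funext => x; rewrite big_nil mul0r.
  have := AD _ _ (Fi r) _ (AF r) IH; rewrite (_ : (fun x => F r x + _) =
    (fun x => \sum_(i <- r :: s) F i x)); last by apply/funext => x; rewrite big_cons.
  by apply; apply: sqi_sum.
have Annsfun (h : {nnsfun T >-> R}) : A h.
  have -> : (h : T -> R) = (fun x => \sum_(y <- finmap.enum_fset (fset_set (range h)))
      y * \1_(h @^-1` [set y]) x).
    by apply/funext => x; rewrite {1}fimfunE fsbig_finite//; exact: fimfunP.
  have mh y : measurable (h @^-1` [set y]) by exact: measurable_sfunP.
  apply: Asum => y; first by apply: sqiZ; exact: sqi_indic.
  by apply: AZ; [exact: sqi_indic|exact: A1].
have Age0 f : (forall x, 0 <= f x) -> sqi P f -> A f.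
  move=> f0 fi; apply: (Acl _ fi) => e e0.
  have mf : measurable_fun setT (EFin \o f) by apply/measurable_EFinP; case: fi.
  pose g n : T -> R := nnsfun_approx measurableT mf n.
  have cg x : g n x @[n --> \oo] --> f x.
    have f0' y : setT y -> (0 <= (EFin \o f) y)%E by rewrite lee_fin.
    by have /fine_cvgP[] := cvg_nnsfun_approx measurableT mf f0' (Logic.I : setT x).
  have gle n x : g n x <= f x.
    have nd : nondecreasing_seq (g ^~ x).
      by move=> a b ab; have /lefP := nd_nnsfun_approx measurableT mf ab; exact.
    rewrite -(cvg_lim _ (cg x))//; apply: nondecreasing_cvgn_le => //.
    by apply/cvg_ex; exists (f x); exact: cg.
  have mg n : measurable_fun setT (g n) by exact: measurable_funP.
  have gabs n x : `|g n x| <= f x by rewrite ger0_norm ?gle//; exact: fun_ge0.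
  have := norm2_dominated mg cg fi gabs.
  move=> /cvgrPdist_le /(_ _ e0) [N _ /(_ N (leqnn N))].
  rewrite sub0r normrN ger0_norm ?norm2_ge0// => h.
  exists (g N); split => //; first exact: sqi_le (mg N) (gabs N) fi.
  exact: Annsfun.
move=> f fi; have mf := sqi_measurable fi.
have mp : measurable_fun setT (fun x => Num.max (f x) 0) by exact: measurable_maxr.
have mn : measurable_fun setT (fun x => Num.max (- f x) 0).
  by apply: measurable_maxr => //; exact: measurableT_comp.
have fi' : sqi P (fun x => `|f x|).
  split; first exact: measurableT_comp.
  have := fi.2; congr integrable; apply/funext => x /=.
  by rewrite real_normK ?num_real.
have ip : sqi P (fun x => Num.max (f x) 0).
  apply: sqi_le mp _ fi' => x; rewrite ger0_norm ?le_max ?lexx ?orbT//.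
  by rewrite ge_max ler_norm normr_ge0.
have in_ : sqi P (fun x => Num.max (- f x) 0).
  apply: sqi_le mn _ fi' => x; rewrite ger0_norm ?le_max ?lexx ?orbT//.
  by rewrite ge_max -normrN ler_norm normr_ge0.
have -> : f = (fun x => Num.max (f x) 0 + (-1) * Num.max (- f x) 0).
  by apply/funext => x; rewrite mulN1r; case: (ltP (f x) 0); case: (ltP (- f x) 0); lra.
apply: AD => //; first exact: sqiZ.
- by apply: Age0 ip => x; rewrite le_max lexx orbT.
- by apply: AZ => //; apply: Age0 in_ => x; rewrite le_max lexx orbT.
Qed.

End L2Approximation.

Section CylinderApproximation.
Context {dS : measure_display} (S : measurableType dS) (R : realType).

Definition depends_on (m : nat) (f : seqspace S -> R) : Prop :=
  forall x y, (forall j, (j < m)%N -> x j = y j) -> f x = f y.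

Definition bounded_cylinder (m : nat) (f : seqspace S -> R) : Prop :=
  [/\ measurable_fun setT f, depends_on m f & exists C, forall x, `|f x| <= C].

Lemma bounded_cylinder_widen m m' f : (m <= m')%N ->
  bounded_cylinder m f -> bounded_cylinder m' f.
Proof.
by move=> mm' [mf df bf]; split=> // x y xy; apply: df => j jm; apply: xy; exact: leq_trans mm'.
Qed.

Lemma bounded_cylinderD m f g : bounded_cylinder m f -> bounded_cylinder m g ->
  bounded_cylinder m (fun x => f x + g x).
Proof.
move=> [mf df [C fC]] [mg dg [D gD]]; split.
- exact: measurable_funD.
- by move=> x y xy; rewrite (df x y)// (dg x y).
- by exists (C + D) => x; rewrite (le_trans (ler_normD _ _))// lerD.
Qed.

Lemma bounded_cylinderZ m c f : bounded_cylinder m f -> bounded_cylinder m (fun x => c * f x).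
Proof.
move=> [mf df [C fC]]; split.
- exact: measurable_funM.
- by move=> x y xy; rewrite (df x y).
- by exists (`|c| * C) => x; rewrite normrM ler_wpM2l.
Qed.

Lemma bounded_cylinder_cst m c : bounded_cylinder m (fun _ => c).
Proof. by split=> //; exists `|c|. Qed.

Variable nu : probability (seqspace S) R.

Lemma bounded_cylinder_sqi m f : bounded_cylinder m f -> sqi nu f.
Proof. by move=> [mf _ [C fC]]; exact: sqi_bounded mf fC. Qed.

Definition cyl_approx (f : seqspace S -> R) : Prop := forall e, 0 < e ->
  exists m g, bounded_cylinder m g /\ norm2 nu (fun x => f x - g x) <= e.

Lemma cyl_approxD f g : sqi nu f -> sqi nu g -> cyl_approx f -> cyl_approx g ->
  cyl_approx (fun x => f x + g x).
Proof.
move=> fi gi Af Ag e e0; have e20 : 0 < e / 2 by rewrite divr_gt0.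
have [m [f' [cf hf]]] := Af _ e20; have [m' [g' [cg hg]]] := Ag _ e20.
exists (maxn m m'), (fun x => f' x + g' x); split.
  by apply: bounded_cylinderD; [apply: bounded_cylinder_widen cf|apply: bounded_cylinder_widen cg];
    rewrite ?leq_maxl ?leq_maxr.
have fi' := bounded_cylinder_sqi cf; have gi' := bounded_cylinder_sqi cg.
rewrite (_ : (fun x => _) = (fun x => (f x - f' x) + (g x - g' x))); last first.
  by apply/funext => x; ring.
rewrite (splitr e) (le_trans (norm2D _ _)) ?lerD//; exact: sqiB.
Qed.

Lemma cyl_approxZ c f : sqi nu f -> cyl_approx f -> cyl_approx (fun x => c * f x).
Proof.
move=> fi Af e e0; have c0 : 0 < `|c| + 1 by rewrite ltr_wpDl.
have [m [g [cg hg]]] := Af _ (divr_gt0 e0 c0).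
exists m, (fun x => c * g x); split; first exact: bounded_cylinderZ.
have gi := bounded_cylinder_sqi cg.
under [X in norm2 _ X]eq_fun do rewrite -mulrBr.
rewrite norm2Z; last exact: sqiB.
rewrite (le_trans (ler_wpM2l _ hg))// mulrCA -[leRHS]mulr1 ler_wpM2l ?(ltW e0)//.
by rewrite ler_pdivrMr// mul1r lerDl.
Qed.

Lemma cyl_approx_closed f : sqi nu f ->
  (forall e, 0 < e -> exists g, [/\ sqi nu g, cyl_approx g & norm2 nu (fun x => f x - g x) <= e]) ->
  cyl_approx f.
Proof.
move=> fi h e e0; have e20 : 0 < e / 2 by rewrite divr_gt0.
have [g [gi Ag hg]] := h _ e20; have [m [g' [cg hg']]] := Ag _ e20.
have gi' := bounded_cylinder_sqi cg.
exists m, g'; split => //.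
rewrite (_ : (fun x => _) = (fun x => (f x - g x) + (g x - g' x))); last first.
  by apply/funext => x; ring.
rewrite (splitr e) (le_trans (norm2D _ _)) ?lerD//; exact: sqiB.
Qed.

Lemma cyl_approx_bounded_cylinder m f : bounded_cylinder m f -> cyl_approx f.
Proof.
move=> cf e e0; exists m, f; split=> //.
by under [X in norm2 _ X]eq_fun do rewrite subrr; rewrite norm2_cst normr0 ltW.
Qed.

(** Dynkin induction from cylinders. In the step for a disjoint union, the partial sums of
    indicators are bounded by 1 and converge in L2 to the indicator of the union. *)
Lemma cyl_approx_indic (B : set (seqspace S)) : measurable B -> cyl_approx (\1_B).
Proof.
move=> mB; move: {mB}(gen_sigma_cyl (coord_gen_sigma mB)); move: B.
apply: (@dynkin_induction _ (seqspace S) (cyl_events (@coord _ S) setT)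
  (fun B => cyl_approx (\1_B))).
- apply/seteqP; split; first by move=> B mB; exact: gen_sigma_cyl (coord_gen_sigma mB).
  apply: smallest_sub; first exact: sigma_algebra_measurable.
  by apply: cyl_events_measurable; exact: measurable_coord.
- exact: cyl_events_setI.
- by rewrite indicT; apply: (@cyl_approx_bounded_cylinder 0); exact: bounded_cylinder_cst.
- move=> B HB; have mB : measurable B.
    by move: HB; apply: cyl_events_measurable; exact: measurable_coord.
  have [s [C [us _ mC CT BE]]] := HB.
  apply: (@cyl_approx_bounded_cylinder (\max_(i <- s) i).+1); split.
  + exact: measurable_indic.
  + move=> x y xy; rewrite !indicE; congr (_ : bool)%:R.
    have E j : j \in s -> x j = y j by move=> js; apply: xy; rewrite ltnS leq_bigmax_seq.
    rewrite BE; apply/idP/idP; rewrite !inE => h i /= is_; rewrite /coord /=.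
      by rewrite -E//; exact: h.
    by rewrite E//; exact: h.
  + by exists 1 => x; rewrite indicE; case: (_ \in _); rewrite ?normr1 ?normr0.
- move=> B mB AB.
  rewrite (_ : \1_ _ = (fun x => 1 + (-1) * (\1_B x : R))).
    apply: cyl_approxD; [exact: sqi_cst|by apply: sqiZ; exact: sqi_indic|..].
      by apply: (@cyl_approx_bounded_cylinder 0); exact: bounded_cylinder_cst.
    by apply: cyl_approxZ => //; exact: sqi_indic.
  by apply/funext => x; rewrite !indicE in_setC; case: (x \in B) => /=; ring.
- move=> F mF tF AF.
  have mU : measurable (\bigcup_k F k) by exact: bigcup_measurable.
  apply: cyl_approx_closed => [|e e0]; first exact: sqi_indic.
  pose s n x : R := \sum_(k < n) \1_(F k) x.
  have si n : sqi nu (s n) by apply: sqi_sum => i _; exact: sqi_indic.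
  have sE n x : s n x = \1_(\bigcup_(k in `I_n) F k) x.
    have [[k /= kn Fkx]|h] := pselect ((\bigcup_(k in `I_n) F k) x).
      rewrite indicE mem_set; last by exists k.
      rewrite /s (bigD1 (Ordinal kn))//= big1; first by rewrite indicE mem_set// addr0.
      move=> i /eqP ik; rewrite indicE memNset// => Fix; apply: ik; apply/val_inj => /=.
      by apply: (tF i k) => //; exists x.
    rewrite indicE memNset// /s big1// => i _; rewrite indicE memNset// => Fix.
    by apply: h; exists i => //=.
  have sle n x : `|s n x| <= 1.
    by rewrite sE indicE; case: (_ \in _); rewrite ?normr1 ?normr0.
  have scvg x : s n x @[n --> \oo] --> (\1_(\bigcup_k F k) x : R).
    have [[k _ Fkx]|h] := pselect ((\bigcup_k F k) x).
      rewrite indicE mem_set; last by exists k.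
      apply: cvg_near_cst; exists k.+1 => // n /= kn.
      by rewrite sE indicE mem_set//; exists k.
    rewrite indicE memNset//; apply: cvg_near_cst; apply: nearW => n.
    by rewrite sE indicE memNset// => -[k _ Fkx]; apply: h; exists k.
  have := norm2_dominated (fun n => sqi_measurable (si n)) scvg (sqi_cst nu 1) sle.
  move=> /cvgrPdist_le /(_ _ e0) [N _ /(_ N (leqnn N))].
  rewrite sub0r normrN ger0_norm ?norm2_ge0// => h.
  exists (s N); split => //; rewrite /s; elim: N {h} => [|N IH].
    under eq_fun do rewrite big_ord0.
    by apply: (@cyl_approx_bounded_cylinder 0); exact: bounded_cylinder_cst.
  under eq_fun do rewrite big_ord_recr /=.
  by apply: cyl_approxD => //; [exact: si|exact: sqi_indic].
Qed.

Lemma sqi_cyl_approx f : sqi nu f -> cyl_approx f.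
Proof.
apply: (@sqi_induction _ _ _ nu cyl_approx).
- exact: cyl_approx_indic.
- exact: cyl_approxD.
- exact: cyl_approxZ.
- exact: cyl_approx_closed.
Qed.

End CylinderApproximation.

(** * Triviality of the remote past *)

Section TailDecay.
Context {dS : measure_display} (S : measurableType dS) (R : realType).
Context d (T : measurableType d) (P : probability T R).
Variables (mu : probability S R) (X : int -> T -> S).
Hypothesis HX : iid_law P mu X.
Local Notation nu := (past_law HX).
Local Notation K := (transition mu).

(** Integrating out coordinate 0 renumbers the remaining ones, so one coordinate of dependence is
    lost at each step. *)
Lemma transition_bounded_cylinder m f : bounded_cylinder m f ->
  bounded_cylinder m.-1 (K f).
Proof.
move=> cf; have [mf df [C fC]] := cf; split.
- exact: sqi_measurable (transition_sqi (bounded_cylinder_sqi nu cf)).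
- move=> x y xy; apply: eq_Rintegral => s _; apply: df => -[|j] //= jm.
  by apply: xy; rewrite -ltnS (ltn_predK jm).
- exists C => x; apply: Rint_norm_le_cst => //.
  apply: measurableT_comp mf _; exact: (measurable_fun_pair1 x (@measurable_scons _ S)).
Qed.

Lemma iter_transition_cylinder j m f : bounded_cylinder m f ->
  bounded_cylinder (m - j) (iter j K f).
Proof.
by move=> cf; elim: j => [|j IH]; rewrite ?subn0// subnS; exact: transition_bounded_cylinder.
Qed.

(* Bounded cylinder functions are mapped to constants after finitely many steps and are dense,
   so the tail of the past is trivial in L2. *)
Lemma iter_transition_cvg0 f : sqi nu f -> \int[nu]_x f x = 0 ->
  forall e, 0 < e -> exists J0, forall J, (J0 <= J)%N -> norm2 nu (iter J K f) <= e.
Proof.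
move=> fi f0 e e0; have e20 : 0 < e / 2 by rewrite divr_gt0.
have [m [g [cg hg]]] := sqi_cyl_approx fi e20.
have gi := bounded_cylinder_sqi nu cg.
exists m => J mJ.
have [_ dK _] := iter_transition_cylinder J cg.
pose c := iter J K g point.
have KgE : iter J K g = fun _ => c.
  by apply/funext => x; apply: dK => j; rewrite (eqP mJ).
have h1 := le_trans (iter_transition_lip J fi gi) hg; rewrite KgE in h1.
have Ki := iter_transition_sqi J fi.
(* As [K^J f] has mean 0, [|c|] is the modulus of the mean of [K^J f - c]. *)
have h2 : `|c| <= e / 2.
  have := le_trans (Rint_le_norm2 (sqiB Ki (sqi_cst nu c))) h1.
  rewrite RintegralB//; [|exact: sqi_integ|exact: integ_cst].
  rewrite Rint_cst.
  have -> : \int[nu]_x iter J K f x = 0; last by rewrite sub0r normrN.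
  rewrite -f0; elim: {KgE h1 Ki mJ dK c} J => //= J IH.
  have := transition_integ (sqi_integ (iter_transition_sqi J fi)).
  by case=> _ ->.
rewrite (_ : iter J K f = fun x => (iter J K f x - c) + c); last first.
  by apply/funext => x; rewrite subrK.
rewrite (splitr e) (le_trans (norm2D _ _)) ?norm2_cst ?lerD//; last exact: sqi_cst.
by apply: sqiB => //; exact: sqi_cst.
Qed.

Local Notation U := (@shift _ S R).

(** For fixed [n] the remainders of [innov_sum_bound] vanish as [J] grows, by
    [iter_transition_cvg0]. The product form [a i * b j] separates the two summations: squares over
    times, a plain sum over ages. *)
Lemma innov_sum_cvg (n : nat) (g : nat -> seqspace S -> R) (a b : nat -> R) B :
  (forall i, sqi nu (g i)) -> (forall i, \int[nu]_x g i x = 0) ->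
  (forall i, 0 <= a i) -> (forall j, 0 <= b j) ->
  (forall i j, innov_coef HX j (g i) <= a i * b j) ->
  (forall J, \sum_(j < J) b j <= B) ->
  norm2 nu (fun x => \sum_(i < n) iter i U (g i) x) <= Num.sqrt (\sum_(i < n) a i ^+ 2) * B.
Proof.
move=> gi g0 a0 b0 gab bB; apply/ler_addgt0Pr => e e0.
have en0 : 0 < e / n.+1%:R by rewrite divr_gt0.
have [J HJ] : exists J, forall i, (i < n)%N -> norm2 nu (iter J K (g i)) <= e / n.+1%:R.
  have /choice[J0 HJ0] : forall i, exists J0, forall J, (J0 <= J)%N ->
      norm2 nu (iter J K (g i)) <= e / n.+1%:R.
    by move=> i; exact: iter_transition_cvg0.
  exists (\max_(i < n) J0 i) => i lin; apply: HJ0.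
  exact: (leq_bigmax (Ordinal lin)).
rewrite (le_trans (innov_sum_bound _ J gi))// lerD//.
  rewrite (@le_trans _ _ (\sum_(j < J) Num.sqrt (\sum_(i < n) a i ^+ 2) * b j))//.
    apply: ler_sum => j _; rewrite -(ger0_norm (b0 j)) -sqrtr_sqr -sqrtrM; last first.
      by apply: sumr_ge0 => i _; exact: sqr_ge0.
    rewrite ler_wsqrtr// mulr_suml; apply: ler_sum => i _; rewrite -exprMn.
    by rewrite lerXn2r ?nnegrE ?mulr_ge0 ?innov_coef_ge0.
  by rewrite -mulr_sumr ler_wpM2l// sqrtr_ge0.
rewrite (@le_trans _ _ (\sum_(i < n) e / n.+1%:R))//.
  by apply: ler_sum => i _; exact: HJ.
rewrite sumr_const card_ord -[(e / _) *+ _]mulr_natl mulrCA -[leRHS]mulr1 ler_wpM2l ?(ltW e0)//.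
by rewrite ler_pdivrMr// mul1r ler_nat.
Qed.

End TailDecay.

(** * From extended-real norms and abstract conditional expectations to [K] *)

Section L2norm.
Context d (T : measurableType d) (R : realType) (P : probability T R).

Lemma L2norm_sqr (V : T -> R) :
  (L2norm P V `^ 2 = \int[P]_x (V x ^+ 2)%:E)%E.
Proof.
rewrite poweR_Lnorm//; apply: eq_integral => x _.
by rewrite /= powR_mulrn// real_normK ?num_real.
Qed.

Lemma L2norm_sqi (V : T -> R) : measurable_fun setT V -> (L2norm P V < +oo)%E -> sqi P V.
Proof.
move=> mV /(poweR_lty 2); rewrite L2norm_sqr => h; split => //.
apply/integrableP; split; first by apply/measurable_EFinP; exact: measurable_funX.
under eq_integral do rewrite /= ger0_norm ?sqr_ge0//.
by [].
Qed.

Lemma sqi_int_sqr (V : T -> R) : sqi P V ->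
  (\int[P]_x (V x ^+ 2)%:E = (norm2 P V ^+ 2)%:E)%E.
Proof.
move=> [mV iV]; rewrite norm2_sqr /inner /Rintegral fineK; last first.
  apply: integrable_fin_num => //.
by [].
Qed.

Lemma L2norm_norm2 (V : T -> R) : sqi P V -> L2norm P V = (norm2 P V)%:E.
Proof.
move=> iV; have h := L2norm_sqr V; rewrite sqi_int_sqr// in h.
have := Lnorm_ge0 P 2%:E (EFin \o V); rewrite -/(L2norm P V).
move: h; case: (L2norm P V) => [r||]//=.
- rewrite lee_fin => -[h] r0; congr EFin.
  move: h; rewrite powR_mulrn// => /eqP; rewrite eqrXn2 ?norm2_ge0//.
  by move=> /eqP.
- by rewrite pnatr_eq0.
Qed.

End L2norm.

Section ConditionalExpectation.
Context d (T : measurableType d) (R : realType) (P : probability T R).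

(** The event where one version is strictly smaller lies in the sigma-field, and the positive
    difference integrates to 0 over it; the argument is used in both directions. *)
Lemma cond_exp_unique (G : set (set T)) (f g : T -> R) : <<s G >> `<=` measurable ->
  (forall B, measurable B -> <<s G >> (f @^-1` B)) ->
  (forall B, measurable B -> <<s G >> (g @^-1` B)) ->
  integ P f -> integ P g ->
  (forall A, <<s G >> A -> (\int[P]_(x in A) (f x)%:E = \int[P]_(x in A) (g x)%:E)%E) ->
  {ae P, forall x, f x = g x}.
Proof.
move=> Gm mf mg fi gi fg.
have key (u v : T -> R) : measurable_fun (setT : set (g_sigma_algebraType G)) u ->
    measurable_fun (setT : set (g_sigma_algebraType G)) v -> integ P u -> integ P v ->
    (forall A, <<s G >> A -> (\int[P]_(x in A) (u x)%:E = \int[P]_(x in A) (v x)%:E)%E) ->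
    {ae P, forall x, u x <= v x}.
  move=> mu mv ui vi uv; pose A := [set x | v x < u x].
  have GA : <<s G >> A.
    have := measurable_fun_ltr mv mu.
    by move=> /(_ measurableT [set true] Logic.I); rewrite setTI.
  have mA := Gm _ GA.
  have iA w : integ P w -> P.-integrable A (EFin \o w).
    by move=> wi; apply: integrableS wi.
  have h : (\int[P]_(x in A) `|(u x - v x)%:E| = 0)%E.
    rewrite (eq_integral (fun x => (u x)%:E - (v x)%:E)%E); last first.
      move=> x; rewrite inE => Ax /=; rewrite ger0_norm// subr_ge0 ltW//.
    rewrite integralB//; [|exact: iA..].
    rewrite uv// subee//; apply: integrable_fin_num => //; exact: iA.
  have muv : measurable_fun A (fun x => (u x - v x)%:E).
    apply/measurable_funTS/measurable_EFinP.
    by apply: measurable_funB; [exact: integ_measurable ui|exact: integ_measurable vi].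
  have := (ae_eq_integral_abs P mA muv).1 h.
  apply: filterS => x hx; rewrite leNgt; apply/negP => Ax.
  have [] := hx Ax; lra.
have mf' : measurable_fun (setT : set (g_sigma_algebraType G)) f.
  by move=> _ B mB; rewrite setTI; exact: mf.
have mg' : measurable_fun (setT : set (g_sigma_algebraType G)) g.
  by move=> _ B mB; rewrite setTI; exact: mg.
have h1 := key f g mf' mg' fi gi fg.
have h2 := key g f mg' mf' gi fi (fun A GA => esym (fg A GA)).
by apply: filterS2 h1 h2 => x h1 h2; apply/eqP; rewrite eq_le h1 h2.
Qed.

Context {dS : measure_display} (S : measurableType dS).
Variables (mu : probability S R) (X : int -> T -> S).
Hypothesis HX : iid_law P mu X.
Local Notation nu := (past_law HX).
Local Notation K := (transition mu).

(** An event of the sigma-field is the preimage of some [B] under [past X 0]. Seen from time [i],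
    its indicator is [U^i] applied to that of [B], so the defining identity is the adjunction
    between [K^i] and [U^i]. *)
Lemma cond_exp_transition (f : seqspace S -> R) (i : nat) (C : T -> R) :
  sqi nu f -> is_cond_exp P (gen_sigma X [set j : int | j <= 0]) (f \o past X i%:Z) C ->
  {ae P, forall w, C w = iter i K f (past X 0 w)}.
Proof.
move=> fi [fpi mC iC hC]; have Ki := iter_transition_sqi i fi.
have mK := sqi_measurable Ki.
have iK : integ P (iter i K f \o past X 0) by apply/(past_integ HX 0 mK); exact: sqi_integ.
pose G0 := [set A | exists j (B : set S),
  [/\ [set j : int | j <= 0] j, measurable B & A = X j @^-1` B]].
apply: (@cond_exp_unique G0) iC (iK) _ => //.
- exact: (gen_sigma_measurable HX.1.1).
- move=> B mB; rewrite comp_preimage.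
  apply: past_gen_sigma; rewrite -[X in measurable X]setTI; exact: mK.
move=> A GA; rewrite hC//.
have [B mB AE] := gen_sigma_past GA.
have mA : measurable A by apply: gen_sigma_measurable GA; exact: HX.1.1.
have iA w : integ P w -> P.-integrable A (EFin \o w) by move=> wi; apply: integrableS wi.
have finA w : integ P w -> (\int[P]_(x in A) (w x)%:E)%E \is a fin_num.
  by move=> wi; apply: integrable_fin_num => //; exact: iA.
rewrite -[LHS](fineK (finA _ fpi)) -[RHS](fineK (finA _ iK)).
congr EFin.
rewrite -[LHS]/(\int[P]_(x in A) (f \o past X i%:Z) x).
rewrite -[RHS]/(\int[P]_(x in A) (iter i K f \o past X 0) x) !(Rintegral_mkcond _ A).
have indE (u : T -> R) : u \_ A = (fun w => u w * \1_B (past X 0 w)).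
  apply/funext => w; rewrite patchE indicE AE.
  have -> : (w \in past X 0 @^-1` B) = (past X 0 w \in B) by apply/idP/idP; rewrite !inE.
  by case: ifP; rewrite ?mulr1 ?mulr0.
rewrite !indE.
have iB := sqi_indic nu mB.
transitivity (inner nu (iter i K f) (\1_B)); last first.
  by rewrite -(past_inner HX 0)//; exact: measurable_indic.
rewrite iter_transition_adjoint// -(past_inner HX i%:Z); last 2 first.
- exact: sqi_measurable fi.
- exact: sqi_measurable (iter_shift_sqi i iB).
apply: eq_Rintegral => w _ /=; rewrite iter_shiftE iter_stail_past.
by rewrite subrr.
Qed.

End ConditionalExpectation.

(** * Replacing the innovation at time 0 by an independent copy *)

Section StarCoupling.
Context d (T : measurableType d) (R : realType) (P : probability T R).
Context {dS : measure_display} (S : measurableType dS).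
Variables (mu : probability S R) (eps eps' : int -> T -> S).
Hypothesis HZ : iid_law P mu (fun ib : bool * int => if ib.1 then eps' ib.2 else eps ib.2).

Lemma iid_eps : iid_law P mu eps.
Proof. by have := iid_law_reindex (h := pair false) _ HZ; apply=> i j []. Qed.

Lemma iid_star : iid_law P mu (star_innov eps eps').
Proof.
have hinj : injective (fun j : int => (j == 0, j)) by move=> i j [].
have := iid_law_reindex hinj HZ; congr iid_law; apply/funext => j /=.
by rewrite /star_innov; case: eqP => // ->.
Qed.

Local Notation nu := (past_law iid_eps).
Local Notation K := (transition mu).
Local Notation Xs := (star_innov eps eps').

Lemma past_starE w : past Xs 0 w = scons (eps' 0 w) (past eps (-1) w).
Proof.
apply/funext => -[|j]; first by rewrite /past /star_innov.
rewrite /past /= /star_innov; case: eqP => [|_]; first by lia.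
by congr (eps _ w); lia.
Qed.

Lemma stail_star w : stail (past Xs 0 w) = past eps (-1) w.
Proof. by rewrite past_starE. Qed.

(** The coupled past at time 0 is built from [eps' 0] and from [eps j] with [j < 0]; it does not
    involve [eps 0]. *)
Lemma star_indep A B : measurable A -> measurable B ->
  P (eps 0 @^-1` A `&` past Xs 0 @^-1` B) = (P (eps 0 @^-1` A) * P (past Xs 0 @^-1` B))%E.
Proof.
move=> mA mB.
pose Z (ib : bool * int) := if ib.1 then eps' ib.2 else eps ib.2.
apply: (@gen_sigma_indep _ _ _ _ _ _ _ Z HZ.1.1 HZ.1 [set (false, 0)]
  [set ib | ib != (false, 0)]).
- by move=> i /= ->; rewrite eqxx.
- by apply: sub_sigma_algebra; exists (false, 0), A.
move: B mB; apply: smallest_sub.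
  have := @sigma_algebra_image _ _ setT (past Xs 0) (gen_sigma Z [set ib | ib != (false, 0)]).
  move=> /(_ (smallest_sigma_algebra _ _)).
  by rewrite /image_set_system; congr sigma_algebra; apply/funext => B /=; rewrite setTI.
move=> _ [j [C [mC ->]]]; apply: sub_sigma_algebra.
exists (j == 0%N, - j%:Z), C; split => //=; first by case: j.
apply/funext => w; rewrite /preimage /= /past sub0r /star_innov /Z /=.
by case: j => [|j] //=.
Qed.

Lemma star_Rint (f : seqspace S -> R) : measurable_fun setT f ->
  \int[P]_w f (past Xs 0 w) = \int[nu]_x f x.
Proof.
move=> mf; rewrite -(law_Rint P (measurable_past iid_star 0) mf) /Rintegral; congr fine.
by apply: eq_measure_integral => A mA _; exact: past_law_eq.
Qed.

Lemma star_sqi (f : seqspace S -> R) : sqi nu f -> sqi P (f \o past Xs 0).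
Proof.
move=> [mf /integrableP[_ fi]].
apply/(sqi_law P (measurable_past iid_star 0)) => //; split => //.
apply/integrableP; split; first by apply/measurable_EFinP; exact: measurable_funX.
rewrite (eq_measure_integral nu)// => A mA _; exact: past_law_eq.
Qed.

(* [g(past)] and [g(past of the coupled process)] are conditionally independent copies given
   the common past, so their distance is controlled from below by the innovation. *)
Lemma star_inner (g : seqspace S -> R) : sqi nu g ->
  inner P (g \o past Xs 0) (g \o past eps 0) = inner nu (K g) (K g).
Proof.
move=> gi; have mg := sqi_measurable gi; have gsi := star_sqi gi.
have gpi : sqi P (g \o past eps 0) by apply/(past_sqi iid_eps 0 mg).
have Kgi := transition_sqi gi.
have mc : measurable_fun setT (fun z : S * seqspace S => scons z.1 (stail z.2)).
  have m2 : measurable_fun setT (fun z : S * seqspace S => (z.1, stail z.2)).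
    apply: measurable_fun_pair; first exact: measurable_fst.
    exact (measurableT_comp (@measurable_stail _ S) measurable_snd).
  exact (measurableT_comp (@measurable_scons _ S) m2).
(* Substituting [eps 0] for the head of the coupled past restores the original past; both pasts thus
   become functions of one independent pair. *)
pose F2 (z : S * seqspace S) := g (scons z.1 (stail z.2)).
have mF2 : measurable_fun setT F2 by exact (measurableT_comp mg mc).
have F2E w : F2 (eps 0 w, past Xs 0 w) = g (past eps 0 w).
  by rewrite /F2 /= stail_star -past_consE.
pose F (z : S * seqspace S) := g z.2 * F2 z.
have mF : measurable_fun setT F.
  by apply: measurable_funM mF2; exact (measurableT_comp mg measurable_snd).
have iF2 : integ P (fun w => F2 (eps 0 w, past Xs 0 w)).
  by have := sqi_integ gpi; congr integrable; apply/funext => w /=; rewrite F2E.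
have iF : integ P (fun w => F (eps 0 w, past Xs 0 w)).
  have := sqi_mul_integ gsi gpi; congr integrable; apply/funext => w /=.
  by rewrite /F F2E.
have [i1 e1] := pair_fubini (iid_eps.1.1 0) (measurable_past iid_star 0) star_indep mF iF.
have ae2 := ae_integrable2 (pair_integ (iid_eps.1.1 0) (measurable_past iid_star 0)
  star_indep mF2 iF2).
transitivity (\int[P]_w F (eps 0 w, past Xs 0 w)).
  by apply: eq_Rintegral => w _; rewrite /F F2E.
have mUK : measurable_fun setT (fun y => g y * K g (stail y)).
  apply: measurable_funM => //.
  exact: (measurableT_comp (sqi_measurable Kgi) (@measurable_stail _ S)).
rewrite e1 transition_adjoint//.
have -> : inner nu g (@shift _ S R (K g)) =
    \int[law P (measurable_past iid_star 0)]_y (g y * K g (stail y)).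
  by rewrite (law_Rint P (measurable_past iid_star 0) mUK) (star_Rint mUK).
rewrite /Rintegral; congr fine; apply: ae_eq_integral => //.
- apply/measurable_EFinP; exact: integ_measurable i1.
- exact/measurable_EFinP.
apply: filterS ae2 => y iy _; congr EFin.
rewrite -[LHS]/(\int[law P (iid_eps.1.1 0)]_x (g y * F2 (x, y))) RintegralZl//.
congr (_ * _).
rewrite /K /transition /Rintegral; congr fine.
by apply: eq_measure_integral => A mA _; have := iid_eps.2 0 A mA.
Qed.

(** By [star_inner], the squared distance between the two copies is [2 (|g|^2 - |K g|^2)], twice the
    squared norm of the innovation. *)
Lemma innov_le_star (g : seqspace S -> R) : sqi nu g ->
  norm2 nu (innov mu g) <= norm2 P (fun w => g (past eps 0 w) - g (past Xs 0 w)).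
Proof.
move=> gi; have mg := sqi_measurable gi; have gsi := star_sqi gi.
have gpi : sqi P (g \o past eps 0) by apply/(past_sqi iid_eps 0 mg).
have Di := sqiB gpi gsi.
have Ki := transition_sqi gi; have UKi := shift_sqi Ki; have Qi := innov_sqi gi.
apply: norm2_le; first exact: norm2_ge0.
pose D w := g (past eps 0 w) - g (past Xs 0 w).
rewrite norm2_sqr -/D.
have E1 : inner P D D = 2 * (inner nu g g - inner nu (K g) (K g)).
  rewrite /D innerBl// innerC innerBl// [X in _ - X]innerC innerBl//.
  rewrite star_inner// (innerC _ (fun w => g (past eps 0 w))).
  rewrite (star_inner gi) (past_inner iid_eps 0 mg mg).
  have -> : inner P (fun w => g (past Xs 0 w)) (fun w => g (past Xs 0 w)) = inner nu g g.
    by rewrite /inner (star_Rint (f := fun x => g x * g x))//; exact: measurable_funM.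
  ring.
have E2 : inner nu (innov mu g) (innov mu g) = inner nu g g - inner nu (K g) (K g).
  rewrite {1}/innov innerBl// (innerC _ (@shift _ S R (K g))) innov_orth// subr0.
  by rewrite innerC innerBl// (innerC _ (@shift _ S R (K g))) -transition_adjoint.
have := inner_ge0 nu (innov mu g); rewrite E1 E2; lra.
Qed.

(** Both conditional expectations are almost surely [K^i f], evaluated at the original and at the
    coupled past. This is where the dependence condition turns into a bound on innovations. *)
Lemma innov_coef_le_cond_exp (f : seqspace S -> R) (i : nat) (C Cs : T -> R) (delta : R) :
  sqi nu f ->
  is_cond_exp P (gen_sigma eps [set j : int | j <= 0]) (f \o past eps i%:Z) C ->
  is_cond_exp P (gen_sigma Xs [set j : int | j <= 0]) (f \o past Xs i%:Z) Cs ->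
  (L2norm P (fun w => C w - Cs w)%R <= delta%:E)%E -> innov_coef iid_eps i f <= delta.
Proof.
move=> fi hC hCs hd; have Ki := iter_transition_sqi i fi.
have fi' : sqi (past_law iid_star) f.
  have [mf _] := fi; apply/(past_sqi iid_star 0) => //; exact: star_sqi.
have ae1 := cond_exp_transition fi hC.
have ae2 := cond_exp_transition fi' hCs.
rewrite (le_trans (innov_le_star Ki))//.
set g := iter i K f in ae1 ae2 *.
have Di : sqi P (fun w => g (past eps 0 w) - g (past Xs 0 w)).
  apply: sqiB; last exact: star_sqi.
  by apply/(past_sqi iid_eps 0 (sqi_measurable Ki)).
have [_ _ iC _] := hC; have [_ _ iCs _] := hCs.
have mV : measurable_fun setT (fun w => C w - Cs w).
  by apply: measurable_funB; [exact: integ_measurable iC|exact: integ_measurable iCs].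
have Vi : sqi P (fun w => C w - Cs w) by apply: L2norm_sqi mV _; exact: le_lt_trans hd (ltry _).
rewrite L2norm_norm2// lee_fin in hd; apply: le_trans hd.
rewrite le_eqVlt; apply/orP; left; apply/eqP; rewrite /norm2 /inner /Rintegral.
congr (Num.sqrt (fine _)); apply: ae_eq_integral => //.
- by apply/measurable_EFinP; apply: measurable_funM; exact: sqi_measurable Di.
- by apply/measurable_EFinP; apply: measurable_funM.
by apply: filterS2 ae1 ae2 => w -> -> _.
Qed.

End StarCoupling.

(** * A central limit theorem for weighted sums *)

Section Taylor.
Context {R : realType}.

(** A quadratic remainder survives integration, so derivatives under the integral sign reduce to the
    pointwise Taylor bounds for the cosine. *)
Lemma is_derive_quadratic (f : R -> R) (t D C : R) :
  (forall h, `|f (t + h) - f t - h * D| <= C * h ^+ 2) -> is_derive t 1 f D.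
Proof.
move=> fC.
have h : h^-1 *: (f (h *: 1 + t) - f t) @[h --> 0^'] --> D.
  apply/cvgrPdist_le => e e0; near=> h.
  have h0 : h != 0 by near: h; exact: nbhs_dnbhs_neq.
  have -> : D - h^-1 *: (f (h *: 1 + t) - f t) = - h^-1 * (f (t + h) - f t - h * D).
    rewrite (_ : h *: 1 + t = t + h); last by rewrite addrC /GRing.scale /= mulr1.
    by rewrite /GRing.scale /=; field.
  rewrite normrM normrN normfV.
  rewrite (le_trans (ler_wpM2l _ (fC h)))//.
  rewrite -(real_normK (num_real h)).
  have -> : `|h|^-1 * (C * `|h| ^+ 2) = C * `|h| by field; rewrite normr_eq0.
  have C0 : C * `|h| <= (`|C| + 1) * `|h| by rewrite ler_wpM2r// (le_trans (ler_norm C))// lerDl.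
  rewrite (le_trans C0)// -ler_pdivlMl ?ltr_wpDl//.
  near: h; apply: dnbhs0_le; by rewrite mulr_gt0// invr_gt0 ltr_wpDl.
apply: DeriveDef; first by apply/cvg_ex; exists D.
exact: cvg_lim h.
Unshelve. all: by end_near. Qed.

Lemma mvt_any (f df : R -> R) (x y : R) : (forall t : R, is_derive t 1 f (df t)) ->
  exists c, [/\ `|c - x| <= `|x - y|, `|c - y| <= `|x - y| & f x - f y = df c * (x - y)].
Proof.
move=> fd; have cf a b : {within `[a, b], continuous f}.
  by apply: derivable_within_continuous => t _; have [] := fd t.
have [xy|yx] := leP x y.
  have [c + h] := MVT_segment xy (fun t _ => fd t) (cf x y).
  rewrite in_itv /= => /andP[xc cy]; exists c; split.
  - by rewrite ger0_norm ?subr_ge0// ler0_norm ?subr_le0// opprB lerB.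
  - by rewrite !ler0_norm ?subr_le0// !opprB lerB.
  - by rewrite -(opprB (f y)) h -mulrN opprB.
have [c + h] := MVT_segment (ltW yx) (fun t _ => fd t) (cf y x).
rewrite in_itv /= => /andP[yc cx]; exists c; split => //.
- by rewrite ler0_norm ?subr_le0// ger0_norm ?subr_ge0 ?(ltW yx)// opprB lerB.
- by rewrite !ger0_norm ?subr_ge0 ?(ltW yx)// lerB.
Qed.

Lemma sin_lip (x y : R) : `|sin x - sin y| <= `|x - y|.
Proof.
have [c [_ _ ->]] := mvt_any x y (@is_derive_sin R).
by rewrite normrM -[leRHS]mul1r ler_wpM2r// cos_max.
Qed.

Lemma cos_lip (x y : R) : `|cos x - cos y| <= `|x - y|.
Proof.
have [c [_ _ ->]] := mvt_any x y (@is_derive_cos R).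
by rewrite normrM normrN -[leRHS]mul1r ler_wpM2r// sin_max.
Qed.

Lemma sin_taylor (x y : R) : `|sin x - sin y - (x - y) * cos x| <= (x - y) ^+ 2.
Proof.
have [c [cx _ ->]] := mvt_any x y (@is_derive_sin R).
rewrite (mulrC _ (x - y)) -mulrBr normrM -(real_normK (num_real (x - y))) expr2.
by rewrite ler_wpM2l// (le_trans (cos_lip _ _)).
Qed.

Lemma cos_taylor (x y : R) : `|cos x - cos y + (x - y) * sin y| <= (x - y) ^+ 2.
Proof.
have [c [_ cy ->]] := mvt_any x y (@is_derive_cos R).
rewrite mulNr (mulrC _ (x - y)) addrC -mulrBr normrM -(real_normK (num_real (x - y))) expr2.
by rewrite ler_wpM2l// distrC (le_trans (sin_lip _ _)).
Qed.

Lemma measurable_cos : measurable_fun setT (@cos R).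
Proof. by apply: continuous_measurable_fun; exact: continuous_cos. Qed.

Lemma measurable_sin : measurable_fun setT (@sin R).
Proof. by apply: continuous_measurable_fun; exact: continuous_sin. Qed.

(* Gronwall-type comparison with the solution [exp(-s t^2/2)] of [f' = -s t f]. *)
Lemma gaussian_ode (f df : R -> R) (s B : R) : 0 <= s ->
  (forall t : R, is_derive t 1 f (df t)) ->
  (forall t, 0 <= t <= 1 -> `|df t + s * t * f t| <= B) ->
  `|f 1 - expR (- s / 2) * f 0| <= B.
Proof.
move=> s0 fd h.
(* The integrating factor: [(E f)' = E (f' + s t f)]. *)
pose E t := expR (s / 2 * t ^+ 2).
pose g := fun t => E t * f t.
have dE (t : R) : is_derive t 1 E (E t * (s * t)).
  have d2 : is_derive t 1 (fun u : R => s / 2 * u ^+ 2) (s * t).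
    apply: (@is_derive_quadratic _ _ _ (s / 2)) => u.
    rewrite (_ : _ - _ - _ = s / 2 * u ^+ 2); last by field.
    by rewrite ger0_norm// mulr_ge0 ?sqr_ge0// divr_ge0.
  have := @is_derive1_comp R expR (fun u : R => s / 2 * u ^+ 2) t _ _ (is_derive_expR _) d2.
  by [].
have dg (t : R) : is_derive t 1 g (E t * (df t + s * t * f t)).
  have := @is_deriveM _ _ E f t 1 _ _ (dE t) (fd t).
  by move=> H; apply: is_derive_eq H _; rewrite /GRing.scale /=; ring.
have cg : {within `[0, 1], continuous g}.
  by apply: derivable_within_continuous => t _; have [] := dg t.
have [c + hc] := MVT_segment ler01 (fun t _ => dg t) cg.
rewrite in_itv /= => c01.
have E1 : expR (- s / 2) * E 1 = 1.
  by rewrite /E expr1n mulr1 -expRD mulNr addNr expR0.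
have E0 : E 0 = 1 by rewrite /E expr0n /= mulr0 expR0.
have -> : f 1 - expR (- s / 2) * f 0 = expR (- s / 2) * (g 1 - g 0).
  by rewrite /g mulrBr mulrA E1 E0 !mul1r.
rewrite hc subr0 mulr1 mulrA normrM (le_trans _ (h c c01))//.
(* The factor [expR (- s / 2) * E c] is at most 1 since [c] lies between 0 and 1. *)
rewrite -[leRHS]mul1r ler_wpM2r// ger0_norm ?mulr_ge0 ?expR_ge0//.
rewrite -expRD -expR0 ler_expR mulNr addrC subr_le0 -[leRHS]mulr1 ler_wpM2l ?divr_ge0//.
by move/andP: c01 => [c0 c1]; rewrite expr_le1.
Qed.

End Taylor.

(** * Sums of locally dependent bounded variables *)

Section LocalDependence.
Context d (T : measurableType d) (R : realType) (P : probability T R).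
Variables (n : nat) (Y : 'I_n -> T -> R) (a : 'I_n -> R).
Variables (near1 near2 : 'I_n -> 'I_n -> bool).
Hypotheses (mY : forall i, measurable_fun setT (Y i))
  (Ya : forall i x, `|Y i x| <= a i)
  (near12 : forall i j, near1 i j -> near2 i j).
Let S x := \sum_i Y i x.
Let N1 i x := \sum_(j | near1 i j) Y j x.
Let N2 i x := \sum_(j | near2 i j) Y j x.
Let A1 i := \sum_(j | near1 i j) a j.
Let A2 i := \sum_(j | near2 i j) a j.
(** [near1 i] indexes the terms that may depend on [Y i], and [near2 i] those that may depend on
    [Y i] or on a neighbour of it. Independence enters only through the integrals that occur in the
    differential equation. *)
Hypothesis indep0 : forall i, \int[P]_x (Y i x * (S x - N1 i x)) = 0.
Hypothesis indep1 : forall t b i, \int[P]_x (Y i x * sin (t * (S x - N1 i x) + b)) = 0.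
Hypothesis indep2 : forall t b i,
  \int[P]_x (Y i x * N1 i x * cos (t * (S x - N2 i x) + b)) =
  \int[P]_x (Y i x * N1 i x) * \int[P]_x cos (t * (S x - N2 i x) + b).

Let a0 i : 0 <= a i. Proof. exact: le_trans (Ya i point). Qed.

Let A12 i : 0 <= A1 i <= A2 i.
Proof.
rewrite sumr_ge0//= /A1 /A2 [leRHS](bigID (near1 i))/=.
rewrite (eq_bigl (fun j => near2 i j && near1 i j)); last first.
  by move=> j; case: (boolP (near1 i j)) => [/near12 ->|]; rewrite ?andbF.
by rewrite lerDl sumr_ge0.
Qed.

Let mS : measurable_fun setT S. Proof. exact: measurable_sum. Qed.
Let mN1 i : measurable_fun setT (N1 i).
Proof. by rewrite /N1; under eq_fun do rewrite -big_filter; exact: measurable_sum. Qed.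
Let mN2 i : measurable_fun setT (N2 i).
Proof. by rewrite /N2; under eq_fun do rewrite -big_filter; exact: measurable_sum. Qed.
Let N1A i x : `|N1 i x| <= A1 i.
Proof. by rewrite (le_trans (ler_norm_sum _ _ _))// ler_sum. Qed.
Let N2A i x : `|N2 i x| <= A2 i.
Proof. by rewrite (le_trans (ler_norm_sum _ _ _))// ler_sum. Qed.
Let SA x : `|S x| <= \sum_i a i.
Proof. by rewrite (le_trans (ler_norm_sum _ _ _))// ler_sum. Qed.

Let mcos (u : T -> R) t b : measurable_fun setT u -> measurable_fun setT (fun x => cos (t * u x + b)).
Proof.
move=> mu; apply: (measurableT_comp measurable_cos).
by apply: measurable_funD => //; exact: measurable_funM.
Qed.
Let msin (u : T -> R) t b : measurable_fun setT u -> measurable_fun setT (fun x => sin (t * u x + b)).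
Proof.
move=> mu; apply: (measurableT_comp measurable_sin).
by apply: measurable_funD => //; exact: measurable_funM.
Qed.

Let s := \sum_i \int[P]_x (Y i x * N1 i x).

Let iYN i : integ P (fun x => Y i x * N1 i x).
Proof.
apply: (@integ_bounded _ _ _ _ _ (a i * A1 i)) => [|x]; first exact: measurable_funM.
by rewrite normrM ler_pM.
Qed.

Lemma local_dependence_var : s = \int[P]_x (S x ^+ 2).
Proof.
rewrite /s; under [RHS]eq_Rintegral do rewrite expr2 {1}/S mulr_suml.
rewrite Rint_sum => [|i _]; last first.
  apply: (@integ_bounded _ _ _ _ _ (a i * \sum_i a i)) => [|x]; first exact: measurable_funM.
  by rewrite normrM ler_pM.
apply: eq_bigr => i _; have := indep0 i.
under [in X in X -> _]eq_Rintegral do rewrite mulrBr.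
rewrite RintegralB//; first by move/eqP; rewrite subr_eq0 => /eqP.
apply: (@integ_bounded _ _ _ _ _ (a i * \sum_i a i)) => [|x]; first exact: measurable_funM.
by rewrite normrM ler_pM.
Qed.

(** Cosines with an arbitrary phase stand in for the characteristic function: the phases 0 and
    [- pi / 2] give its real and imaginary parts. *)
Let f b t := \int[P]_x cos (t * S x + b).
Let df b t := - \sum_i \int[P]_x (Y i x * sin (t * S x + b)).

Let f_derive b (t : R) : is_derive t 1 (f b) (df b t).
Proof.
have mYs i : measurable_fun setT (fun x => Y i x * sin (t * S x + b)).
  by apply: measurable_funM => //; exact: msin.
have iYs i : integ P (fun x => Y i x * sin (t * S x + b)).
  apply: (@integ_bounded _ _ _ _ _ (a i * 1)) => [|x]; first exact: mYs.
  by rewrite normrM ler_pM// sin_max.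
have ic u : integ P (fun x => cos (u * S x + b)).
  by apply: (@integ_bounded _ _ _ _ _ 1) => [|x]; [exact: mcos|exact: cos_max].
apply: (@is_derive_quadratic _ _ _ _ ((\sum_i a i) ^+ 2)) => h.
rewrite /f /df mulrN opprK -Rint_sum// -RintegralB// -RintegralZl//; last exact: integ_sum.
rewrite -RintegralD//; [|exact: integB|by apply: integZ; exact: integ_sum].
apply: Rint_norm_le_cst => [|x].
  apply: measurable_funD; first by apply: measurable_funB; exact: mcos.
  by apply: measurable_funM => //; exact: measurable_sum.
rewrite -mulr_suml -/(S x).
have := cos_taylor ((t + h) * S x + b) (t * S x + b).
rewrite (_ : (t + h) * S x + b - (t * S x + b) = h * S x); last by ring.
rewrite mulrA => h1; rewrite (le_trans h1)// exprMn mulrC ler_wpM2r ?sqr_ge0//.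
by rewrite -(real_normK (num_real (S x))) lerXn2r// nnegrE ?sumr_ge0// => i _.
Qed.

Let B := \sum_i a i * A2 i ^+ 2.

(** Three errors for each [i], each at most [a i * A2 i ^+ 2]: [r1] comes from linearising the sine
    when the neighbours of [i] are removed, [r2] from removing the larger neighbourhood from the
    cosine that multiplies [Y i * N1 i], and [r3] from putting that neighbourhood back into the
    separated cosine integral. *)
Let df_bound b (t : R) : 0 <= t <= 1 -> `|df b t + s * t * f b t| <= 3 * B.
Proof.
move=> /andP[t0 t1].
rewrite /df /s -!mulrA mulr_suml addrC -sumrB (le_trans (ler_norm_sum _ _ _))//.
rewrite /B mulr_sumr; apply: ler_sum => i _.
have /andP[A10 A1le] := A12 i.
have A20 : 0 <= A2 i := le_trans A10 A1le.
pose r1 x := Y i x * (sin (t * S x + b) - sin (t * (S x - N1 i x) + b)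
                      - t * N1 i x * cos (t * S x + b)).
pose r2 x := Y i x * N1 i x * (cos (t * S x + b) - cos (t * (S x - N2 i x) + b)).
pose r3 x := cos (t * S x + b) - cos (t * (S x - N2 i x) + b).
have mSN1 : measurable_fun setT (fun x => S x - N1 i x) by exact: measurable_funB.
have mSN2 : measurable_fun setT (fun x => S x - N2 i x) by exact: measurable_funB.
have mr3 : measurable_fun setT r3 by apply: measurable_funB; exact: mcos.
have mr2 : measurable_fun setT r2.
  by apply: measurable_funM => //; exact: measurable_funM.
have mr1 : measurable_fun setT r1.
  apply: measurable_funM => //; apply: measurable_funB.
    by apply: measurable_funB; exact: msin.
  by apply: measurable_funM; [exact: measurable_funM|exact: mcos].
have r1le x : `|r1 x| <= a i * A1 i ^+ 2.
  rewrite /r1 normrM ler_pM//.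
  have := sin_taylor (t * S x + b) (t * (S x - N1 i x) + b).
  rewrite (_ : t * S x + b - (t * (S x - N1 i x) + b) = t * N1 i x); last by ring.
  move=> h; rewrite (le_trans h)// -(real_normK (num_real (t * N1 i x))) lerXn2r// ?nnegrE//.
  by rewrite normrM -[leRHS]mul1r ler_pM// ger0_norm.
have r3le x : `|r3 x| <= A2 i.
  rewrite (le_trans (cos_lip _ _))//.
  rewrite (_ : t * S x + b - (t * (S x - N2 i x) + b) = t * N2 i x); last by ring.
  by rewrite normrM -[leRHS]mul1r ler_pM// ger0_norm.
have r2le x : `|r2 x| <= a i * A1 i * A2 i.
  rewrite /r2 normrM; apply: ler_pM => //; last exact: r3le.
  by rewrite normrM ler_pM.
have ir1 : integ P r1 by exact: integ_bounded mr1 r1le.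
have ir2 : integ P r2 by exact: integ_bounded mr2 r2le.
have ir3 : integ P r3 by exact: integ_bounded mr3 r3le.
have is1 : integ P (fun x => Y i x * sin (t * (S x - N1 i x) + b)).
  apply: (@integ_bounded _ _ _ _ _ (a i * 1)) => [|x].
    by apply: measurable_funM => //; exact: msin.
  by rewrite normrM ler_pM// sin_max.
have ic2 : integ P (fun x => cos (t * (S x - N2 i x) + b)).
  by apply: (@integ_bounded _ _ _ _ _ 1) => [|x]; [exact: mcos|exact: cos_max].
have iYc : integ P (fun x => Y i x * N1 i x * cos (t * (S x - N2 i x) + b)).
  apply: (@integ_bounded _ _ _ _ _ (a i * A1 i * 1)) => [|x].
    by apply: measurable_funM; [exact: measurable_funM|exact: mcos].
  rewrite normrM; apply: ler_pM => //; last exact: cos_max.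
  by rewrite normrM ler_pM.
have E1 : \int[P]_x (Y i x * sin (t * S x + b)) =
    \int[P]_x r1 x + t * (\int[P]_x r2 x +
      \int[P]_x (Y i x * N1 i x) * \int[P]_x cos (t * (S x - N2 i x) + b)).
  rewrite -indep2 -RintegralD// -RintegralZl//; last exact: integD.
  rewrite -[LHS]subr0 -(indep1 t b i) -RintegralB//; last first.
    apply: (@integ_bounded _ _ _ _ _ (a i * 1)) => [|x].
      by apply: measurable_funM => //; exact: msin.
    by rewrite normrM ler_pM// sin_max.
  rewrite -RintegralD//; last by apply: integZ; exact: integD.
  by apply: eq_Rintegral => x _; rewrite /r1 /r2; ring.
have E2 : f b t = \int[P]_x r3 x + \int[P]_x cos (t * (S x - N2 i x) + b).
  rewrite -RintegralD//; apply: eq_Rintegral => x _; rewrite /r3; ring.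
set g := \int[P]_x (Y i x * N1 i x).
have gle : `|g| <= a i * A1 i.
  by apply: Rint_norm_le_cst => [|x]; [exact: measurable_funM|rewrite normrM ler_pM].
rewrite E1 E2; set c := \int[P]_x cos _.
have -> : g * (t * (\int[P]_x r3 x + c)) - (\int[P]_x r1 x + t * (\int[P]_x r2 x + g * c))
  = t * (g * \int[P]_x r3 x) - \int[P]_x r1 x - t * \int[P]_x r2 x by ring.
have I1 := Rint_norm_le_cst P mr1 r1le; have I2 := Rint_norm_le_cst P mr2 r2le.
have I3 := Rint_norm_le_cst P mr3 r3le.
have tle (u v : R) : `|u| <= v -> `|t * u| <= v.
  by move=> uv; rewrite normrM -[leRHS]mul1r ler_pM// ger0_norm.
rewrite (le_trans (ler_normB _ _))// (@le_trans _ _ (a i * A1 i * A2 i + a i * A1 i ^+ 2 + a i * A1 i * A2 i))//.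
  rewrite lerD ?tle// (le_trans (ler_normB _ _))// lerD ?tle//.
  by rewrite normrM ler_pM.
have h1 : A1 i * A2 i <= A2 i ^+ 2 by rewrite expr2 ler_wpM2r.
have h2 : A1 i ^+ 2 <= A2 i ^+ 2 by rewrite lerXn2r// nnegrE.
have := ler_wpM2l (a0 i) h1; have := ler_wpM2l (a0 i) h2; rewrite mulrA; lra.
Qed.

(* By local dependence, f(t) = E cos(t S + b) almost satisfies f' = - s t f. *)
Lemma local_dependence_clt b :
  `|(\int[P]_x cos (S x + b)) - expR (- (\int[P]_x (S x ^+ 2)) / 2) * cos b| <= 3 * B.
Proof.
rewrite -local_dependence_var.
have s0 : 0 <= s by rewrite local_dependence_var; apply: Rintegral_ge0 => x _; exact: sqr_ge0.
have h := gaussian_ode s0 (f_derive b) (@df_bound b).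
have f1 : f b 1 = \int[P]_x cos (S x + b).
  by apply: eq_Rintegral => x _; rewrite mul1r.
have f0 : f b 0 = cos b.
  by rewrite -[RHS](Rint_cst P); apply: eq_Rintegral => x _; rewrite mul0r add0r.
by rewrite f1 f0 in h.
Qed.

End LocalDependence.

Section IndependentProduct.
Context d (T : measurableType d) (R : realType) (P : probability T R).

Lemma indep_Rint (g h : T -> R) C D : measurable_fun setT g -> measurable_fun setT h ->
  (forall x, `|g x| <= C) -> (forall x, `|h x| <= D) ->
  (forall A B, measurable A -> measurable B ->
    P (g @^-1` A `&` h @^-1` B) = (P (g @^-1` A) * P (h @^-1` B))%E) ->
  \int[P]_x (g x * h x) = \int[P]_x g x * \int[P]_x h x.
Proof.
move=> mg mh gC hD gh.
have ig := integ_bounded P mg gC; have ih := integ_bounded P mh hD.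
have mF : measurable_fun setT (fun z : R * R => z.1 * z.2).
  by apply: measurable_funM; [exact: measurable_fst|exact: measurable_snd].
have iF : integ P (fun w => (g w, h w).1 * (g w, h w).2).
  apply: (@integ_bounded _ _ _ _ _ (C * D)) => [|x /=]; first exact: measurable_funM.
  by rewrite normrM ler_pM.
have mid : measurable_fun setT (fun x : R => x) by exact: measurable_id.
have ig' : integ (law P mg) (fun x : R => x) by apply/(integ_law P mg mid).
have ih' : integ (law P mh) (fun x : R => x) by apply/(integ_law P mh mid).
have [_ ->] := pair_fubini mg mh gh mF iF.
transitivity (\int[law P mh]_y (\int[law P mg]_x x * y)).
  by apply: eq_Rintegral => y _ /=; rewrite RintegralZr.
by rewrite RintegralZl// !law_Rint.
Qed.

End IndependentProduct.

(** * Independent blocks of coordinates and recentred approximations *)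

Section CoordinateIndependence.
Context {dS : measure_display} (S : measurableType dS) (R : realType).
Context d (T : measurableType d) (P : probability T R).
Variables (mu : probability S R) (X : int -> T -> S).
Hypothesis HX : iid_law P mu X.
Local Notation nu := (past_law HX).

Lemma coord_indep : mutually_independent nu (@coord _ S).
Proof.
split=> [j|s C us mC]; first exact: measurable_coord.
have H (s' : seq nat) (us' : uniq s') : nu (\bigcap_(i in [set` s']) coord i @^-1` C i) =
    (\prod_(i <- s') mu (C i))%E := past_cyl HX 0 us' mC.
rewrite H//; apply: eq_bigr => i _; have := H [:: i] isT.
rewrite big_seq1 => <-; congr (nu _); apply/seteqP; split=> x /=.
  by move=> /(_ i); apply; rewrite /= inE.
by move=> h j /=; rewrite inE => /eqP ->.
Qed.

Definition depends_set (J : set nat) (g : seqspace S -> R) : Prop :=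
  forall x y, (forall j, J j -> x j = y j) -> g x = g y.

(** A function that ignores the coordinates off [J] factors through [mask], which freezes them at
    [point] and is measurable for the sigma-field of the coordinates in [J]. *)
Lemma depends_set_gen_sigma (J : set nat) (g : seqspace S -> R) (B : set R) :
  measurable_fun setT g -> depends_set J g -> measurable B ->
  gen_sigma (@coord _ S) J (g @^-1` B).
Proof.
move=> mg dg mB.
pose mask (x : seqspace S) : seqspace S := fun j => if `[< J j >] then x j else point.
have gE : g = g \o mask.
  by apply/funext => x; apply: dg => j Jj; rewrite /mask; case: asboolP.
rewrite gE comp_preimage.
have : measurable (g @^-1` B) by rewrite -[X in measurable X]setTI; exact: mg.
move: (g @^-1` B); apply: smallest_sub.
  have := @sigma_algebra_image _ _ setT mask (gen_sigma (@coord _ S) J).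
  move=> /(_ (smallest_sigma_algebra _ _)).
  by rewrite /image_set_system; congr sigma_algebra; apply/funext => A /=; rewrite setTI.
move=> _ [j [C [mC ->]]].
have [Jj|nJ] := pselect (J j).
  apply: sub_sigma_algebra; exists j, C; split => //.
  by apply/funext => x; rewrite /preimage /= /mask /coord; case: asboolP.
(* A frozen coordinate is constant, so the preimage is the whole space or empty. *)
have [Cp|nC] := pselect (C point).
  rewrite (_ : mask @^-1` _ = setT).
    have [_ hC _] := smallest_sigma_algebra setT [set A | exists j (B : set S),
       [/\ J j, measurable B & A = coord j @^-1` B]].
    by rewrite -(setD0 setT); apply: hC; exact: sigma_algebra0.
  by apply/seteqP; split=> x //= _; rewrite /mask; case: asboolP.
rewrite (_ : mask @^-1` _ = set0); first exact: sigma_algebra0.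
by apply/seteqP; split=> x //=; rewrite /mask; case: asboolP.
Qed.

Lemma depends_set_Rint (J1 J2 : set nat) (g h : seqspace S -> R) C D :
  measurable_fun setT g -> measurable_fun setT h ->
  (forall x, `|g x| <= C) -> (forall x, `|h x| <= D) ->
  (forall j, J1 j -> ~ J2 j) -> depends_set J1 g -> depends_set J2 h ->
  \int[nu]_x (g x * h x) = \int[nu]_x g x * \int[nu]_x h x.
Proof.
move=> mg mh gC hD J12 dg dh; apply: indep_Rint gC hD _ => // A B mA mB.
apply: (gen_sigma_indep (@measurable_coord _ S) coord_indep J12);
  exact: depends_set_gen_sigma.
Qed.

Local Notation K := (transition mu).
Local Notation U := (@shift _ S R).

Lemma transitionB_bounded f g m : bounded_cylinder m f -> bounded_cylinder m g ->
  K (fun x => f x - g x) = fun x => K f x - K g x.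
Proof.
move=> [mf _ [C fC]] [mg _ [D gD]]; apply/funext => x.
have ms : measurable_fun setT (fun s => scons s x).
  exact: (measurable_fun_pair1 x (@measurable_scons _ S)).
have fi : integ mu (fun s => f (scons s x)).
  by apply: (integ_bounded mu) => //; exact (measurableT_comp mf ms).
have gi : integ mu (fun s => g (scons s x)).
  by apply: (integ_bounded mu) => //; exact (measurableT_comp mg ms).
by rewrite /transition RintegralB.
Qed.

Lemma iter_transitionB_bounded j f g m : bounded_cylinder m f -> bounded_cylinder m g ->
  iter j K (fun x => f x - g x) = fun x => iter j K f x - iter j K g x.
Proof.
move=> cf cg; elim: j => //= j ->; apply: (@transitionB_bounded _ _ m);
  by apply: bounded_cylinder_widen (leq_subr j m) _; exact: (iter_transition_cylinder HX).
Qed.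

Lemma iter_transition_shift j f : iter j K (iter j U f) = f.
Proof.
elim: j f => // j IH f; rewrite iterSr iterS.
rewrite (_ : K (U (iter j U f)) = iter j U f) ?IH//.
by apply/funext => x; exact: transition_shift.
Qed.

Lemma innov_shift f : innov mu (U f) = fun _ => 0.
Proof.
apply/funext => x; rewrite /innov (_ : K (U f) = f) ?subrr//.
by apply/funext => y; exact: transition_shift.
Qed.

(** [K^j U^J = U^(J - j)] still has a factor [U] when [j < J], and a shifted function has no
    innovation. *)
Lemma innov_coef_iter_shift J j f : (j < J)%N -> innov_coef HX j (iter J U f) = 0.
Proof.
move=> jJ; rewrite /innov_coef -(subnKC (ltnW jJ)) iterD iter_transition_shift.
by rewrite -(subnSK jJ) iterS innov_shift norm2_cst normr0.
Qed.

Lemma bounded_cylinder_shift j m f : bounded_cylinder m f ->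
  bounded_cylinder (m + j) (iter j U f).
Proof.
move=> [mf df [C fC]]; split.
- rewrite (_ : iter j U f = f \o iter j (@stail _ S)).
    exact (measurableT_comp mf (@measurable_iter_stail _ S j)).
  by apply/funext => x; rewrite iter_shiftE.
- move=> x y xy; rewrite !iter_shiftE; apply: df => i im.
  by rewrite !iter_stail; apply: xy; rewrite addnC ltn_add2r.
- by exists C => x; rewrite iter_shiftE.
Qed.

(* A mean zero approximation of [q] with the same innovation coefficients as [q] up to [J]
   and none beyond. *)
Definition recentre J q : seqspace S -> R := fun x => q x - iter J U (iter J K q) x.

Lemma recentre_bounded_cylinder J m q : bounded_cylinder m q ->
  bounded_cylinder (m + J) (recentre J q).
Proof.
move=> cq; have cK := iter_transition_cylinder HX J cq.
have cU := bounded_cylinder_shift J (bounded_cylinder_widen (leq_subr J m) cK).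
have := bounded_cylinderD (bounded_cylinder_widen (leq_addr J m) cq) (bounded_cylinderZ (-1) cU).
by congr bounded_cylinder; apply/funext => x; rewrite mulN1r.
Qed.

Lemma iter_transition_Rint j f : sqi nu f -> \int[nu]_x iter j K f x = \int[nu]_x f x.
Proof.
move=> fi; elim: j => //= j <-.
by have [_ ->] := transition_integ (sqi_integ (iter_transition_sqi j fi)).
Qed.

Lemma iter_shift_Rint j f : sqi nu f -> \int[nu]_x iter j U f x = \int[nu]_x f x.
Proof.
by move=> fi; rewrite -(iter_transition_Rint j (iter_shift_sqi j fi)) iter_transition_shift.
Qed.

Lemma recentre_Rint J m q : bounded_cylinder m q -> \int[nu]_x recentre J q x = 0.
Proof.
move=> cq; have qi := bounded_cylinder_sqi nu cq.
have Ki := iter_transition_sqi J qi; have Ui := iter_shift_sqi J Ki.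
by rewrite RintegralB ?iter_shift_Rint ?iter_transition_Rint ?subrr//; exact: sqi_integ.
Qed.

(** Closeness in L2 controls each coefficient but not their sum. Recentring confines the
    approximation error to the ages below [J]; beyond them [K^J] annihilates the approximant and the
    coefficients are those of [f]. *)
Lemma recentre_coef (J j m : nat) f q : sqi nu f -> bounded_cylinder m q ->
  innov_coef HX j (fun x => f x - recentre J q x) <=
  if (j < J)%N then norm2 nu (fun x => f x - q x) else innov_coef HX j f.
Proof.
move=> fi cq; have qi := bounded_cylinder_sqi nu cq.
have Ki := iter_transition_sqi J qi; have Ui := iter_shift_sqi J Ki.
have cr := recentre_bounded_cylinder J cq; have ri := bounded_cylinder_sqi nu cr.
case: ltnP => jJ.
  have -> : (fun x => f x - recentre J q x) = (fun x => (f x - q x) -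
      (-1) * iter J U (iter J K q) x).
    by apply/funext => x; rewrite /recentre; ring.
  have fqi := sqiB fi qi.
  rewrite (le_trans (innov_coefB _ _ _))//; first exact: sqiZ.
  rewrite -[leRHS]addr0 lerD ?innov_coef_le// (le_trans (innov_coefZ _ _ _))//.
  by rewrite innov_coef_iter_shift// mulr0.
rewrite (le_trans (innov_coefB _ _ _))// -[leRHS]addr0 lerD//.
have cq' := bounded_cylinder_widen (leq_addr J m) cq.
have cU := bounded_cylinder_shift J (bounded_cylinder_widen (leq_subr J m)
  (iter_transition_cylinder HX J cq)).
rewrite /innov_coef -(subnK jJ) iterD (iter_transitionB_bounded _ cq' cU).
rewrite iter_transition_shift.
have -> : (fun x : seqspace S => iter J K q x - iter J K q x) = (fun _ => 0).
  by apply/funext => x; rewrite subrr.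
rewrite iter_transition_cst.
have -> : innov mu (fun _ => 0 : R) = (fun _ => 0).
  by apply/funext => x; rewrite /innov /shift /= /transition Rint_cst subrr.
by rewrite norm2_cst normr0.
Qed.

End CoordinateIndependence.

Lemma measurable_sum_cond d (T : measurableType d) (R : realType) (I : Type) (s : seq I)
    (Q : pred I) (F : I -> T -> R) : (forall i, measurable_fun setT (F i)) ->
  measurable_fun setT (fun x => \sum_(i <- s | Q i) F i x).
Proof. by move=> mF; under eq_fun do rewrite -big_filter; exact: measurable_sum. Qed.

(** * Neighbour counts and elementary estimates *)

Section WeightedSums.
Context {R : realType}.

Definition near (M i j : nat) : bool := (i < j + M)%N && (j < i + M)%N.

Lemma near_count (n M i : nat) : (\sum_(j < n | near M i j) 1 <= 2 * M)%N.
Proof.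
rewrite sum1_card cardE -(size_map (@nat_of_ord n)).
have <- : size (iota (i - M) (2 * M)) = (2 * M)%N by rewrite size_iota.
apply: uniq_leq_size.
  by rewrite map_inj_uniq ?enum_uniq//; exact: val_inj.
move=> j /mapP[k]; rewrite mem_enum unfold_in /near => h ->; rewrite mem_iota; lia.
Qed.

Lemma near_sum (n M i : nat) (c : R) : 0 <= c ->
  \sum_(j < n | near M i j) c <= (2 * M)%:R * c.
Proof.
move=> c0; rewrite sumr_const -[c *+ _]mulr_natl ler_wpM2r// ler_nat.
by have := near_count n M i; rewrite sum1_card.
Qed.

Lemma nearC M i j : near M i j = near M j i. Proof. by rewrite /near andbC. Qed.

(** One neighbourhood sum is bounded by [2 M r]. The quadratic form that remains is bounded by
    [a_i a_j <= (a_i^2 + a_j^2) / 2] and the symmetry of [near]. *)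
Lemma near_cube (n M : nat) (a : nat -> R) (r : R) :
  (forall j, (j < n)%N -> 0 <= a j <= r) ->
  \sum_(i < n) a i * (\sum_(j < n | near M i j) a j) ^+ 2 <=
  r * (2 * M)%:R ^+ 2 * \sum_(i < n) a i ^+ 2.
Proof.
move=> ar; have a0 (j : 'I_n) : 0 <= a j by case/andP: (ar j (ltn_ord j)).
case: n ar a0 => [|n] ar a0; first by rewrite !big_ord0 mulr0.
have r0 : 0 <= r by case/andP: (ar 0 isT); exact: le_trans.
have M0 : (0 : R) <= (2 * M)%:R by exact: ler0n.
pose A i := \sum_(j < n.+1 | near M i j) a j.
have A0 i : 0 <= A i by apply: sumr_ge0.
have Ar i : A i <= (2 * M)%:R * r.
  rewrite (le_trans _ (near_sum n.+1 M i r0))//; apply: ler_sum => j _.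
  by case/andP: (ar j (ltn_ord j)).
have h1 : \sum_(i < n.+1) a i * A i ^+ 2 <= \sum_(i < n.+1) ((2 * M)%:R * r) * (a i * A i).
  apply: ler_sum => i _; rewrite expr2 mulrA mulrC ler_wpM2r//.
  by rewrite mulr_ge0.
rewrite (le_trans h1)// -mulr_sumr.
have h2 : \sum_(i < n.+1) a i * A i <= (2 * M)%:R * \sum_(i < n.+1) a i ^+ 2.
  have h3 : \sum_(i < n.+1) a i * A i <=
     \sum_(i < n.+1) \sum_(j < n.+1 | near M i j) (a i ^+ 2 / 2 + a j ^+ 2 / 2).
    apply: ler_sum => i _; rewrite mulr_sumr; apply: ler_sum => j _.
    have := sqr_ge0 (a i - a j); lra.
  rewrite (le_trans h3)//; under eq_bigr do rewrite big_split/=.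
  rewrite big_split /=.
  have h4 : \sum_(i < n.+1) \sum_(j < n.+1 | near M i j) (a i ^+ 2 / 2) <=
     \sum_(i < n.+1) (2 * M)%:R * (a i ^+ 2 / 2).
    by apply: ler_sum => i _; apply: near_sum; rewrite divr_ge0 ?sqr_ge0.
  have h5 : \sum_(i < n.+1) \sum_(j < n.+1 | near M i j) (a j ^+ 2 / 2) <=
     \sum_(i < n.+1) (2 * M)%:R * (a i ^+ 2 / 2).
    rewrite (exchange_big_dep predT)//=; apply: ler_sum => i _.
    under eq_bigl do rewrite nearC.
    by apply: near_sum; rewrite divr_ge0 ?sqr_ge0.
  rewrite (le_trans (lerD h4 h5))// -!mulr_sumr -mulr_suml.
  by rewrite le_eqVlt; apply/orP; left; apply/eqP; field.
have Mr0 : 0 <= (2 * M)%:R * r by exact: mulr_ge0.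
rewrite (le_trans (ler_wpM2l Mr0 h2))//.
by rewrite le_eqVlt; apply/orP; left; apply/eqP; ring.
Qed.

(** The derivative has modulus at most 1, because [|c| <= 1 + c^2 / 2 <= expR (c^2 / 2)]. *)
Lemma exp_sqr_lip (x y : R) : `|expR (- x ^+ 2 / 2) - expR (- y ^+ 2 / 2)| <= `|x - y|.
Proof.
have dE (t : R) : is_derive t 1 (fun u : R => expR (- u ^+ 2 / 2)) (expR (- t ^+ 2 / 2) * - t).
  have d2 : is_derive t 1 (fun u : R => - u ^+ 2 / 2) (- t).
    apply: (@is_derive_quadratic _ _ _ _ (2^-1)) => u.
    rewrite (_ : _ - _ - _ = - (u ^+ 2 / 2)); last by field.
    by rewrite normrN ger0_norm ?divr_ge0 ?sqr_ge0// mulrC.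
  exact: (@is_derive1_comp R expR (fun u : R => - u ^+ 2 / 2) t _ _ (is_derive_expR _) d2).
have [c [_ _ ->]] := mvt_any x y dE.
rewrite normrM -[leRHS]mul1r ler_wpM2r// normrM normrN ger0_norm ?expR_ge0//.
rewrite mulNr expRN -ler_pdivlMl ?invr_gt0 ?expR_gt0// invrK mulr1.
rewrite (le_trans _ (expR_ge1Dx _))// -(real_normK (num_real c)).
have := sqr_ge0 (`|c| - 1); lra.
Qed.

Lemma summable_tail (p : nat -> R) (B e : R) : (forall j, 0 <= p j) ->
  (forall J, \sum_(j < J) p j <= B) -> 0 < e ->
  exists J, forall L, \sum_(j < L) (if (j < J)%N then 0 else p j) <= e.
Proof.
move=> p0 pB e0; pose u J := \sum_(j < J) p j.
have nd : nondecreasing_seq u.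
  by apply/nondecreasing_seqP => n; rewrite /u big_ord_recr lerDl.
have cu : cvgn u.
  by apply: nondecreasing_is_cvgn => //; exists B => _ [n _ <-]; exact: pB.
have /cvgrPdist_le /(_ _ e0) [J _ hJ] := cu.
exists J => L; have [LJ|JL] := leqP L J.
  rewrite big1 ?ltW// => j _; by rewrite (leq_trans (ltn_ord j) LJ).
have uL : u L <= limn u by apply: nondecreasing_cvgn_le.
have E1 : u L = u J + \sum_(J <= j < L) p j.
  by rewrite /u -!(big_mkord xpredT p) (@big_cat_nat _ _ _ J)//= ltnW.
have : \sum_(j < L) (if (j < J)%N then 0 else p j) = u L - u J.
  rewrite E1 addrAC subrr add0r -(big_mkord xpredT (fun j => if (j < J)%N then 0 else p j)).
  rewrite (@big_cat_nat _ _ _ J)//=; last exact: ltnW.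
  rewrite [X in X + _]big_nat_cond big1 => [|j /andP[/andP[_ ->]]//].
  by rewrite add0r; apply: eq_big_nat => j /andP[Jj _]; rewrite ltnNge Jj.
move=> ->; have := hJ J (leqnn J); rewrite ger0_norm ?subr_ge0; first by lra.
exact: nondecreasing_cvgn_le.
Qed.

End WeightedSums.

(** * Normal approximation of weighted sums *)

Section CentralLimit.
Context {dS : measure_display} (S : measurableType dS) (R : realType).
Context d (T : measurableType d) (P : probability T R).
Variables (mu : probability S R) (X : int -> T -> S).
Hypothesis HX : iid_law P mu X.
Local Notation nu := (past_law HX).
Local Notation K := (transition mu).
Local Notation U := (@shift _ S R).

Definition wsum (f : seqspace S -> R) (n : nat) (v : nat -> R) : seqspace S -> R :=
  fun x => \sum_(k < n) v k * iter k U f x.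

Lemma wsum_sqi f n v : sqi nu f -> sqi nu (wsum f n v).
Proof. by move=> fi; apply: sqi_sum => k _; apply: sqiZ; exact: iter_shift_sqi. Qed.

(** The term of index [k] reads the coordinates from [k] to [k + m - 1]. Terms at distance at least
    [m] are independent, and those at distance at least [2 * m] from [i] are independent of term [i]
    together with its neighbours; the factor [2 * (2 * m)] counts the latter neighbourhood. *)
Lemma bounded_cylinder_clt (m : nat) (q : seqspace S -> R) (C : R) (n : nat)
    (v : nat -> R) (r b : R) :
  measurable_fun setT q -> depends_on m q -> (forall x, `|q x| <= C) ->
  \int[nu]_x q x = 0 -> (forall k, (k < n)%N -> `|v k| <= r) ->
  `|(\int[nu]_x cos (wsum q n v x + b)) - expR (- norm2 nu (wsum q n v) ^+ 2 / 2) * cos b| <=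
  3 * (C * r * (2 * (2 * m))%:R ^+ 2 * (C ^+ 2 * \sum_(k < n) v k ^+ 2)).
Proof.
move=> mq dq qC q0 vr.
have C0 : 0 <= C := le_trans (normr_ge0 _) (qC (point : seqspace S)).
have qi : sqi nu q := sqi_bounded nu mq qC.
pose Y (k : 'I_n) x := v k * iter k U q x.
pose a (k : 'I_n) := C * `|v k|.
have mU k : measurable_fun setT (iter k U q) by exact: sqi_measurable (iter_shift_sqi k qi).
have mY k : measurable_fun setT (Y k) by exact: measurable_funM.
have Ya k x : `|Y k x| <= a k.
  by rewrite /Y /a normrM mulrC iter_shiftE ler_wpM2r.
have dY (k : 'I_n) (J : set nat) : (forall c, (k <= c < k + m)%N -> J c) -> depends_set J (Y k).
  move=> kJ x y xy; rewrite /Y !iter_shiftE; congr (_ * _); apply: dq => j jm.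
  by rewrite !iter_stail; apply: xy; apply: kJ; lia.
have dsum (I : Type) (s : seq I) (Q : pred I) (F : I -> seqspace S -> R) (J : set nat) :
    (forall i, Q i -> depends_set J (F i)) -> depends_set J (fun x => \sum_(i <- s | Q i) F i x).
  by move=> dF x y xy; apply: eq_bigr => i Qi; exact: dF.
have ifar M (i : 'I_n) x : \sum_j Y j x - \sum_(j < n | near M i j) Y j x =
    \sum_(j < n | ~~ near M i j) Y j x.
  by rewrite (bigID (fun j : 'I_n => near M i j)) /= [X in X - _]addrC addrK.
have far_bd M (i : 'I_n) : forall x, `|\sum_(j < n | ~~ near M i j) Y j x| <= \sum_j a j.
  move=> x; rewrite (le_trans (ler_norm_sum _ _ _))//.
  rewrite [leRHS](bigID (fun j : 'I_n => ~~ near M i j)) /= -[leLHS]addr0 lerD ?ler_sum//.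
  by apply: sumr_ge0 => j _; rewrite mulr_ge0.
have near_bd M (i : 'I_n) : forall x, `|\sum_(j < n | near M i j) Y j x| <= \sum_j a j.
  move=> x; rewrite (le_trans (ler_norm_sum _ _ _))//.
  rewrite [leRHS](bigID (fun j : 'I_n => near M i j)) /= -[leLHS]addr0 lerD ?ler_sum//.
  by apply: sumr_ge0 => j _; rewrite mulr_ge0.
have mfar M (i : 'I_n) : measurable_fun setT (fun x => \sum_(j < n | ~~ near M i j) Y j x).
  exact: measurable_sum_cond.
have mnear M (i : 'I_n) : measurable_fun setT (fun x => \sum_(j < n | near M i j) Y j x).
  exact: measurable_sum_cond.
(* [J1 i] consists of the coordinates read by [Y i]; [J2 i] contains those read by [Y i] and by its
   neighbours within [m]. *)
pose J1 (i : 'I_n) := [set c : nat | (i <= c < i + m)%N].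
pose J2 (i : 'I_n) := [set c : nat | (i < c + m)%N && (c < i + 2 * m)%N].
have dfar1 (i : 'I_n) : depends_set (~` J1 i) (fun x => \sum_(j < n | ~~ near m i j) Y j x).
  by apply: dsum => j; rewrite /near => h; apply: dY => c hc; rewrite /J1 /J2 => /= h'; lia.
have dfar2 (i : 'I_n) : depends_set (~` J2 i)
    (fun x => \sum_(j < n | ~~ near (2 * m) i j) Y j x).
  by apply: dsum => j; rewrite /near => h; apply: dY => c hc; rewrite /J1 /J2 => /= h'; lia.
have dY1 i : depends_set (J1 i) (Y i) by exact: dY.
have dYN i : depends_set (J2 i) (fun x => Y i x * \sum_(j < n | near m i j) Y j x).
  move=> x y xy; congr (_ * _).
    by apply: (dY i (J2 i)) => // c hc /=; rewrite /J2 /=; lia.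
  by apply: (dsum _ _ _ _ (J2 i)) => // j; rewrite /near => h; apply: dY => c hc; rewrite /J2 /=; lia.
have Y0 i : \int[nu]_x Y i x = 0.
  rewrite RintegralZl//; last exact: sqi_integ (iter_shift_sqi i qi).
  by rewrite iter_shift_Rint// q0 mulr0.
have NN (J : set nat) c : J c -> ~ (~` J) c by move=> Jc; exact.
have key := @local_dependence_clt _ _ _ nu n Y a (fun i j => near m i j)
  (fun i j => near (2 * m) i j) mY Ya.
rewrite norm2_sqr.
have -> : inner nu (wsum q n v) (wsum q n v) = \int[nu]_x ((\sum_i Y i x) ^+ 2).
  by apply: eq_Rintegral => x _; rewrite expr2.
apply: le_trans (key _ _ _ _ b) _.
- by move=> i j; rewrite /near; lia.
- move=> i; under eq_Rintegral do rewrite ifar.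
  rewrite (depends_set_Rint HX _ _ (Ya i) (far_bd m i) (NN (J1 i)))//.
  by rewrite Y0 mul0r.
- move=> t b' i; under eq_Rintegral do rewrite ifar.
  rewrite (depends_set_Rint (C := a i) (D := 1) HX _ _ _ _ (NN (J1 i)))//.
  + by rewrite Y0 mul0r.
  + apply: (measurableT_comp measurable_sin).
    by apply: measurable_funD => //; exact: measurable_funM.
  + by move=> x; exact: sin_max.
  + by move=> x y xy; congr (sin (_ * _ + _)); exact: dfar1.
- move=> t b' i; under [in LHS]eq_Rintegral do rewrite ifar.
  under [X in _ = _ * X]eq_Rintegral do rewrite ifar.
  rewrite (depends_set_Rint (C := a i * \sum_j a j) (D := 1) HX _ _ _ _ (NN (J2 i)))//.
  + exact: measurable_funM.
  + apply: (measurableT_comp measurable_cos).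
    by apply: measurable_funD => //; exact: measurable_funM.
  + by move=> x; rewrite normrM ler_pM.
  + by move=> x; exact: cos_max.
  + by move=> x y xy; congr (cos (_ * _ + _)); exact: dfar2.
rewrite ler_wpM2l//.
apply: le_trans (@near_cube _ n (2 * m) (fun k => C * `|v k|) (C * r) _) _.
  by move=> j jn; rewrite mulr_ge0//= ler_wpM2l// vr.
rewrite le_eqVlt; apply/orP; left; apply/eqP; congr (_ * _).
by rewrite mulr_sumr; apply: eq_bigr => k _; rewrite exprMn real_normK ?num_real.
Qed.

End CentralLimit.

Section GeneralCentralLimit.
Context {dS : measure_display} (S : measurableType dS) (R : realType).
Context d (T : measurableType d) (P : probability T R).
Variables (mu : probability S R) (X : int -> T -> S).
Hypothesis HX : iid_law P mu X.
Local Notation nu := (past_law HX).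
Local Notation K := (transition mu).
Local Notation U := (@shift _ S R).

Lemma norm2_wsum_le f n v B : sqi nu f -> \int[nu]_x f x = 0 ->
  (forall J, \sum_(j < J) innov_coef HX j f <= B) ->
  norm2 nu (wsum f n v) <= Num.sqrt (\sum_(k < n) v k ^+ 2) * B.
Proof.
move=> fi f0 fB.
have -> : \sum_(k < n) v k ^+ 2 = \sum_(k < n) `|v k| ^+ 2.
  by apply: eq_bigr => k _; rewrite real_normK ?num_real.
have -> : wsum f n v = (fun x => \sum_(k < n) iter k U (fun y => v k * f y) x).
  by apply/funext => x; apply: eq_bigr => k _; rewrite !iter_shiftE.
apply (@innov_sum_cvg _ _ _ _ _ _ _ _ HX n (fun k y => v k * f y) (fun k => `|v k|) (fun j => innov_coef HX j f) B) => //.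
- by move=> k; exact: sqiZ.
- by move=> k; rewrite RintegralZl ?f0 ?mulr0//; exact: sqi_integ.
- by move=> j; exact: innov_coef_ge0.
- by move=> k j; exact: innov_coefZ.
Qed.

Lemma cos_norm2_lip (g h : seqspace S -> R) b : sqi nu g -> sqi nu h ->
  `|(\int[nu]_x cos (g x + b)) - \int[nu]_x cos (h x + b)| <= norm2 nu (fun x => g x - h x).
Proof.
move=> gi hi; have ghi := sqiB gi hi.
have mcos (u : seqspace S -> R) : sqi nu u -> measurable_fun setT (fun x => cos (u x + b)).
  move=> [mu' _]; apply: (measurableT_comp measurable_cos).
  exact: measurable_funD.
have icos u : sqi nu u -> integ nu (fun x => cos (u x + b)).
  by move=> ui; apply: (integ_bounded nu (C := 1)) => [|x]; [exact: mcos|exact: cos_max].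
rewrite -RintegralB//; [|exact: icos..].
apply: le_trans (Rint_abs_le_norm2 ghi); apply: Rint_norm_le.
- by apply: measurable_funB; exact: mcos.
- have := ghi; move=> /sqi_integ /integrable_abse; congr integrable.
- move=> x; rewrite (le_trans (cos_lip _ _))//.
  by rewrite (_ : g x + b - (h x + b) = g x - h x)//; ring.
Qed.

(** The cosine integral and the Gaussian value are both 1-Lipschitz for the L2 norm of the sum. By
    [norm2_wsum_le] this norm is small uniformly in [n] once the coefficient sum is, so [f] may be
    replaced by a recentred bounded cylinder function. *)
Lemma weighted_clt (f : seqspace S -> R) (v : nat -> nat -> R) (B V b : R) (N0 : nat) :
  sqi nu f -> \int[nu]_x f x = 0 ->
  (forall J, \sum_(j < J) innov_coef HX j f <= B) ->
  (forall n, (N0 <= n)%N -> \sum_(k < n) v n k ^+ 2 <= V) ->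
  (forall e, 0 < e -> exists N, forall n k, (N <= n)%N -> (k < n)%N -> `|v n k| <= e) ->
  (\int[nu]_x cos (wsum f n (v n) x + b)) -
    expR (- norm2 nu (wsum f n (v n)) ^+ 2 / 2) * cos b @[n --> \oo] --> (0 : R).
Proof.
move=> fi f0 fB vV vsmall; apply/cvgrPdist_le => e e0.
have V0 : 0 <= V by apply: le_trans (vV N0 (leqnn _)); apply: sumr_ge0 => k _; exact: sqr_ge0.
pose c := Num.sqrt V + 1.
have c0 : 0 < c by rewrite ltr_wpDl// sqrtr_ge0.
(* [c] bounds the Euclidean norm of the weights, so a coefficient sum of [e / (3 * c)] costs
   [e / 3]. Half of it is reserved for the ages from [J] on, the other half is shared by the ages
   below [J]. *)
have e1 : 0 < e / (6 * c) by rewrite divr_gt0// mulr_gt0.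
have [J HJ] := summable_tail (fun j => innov_coef_ge0 HX j f) fB e1.
have e2 : 0 < e / (6 * c * J.+1%:R) by rewrite divr_gt0// !mulr_gt0.
have [m [q [cq hq]]] := sqi_cyl_approx fi e2.
pose q' := recentre mu J q.
have cq' : bounded_cylinder (m + J) q' := recentre_bounded_cylinder HX J cq.
have q'i := bounded_cylinder_sqi nu cq'.
have q'0 : \int[nu]_x q' x = 0 := recentre_Rint HX J cq.
have fq'i := sqiB fi q'i.
have fq'0 : \int[nu]_x (f x - q' x) = 0.
  by rewrite RintegralB ?f0 ?q'0 ?subrr//; exact: sqi_integ.
have coefB L : \sum_(j < L) innov_coef HX j (fun x => f x - q' x) <= e / (3 * c).
  have h1 : \sum_(j < L) innov_coef HX j (fun x => f x - q' x) <=
      \sum_(j < L) ((if (j < J)%N then e / (6 * c * J.+1%:R) else 0) +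
                    (if (j < J)%N then 0 else innov_coef HX j f)).
    apply: ler_sum => j _; rewrite (le_trans (recentre_coef J j fi cq))//.
    by case: ltnP => _; rewrite ?addr0 ?add0r.
  rewrite (le_trans h1)// big_split /=.
  have -> : e / (3 * c) = e / (6 * c) + e / (6 * c) by field; rewrite gt_eqF.
  rewrite lerD ?HJ// -big_mkcond /=.
  rewrite (@le_trans _ _ (J%:R * (e / (6 * c * J.+1%:R))))//.
    rewrite sumr_const -[_ *+ _]mulr_natl ler_wpM2r ?(ltW e2)// ler_nat.
    rewrite cardE -(size_map (@nat_of_ord L)) -[leqRHS](size_iota 0).
    apply: uniq_leq_size; first by rewrite map_inj_uniq ?enum_uniq//; exact: val_inj.
    by move=> j /mapP[k]; rewrite mem_enum unfold_in => h ->; rewrite mem_iota.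
  have -> : J%:R * (e / (6 * c * J.+1%:R)) = e / (6 * c) * (J%:R / J.+1%:R).
    by field; rewrite gt_eqF//= gt_eqF// ltr_wpDl.
  rewrite -[leRHS]mulr1 ler_wpM2l ?(ltW e1)//.
  by rewrite ler_pdivrMr// mul1r ler_nat.
have [mq' dq' [C0 qC0]] := cq'.
pose C := C0; have C00 : 0 <= C := le_trans (normr_ge0 _) (qC0 (point : seqspace S)).
(* [A] times a bound on the individual weights dominates the error in [bounded_cylinder_clt]. *)
pose A := 3 * ((2 * (2 * (m + J)))%:R ^+ 2 * (C ^+ 3 * V)).
have A0 : 0 <= A by rewrite !mulr_ge0// exprn_ge0.
have r0 : 0 < e / (3 * (A + 1)) by rewrite divr_gt0// mulr_gt0// ltr_wpDl.
have [N HN] := vsmall _ r0.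
exists (maxn N N0) => // n /=; rewrite geq_max => /andP[Nn N0n]; rewrite sub0r normrN.
have clt := bounded_cylinder_clt b mq' dq' qC0 q'0 (fun k => HN n k Nn).
have wf := wsum_sqi n (v n) fi; have wq := wsum_sqi n (v n) q'i.
have dist : norm2 nu (fun x => wsum f n (v n) x - wsum q' n (v n) x) <= e / 3.
  have -> : (fun x => wsum f n (v n) x - wsum q' n (v n) x) =
      wsum (fun x => f x - q' x) n (v n).
    apply/funext => x; rewrite /wsum -sumrB; apply: eq_bigr => k _.
    rewrite -mulrBr; congr (_ * _).
    by rewrite (iter_shiftE k f) (iter_shiftE k q') (iter_shiftE k (fun y => f y - q' y)).
  rewrite (le_trans (norm2_wsum_le n (v n) fq'i fq'0 coefB))//.
  have sc : Num.sqrt (\sum_(k < n) v n k ^+ 2) <= c.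
    by rewrite (le_trans (ler_wsqrtr (vV n N0n)))// lerDl.
  rewrite (le_trans (ler_wpM2r _ sc))//; first by rewrite divr_ge0 ?(ltW e0)// mulr_ge0// ltW.
  by rewrite le_eqVlt; apply/orP; left; apply/eqP; field; rewrite gt_eqF.
have h1 := cos_norm2_lip b wf wq.
have h2 := exp_sqr_lip (norm2 nu (wsum f n (v n))) (norm2 nu (wsum q' n (v n))).
have h3 := norm2_dist wf wq.
have h4 : `|expR (- norm2 nu (wsum f n (v n)) ^+ 2 / 2) * cos b -
    expR (- norm2 nu (wsum q' n (v n)) ^+ 2 / 2) * cos b| <= e / 3.
  rewrite -mulrBl normrM -[leRHS]mulr1 ler_pM// ?cos_max//.
  exact: le_trans h2 (le_trans h3 dist).
have h5 : 3 * (C0 * (e / (3 * (A + 1))) * (2 * (2 * (m + J)))%:R ^+ 2 *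
    (C0 ^+ 2 * \sum_(k < n) v n k ^+ 2)) <= e / 3.
  rewrite (@le_trans _ _ (A * (e / (3 * (A + 1)))))//.
    rewrite /A /C [leLHS](_ : _ = 3 * ((2 * (2 * (m + J)))%:R ^+ 2 * (C0 ^+ 3 *
        \sum_(k < n) v n k ^+ 2)) * (e / (3 * (A + 1)))); last by ring.
    rewrite ler_wpM2r ?(ltW r0)// ler_wpM2l// ler_wpM2l ?sqr_ge0//.
    by rewrite ler_wpM2l ?exprn_ge0// vV.
  rewrite [leLHS](_ : _ = e / 3 * (A / (A + 1))); last first.
    by field; rewrite gt_eqF// ltr_wpDl.
  rewrite -[leRHS]mulr1 ler_wpM2l ?divr_ge0 ?(ltW e0)//.
  by rewrite ler_pdivrMr ?ltr_wpDl// mul1r lerDl.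
have fin3 (c1 x1 c2 x2 : R) : `|c1 - c2| <= e / 3 -> `|c2 - x2| <= e / 3 ->
    `|x1 - x2| <= e / 3 -> `|c1 - x1| <= e.
  move=> k1 k2 k3; have -> : c1 - x1 = (c1 - c2) + (c2 - x2) - (x1 - x2) by ring.
  rewrite (le_trans (ler_normB _ _))// (@le_trans _ _ (e / 3 + e / 3 + e / 3))//; last lra.
  by rewrite lerD// (le_trans (ler_normD _ _))// lerD.
exact: fin3 (le_trans h1 dist) (le_trans clt h5) h4.
Qed.

End GeneralCentralLimit.

(** * Gaussian vectors and weak convergence *)

Section NormalIntegral.
Context {R : realType}.
Local Notation lam := (@lebesgue_measure R).
Local Notation N := (@normal_prob R 0 1).
Local Notation pdf := (@normal_pdf R 0 1).

Let RN_pdf (D : set R) : measurable D ->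
  ae_eq lam D (Radon_Nikodym (charge_of_finite_measure N) lam) (EFin \o pdf).
Proof.
move=> mD; have dom := normal_prob_dominates (0 : R) 1.
rewrite Radon_NikodymE//; case: cid => /= h [h1 h2 h3].
apply: integral_ae_eq => //=.
- exact: integrableS h2.
- by apply/measurable_funTS/measurableT_comp => //; exact: measurable_normal_pdf.
- by move=> E E01 mE; rewrite -h3.
Qed.

Lemma normal_integral (D : set R) (f : R -> \bar R) : measurable D ->
  N.-integrable D f ->
  (\int[N]_(x in D) f x = \int[lam]_(x in D) (f x * (pdf x)%:E))%E.
Proof.
move=> mD fi; have dom := normal_prob_dominates (0 : R) 1.
have mf := measurable_int N fi.
rewrite -(Radon_Nikodym_change_of_variables dom)//.
apply: ae_eq_integral => //.
- apply: emeasurable_funM => //; apply: (measurable_int lam).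
  apply: (integrableS _ _ (@subsetT _ _)) => //=.
  exact: Radon_Nikodym_integrable.
- apply: emeasurable_funM => //=; apply/measurableT_comp => //=.
  by apply/measurable_funTS; exact: measurable_normal_pdf.
- by apply: ae_eqe_mul2l; exact: RN_pdf.
Qed.

(** The version for nonnegative functions serves to establish integrability in the first place. *)
Lemma normal_integral_ge0 (f : R -> \bar R) : (forall x, 0 <= f x)%E ->
  measurable_fun setT f ->
  (\int[N]_x f x = \int[lam]_x (f x * (pdf x)%:E))%E.
Proof.
move=> f0 mf; have dom := normal_prob_dominates (0 : R) 1.
rewrite -(Radon_Nikodym_SigmaFinite.change_of_variables dom f0 measurableT mf).
have fint : lam.-integrable setT (Radon_Nikodym_SigmaFinite.f N lam).
  exact: Radon_Nikodym_SigmaFinite.f_integrable.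
apply: ae_eq_integral => //.
- by apply: emeasurable_funM => //; exact: (measurable_int lam).
- by apply: emeasurable_funM => //=; apply/measurable_EFinP; exact: measurable_normal_pdf.
- apply: ae_eqe_mul2l; apply: integral_ae_eq => //.
  + by apply/measurable_EFinP; exact: measurable_normal_pdf.
  + by move=> E _ mE; rewrite -Radon_Nikodym_SigmaFinite.f_integral.
Qed.

Let pdfE x : pdf x = normal_peak (1 : R) * expR (- x ^+ 2 / 2).
Proof. by rewrite normal_pdfE ?oner_neq0// /normal_fun subr0 expr1n. Qed.

Let peak0 : 0 <= normal_peak (1 : R). Proof. exact: normal_peak_ge0. Qed.

(** [x^2 expR (- x^2 / 2) <= 4 expR (- x^2 / 4)], and the right side is a multiple of the normal
    density of variance 2. *)
Lemma normal_sqi_id : sqi N (fun x : R => x).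
Proof.
split; first exact: measurable_id.
apply/integrableP; split; first by apply/measurable_EFinP; exact: measurable_funX.
rewrite normal_integral_ge0; last 2 first.
- by move=> x; exact: abse_ge0.
- apply: (measurableT_comp (@abse_measurable R setT)); apply/measurable_EFinP.
  exact: measurable_funX.
have s2 : Num.sqrt 2 != 0 :> R by rewrite gt_eqF// sqrtr_gt0.
pose c := 4 * normal_peak (1 : R) / normal_peak (Num.sqrt 2 : R).
have p2 : 0 < normal_peak (Num.sqrt 2 : R) by exact: normal_peak_gt0.
have : (\int[lam]_x (c%:E * (normal_pdf 0 (Num.sqrt 2) x)%:E) < +oo)%E.
  by rewrite integralZl ?integral_normal_pdf ?mule1 ?ltry//; exact: integrable_normal_pdf.
apply: le_lt_trans; apply: ge0_le_integral => //.
- by move=> x _; rewrite mule_ge0// lee_fin pdfE mulr_ge0// expR_ge0.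
- apply: emeasurable_funM.
    apply: (measurableT_comp (@abse_measurable R setT)); apply/measurable_EFinP.
    exact: measurable_funX.
  by apply/measurable_EFinP; exact: measurable_normal_pdf.
- apply: emeasurable_funM; first exact: measurable_cst.
  by apply/measurable_EFinP; exact: measurable_normal_pdf.
move=> x _; rewrite /= ger0_norm ?sqr_ge0// lee_fin pdfE normal_pdfE// /normal_fun subr0.
have -> : c * (normal_peak (Num.sqrt 2) * expR (- x ^+ 2 / (Num.sqrt 2 ^+ 2 *+ 2))) =
    normal_peak 1 * (4 * expR (- x ^+ 2 / (Num.sqrt 2 ^+ 2 *+ 2))).
  by rewrite /c; field; rewrite gt_eqF.
rewrite mulrCA ler_wpM2l// sqr_sqrtr//.
have -> : - x ^+ 2 / 2 = - x ^+ 2 / (2 *+ 2) + - (x ^+ 2 / 4) by field.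
rewrite expRD mulrCA mulrC ler_wpM2r ?expR_ge0//.
rewrite expRN -[_ * _^-1]/(_ / _) ler_pdivrMr ?expR_gt0//.
by have := expR_ge1Dx (x ^+ 2 / 4); lra.
Qed.

Let is_derive_trig (f df : R -> R) (t b : R) (fd : forall x : R, is_derive x 1 f (df x)) (x : R) :
  is_derive x 1 (fun u : R => f (t * u + b)) (df (t * x + b) * t).
Proof.
have d2 : is_derive x 1 (fun u : R => t * u + b) t.
  apply: (@is_derive_quadratic _ _ _ _ 0) => u.
  by rewrite mul0r (_ : _ - _ - _ = 0) ?normr0//; ring.
exact: (@is_derive1_comp R f (fun u : R => t * u + b) x _ _ (fd _) d2).
Qed.

Let is_derive_pdf (x : R) : is_derive x 1 pdf (- x * pdf x).
Proof.
have -> : (pdf : R -> R) = (fun u => normal_peak (1 : R) * expR (- u ^+ 2 / 2)).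
  by apply/funext => u; exact: pdfE.
have d2 : is_derive x 1 (fun u : R => - u ^+ 2 / 2) (- x).
  apply: (@is_derive_quadratic _ _ _ _ (2^-1)) => u.
  rewrite (_ : _ - _ - _ = - (u ^+ 2 / 2)); last by field.
  by rewrite normrN ger0_norm ?divr_ge0 ?sqr_ge0// mulrC.
have d3 := @is_derive1_comp R expR (fun u : R => - u ^+ 2 / 2) x _ _ (is_derive_expR _) d2.
have := @is_deriveZ _ _ _ _ (normal_peak (1 : R)) x 1 _ d3.
by move=> H; apply: is_derive_eq H _; rewrite /GRing.scale /=; ring.
Qed.

Let pdf_cvg0 : pdf n%:R @[n --> \oo] --> (0 : R).
Proof.
apply/cvgrPdist_le => e e0.
have [n0 hn0] : exists n : nat, normal_peak (1 : R) / e <= n%:R.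
  exists (Num.truncn (normal_peak (1 : R) / e)).+1; apply: ltW; exact: truncnS_gt.
exists (n0 + 2)%N => // n /= hn; rewrite sub0r normrN pdfE ger0_norm ?mulr_ge0 ?expR_ge0//.
rewrite mulNr expRN -ler_pdivlMr ?invr_gt0 ?expR_gt0// invrK.
rewrite mulrC -ler_pdivrMr// (le_trans hn0)// (le_trans _ (expR_ge1Dx _))//.
have h1 : (n0%:R : R) <= n%:R by rewrite ler_nat; lia.
have h2 : (2 : R) <= n%:R by rewrite ler_nat; lia.
nra.
Qed.

(** Integration by parts: [F] is a primitive of [h * pdf] and its boundary values vanish at
    infinity. *)
Lemma normal_stein t b :
  \int[N]_x (x * sin (t * x + b)) = t * \int[N]_x cos (t * x + b).
Proof.
have mid := sqi_measurable normal_sqi_id.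
have mlin : measurable_fun setT (fun x : R => t * x + b).
  by apply: measurable_funD => //; exact: measurable_funM.
have ms : measurable_fun setT (fun x : R => sin (t * x + b)) := measurableT_comp measurable_sin mlin.
have mc : measurable_fun setT (fun x : R => cos (t * x + b)) := measurableT_comp measurable_cos mlin.
have ssi : sqi N (fun x => sin (t * x + b)).
  by apply: (sqi_bounded N (C := 1) ms) => x; exact: sin_max.
have sci : sqi N (fun x => cos (t * x + b)).
  by apply: (sqi_bounded N (C := 1) mc) => x; exact: cos_max.
have ixs := sqi_mul_integ normal_sqi_id ssi.
have ic := integZ t (sqi_integ sci).
pose h x := t * cos (t * x + b) - x * sin (t * x + b).
have ih : integ N h by exact: integB.
pose F x := sin (t * x + b) * pdf x.
have dF (x : R) : is_derive x 1 F (h x * pdf x).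
  have := @is_deriveM _ _ _ _ x 1 _ _ (is_derive_trig t b (@is_derive_sin R) x) (is_derive_pdf x).
  by move=> H; apply: is_derive_eq H _; rewrite /GRing.scale /= /h; ring.
have cder (g dg : R -> R) : (forall x : R, is_derive x 1 g (dg x)) -> continuous g.
  move=> gd x; apply: differentiable_continuous; apply/derivable1_diffP.
  by have [] := gd x.
have ch : continuous (fun x => h x * pdf x).
  move=> x; apply: cvgM; last exact: (cder _ _ is_derive_pdf).
  apply: cvgB; apply: cvgM.
  - exact: cvg_cst.
  - exact: (cder _ _ (is_derive_trig t b (@is_derive_cos R))).
  - exact: cvg_id.
  - exact: (cder _ _ (is_derive_trig t b (@is_derive_sin R))).
have seg (n : nat) : \int[N]_(x in `[- n.+1%:R, n.+1%:R]) h x = F n.+1%:R - F (- n.+1%:R).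
  have mD : measurable (`[- n.+1%:R, n.+1%:R]%classic : set R) by exact: measurable_itv.
  rewrite /Rintegral normal_integral//; last exact: integrableS ih.
  rewrite (@continuous_FTC2 _ (fun x => h x * pdf x) F)//.
  - have n0 : (0 : R) < n.+1%:R by rewrite ltr0n.
    by move: n0; lra.
  - exact: continuous_subspaceT.
  - have cF := cder _ _ dF; split.
    + by move=> x _; have [] := dF x.
    + by apply: cvg_at_right_filter; exact: cF.
    + by apply: cvg_at_left_filter; exact: cF.
  - by move=> x _; rewrite derive1E; have [_ ->] := dF x.
have c1 : \int[N]_(x in `[- n.+1%:R, n.+1%:R]) h x @[n --> \oo] --> \int[N]_x h x.
  under eq_fun do rewrite Rintegral_mkcond.
  apply: (@Rint_dominated _ _ _ N _ _ (fun x => `|h x|)).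
  - move=> n; apply/(measurable_restrictT _ (measurable_itv _)).
    exact: measurable_funTS (integ_measurable ih).
  - move=> x; apply: cvg_near_cst; exists (Num.truncn `|x|) => // n /= xn.
    rewrite patchE ifT// inE /= in_itv /= -ler_norml ltW//.
    by rewrite (lt_le_trans (truncnS_gt _))// ler_nat.
  - by have := integrable_abse ih; congr integrable.
  - by move=> n x; rewrite patchE; case: ifP; rewrite ?normr0.
have c2 : F n.+1%:R - F (- n.+1%:R) @[n --> \oo] --> (0 : R).
  apply/cvgrPdist_le => e e0; have e20 : 0 < e / 2 by rewrite divr_gt0.
  have /cvgrPdist_le /(_ _ e20) [n0 _ hn0] := pdf_cvg0.
  exists n0 => // n /= nn; have := hn0 n.+1 (leqW nn); rewrite !sub0r !normrN => hp.
  have pp x : 0 <= pdf x by rewrite pdfE mulr_ge0// expR_ge0.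
  have pN : pdf (- n.+1%:R) = pdf n.+1%:R by rewrite !pdfE sqrrN.
  have FF x : `|F x| <= `|pdf x| by rewrite /F normrM -[leRHS]mul1r ler_wpM2r// sin_max.
  rewrite (le_trans (ler_normB _ _))// (splitr e) lerD// (le_trans (FF _))//.
  by rewrite pN.
have : \int[N]_x h x = 0.
  rewrite -(cvg_lim _ c1)//; under eq_fun do rewrite seg.
  exact: cvg_lim c2.
rewrite RintegralB// RintegralZl//; last exact: sqi_integ.
by move/eqP; rewrite subr_eq0 => /eqP.
Qed.

(** By Stein's identity [f' = - s^2 t f] holds exactly, so the comparison [gaussian_ode] applies
    with error bound 0. *)
Lemma normal_cos (s b : R) :
  \int[N]_x cos (s * x + b) = expR (- s ^+ 2 / 2) * cos b.
Proof.
have mid := sqi_measurable normal_sqi_id.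
have mlin t c : measurable_fun setT (fun x : R => t * x + c).
  by apply: measurable_funD => //; exact: measurable_funM.
have ms t c : measurable_fun setT (fun x : R => sin (t * x + c)) := measurableT_comp measurable_sin (mlin t c).
have mc t c : measurable_fun setT (fun x : R => cos (t * x + c)) := measurableT_comp measurable_cos (mlin t c).
have ssi t c : sqi N (fun x => sin (t * x + c)).
  by apply: (sqi_bounded N (C := 1) (ms t c)) => x; exact: sin_max.
have sci t c : sqi N (fun x => cos (t * x + c)).
  by apply: (sqi_bounded N (C := 1) (mc t c)) => x; exact: cos_max.
pose f t := \int[N]_x cos (t * s * x + b).
pose df t := - (s * \int[N]_x (x * sin (t * s * x + b))).
have fd (t : R) : is_derive t 1 f (df t).
  apply: (@is_derive_quadratic _ _ _ _ (s ^+ 2 * \int[N]_x (x ^+ 2))) => h.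
  have ixs := sqi_mul_integ normal_sqi_id (ssi (t * s) b).
  have ic u := sqi_integ (sci u b).
  have -> : f (t + h) - f t - h * df t = \int[N]_x (cos ((t + h) * s * x + b) -
      cos (t * s * x + b) + (h * s) * (x * sin (t * s * x + b))).
    rewrite RintegralD//; [|exact: integB|exact: integZ].
    by rewrite RintegralB// RintegralZl// /df mulrN opprK mulrA.
  rewrite mulrAC -RintegralZl//; last exact: normal_sqi_id.2.
  apply: Rint_norm_le.
  - apply: measurable_funD; first by apply: measurable_funB; exact: mc.
    exact: (integ_measurable (integZ (h * s) ixs)).
  - by apply: integZ; exact: normal_sqi_id.2.
  move=> x; have := cos_taylor ((t + h) * s * x + b) (t * s * x + b).
  have -> : (t + h) * s * x + b - (t * s * x + b) = h * s * x by ring.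
  rewrite (_ : h * s * (x * _) = h * s * x * sin (t * s * x + b)); last by ring.
  by rewrite (_ : s ^+ 2 * h ^+ 2 * x ^+ 2 = (h * s * x) ^+ 2)//; ring.
have h01 (t : R) : 0 <= t <= 1 -> `|df t + s ^+ 2 * t * f t| <= 0.
  move=> _; rewrite /df normal_stein -/(f t) (_ : _ + _ = 0) ?normr0//; ring.
have := gaussian_ode (sqr_ge0 s) fd h01.
rewrite normr_le0 subr_eq0 => /eqP; rewrite /f.
under eq_Rintegral do rewrite mul1r.
move=> ->; congr (_ * _).
by under eq_Rintegral do rewrite !mul0r add0r; rewrite Rint_cst.
Qed.

End NormalIntegral.

(** * Bernstein polynomials and approximation by trigonometric polynomials *)

Section Bernstein.
Context {R : realType}.

(* Expectation of [phi] under the binomial law with parameters [N] and [u], computed by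
   conditioning on the first trial. *)
Fixpoint bernstein (N : nat) (phi : nat -> R) (u : R) : R :=
  if N is N'.+1 then u * bernstein N' (fun k => phi k.+1) u + (1 - u) * bernstein N' phi u
  else phi 0%N.

Lemma bernstein_norm_le N phi psi u : 0 <= u <= 1 ->
  (forall k, `|phi k| <= psi k) -> `|bernstein N phi u| <= bernstein N psi u.
Proof.
move=> /andP[u0 u1]; elim: N phi psi => [|N IH] phi psi h /=; first exact: h.
rewrite (le_trans (ler_normD _ _))// !normrM (ger0_norm u0) (ger0_norm (_ : 0 <= 1 - u)) ?subr_ge0//.
by apply: lerD; rewrite ler_wpM2l ?subr_ge0//; apply: IH => k.
Qed.

Lemma bernstein_sub N phi c u : bernstein N (fun k => phi k - c) u = bernstein N phi u - c.
Proof. by elim: N phi => //= N IH phi; rewrite !IH; ring. Qed.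

Lemma bernstein_cst N c u : bernstein N (fun _ => c) u = c.
Proof. by elim: N => //= N ->; ring. Qed.

Lemma bernstein_affine N phi a c u :
  bernstein N (fun k => a + c * phi k) u = a + c * bernstein N phi u.
Proof. by elim: N phi => //= N IH phi; rewrite !IH; ring. Qed.

(** The shift [c] makes the induction possible: conditioning on a success in the first trial
    replaces it by [c + 1]. *)
Lemma bernstein_var N c u :
  bernstein N (fun k => (k%:R + c) ^+ 2) u = (N%:R * u + c) ^+ 2 + N%:R * (u * (1 - u)).
Proof.
elim: N c => [|N IH] c /=; first by rewrite !mul0r addr0.
have -> : (fun k : nat => (k.+1%:R + c) ^+ 2) = (fun k : nat => (k%:R + (c + 1)) ^+ 2).
  by apply/funext => k; rewrite -natr1; ring.
by rewrite !IH -natr1; ring.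
Qed.

Lemma bernstein_dev N a c u : (0 < N)%N -> 0 <= u <= 1 -> 0 <= c ->
  bernstein N (fun k => a + c * (k%:R / N%:R - u) ^+ 2) u <= a + c / N%:R.
Proof.
move=> N0 /andP[u0 u1] c0; have N1 : (0 : R) < N%:R by rewrite ltr0n.
rewrite bernstein_affine lerD2l ler_wpM2l//.
have -> : (fun k : nat => (k%:R / N%:R - u) ^+ 2) =
    (fun k : nat => 0 + N%:R ^- 2 * (k%:R + - (N%:R * u)) ^+ 2).
  by apply/funext => k; field; rewrite gt_eqF.
rewrite bernstein_affine bernstein_var subrr expr0n /= !add0r.
have -> : N%:R ^- 2 * (N%:R * (u * (1 - u))) = u * (1 - u) / N%:R.
  by field; rewrite gt_eqF.
rewrite -[leRHS]mul1r ler_wpM2r ?invr_ge0 ?(ltW N1)//.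
by rewrite -[leRHS]mulr1 ler_pM ?subr_ge0// gerBl.
Qed.

Context (I : eqType).

(** The counts at the positions in [js] are independent binomial variables; [k] stores the counts
    that have already been fixed. *)
Fixpoint mbernstein (N : nat) (js : seq I) (phi : (I -> nat) -> R) (u : I -> R)
    (k : I -> nat) : R :=
  if js is j :: js' then
    bernstein N (fun m => mbernstein N js' phi u (fun i => if i == j then m else k i)) (u j)
  else phi k.

Lemma mbernstein_norm_le N js phi u k M : (forall j, 0 <= u j <= 1) ->
  (forall k, `|phi k| <= M) -> `|mbernstein N js phi u k| <= M.
Proof.
move=> u01 h; elim: js k => //= j js IH k.
by rewrite -[leRHS](bernstein_cst N M (u j)); apply: bernstein_norm_le => // m.
Qed.

(** A quadratic majorant of the deviation suffices, because each coordinate contributes at most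
    [C / N] in expectation. In the induction the square at the head coordinate is carried inside [e]
    until its own expectation is taken, which is why only [k] agreeing with [k0] off [js] are
    considered. *)
Lemma mbernstein_dev N js phi u k0 c e C : uniq js -> (0 < N)%N ->
  (forall j, 0 <= u j <= 1) -> 0 <= C ->
  (forall k, (forall i, i \notin js -> k i = k0 i) ->
     `|phi k - c| <= e + C * \sum_(j <- js) ((k j)%:R / N%:R - u j) ^+ 2) ->
  `|mbernstein N js phi u k0 - c| <= e + C * ((size js)%:R / N%:R).
Proof.
move=> + N0 u01 C0; elim: js k0 e => [|j js IH] k0 e /=.
  by move=> _ h; rewrite mul0r; have := h k0 (fun _ _ => erefl); rewrite big_nil.
move=> /andP[jjs ujs] h; rewrite -bernstein_sub.
have -> : e + C * ((size js).+1%:R / N%:R) = (e + C * ((size js)%:R / N%:R)) + C / N%:R.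
  by rewrite -natr1; field; rewrite gt_eqF// ltr0n.
apply: le_trans (@bernstein_dev N _ C (u j) N0 (u01 j) C0).
apply: bernstein_norm_le => // m; rewrite addrAC.
apply: IH => // k hk.
have kj : k j = m by rewrite hk// eqxx.
rewrite (le_trans (h k _)) ?big_cons ?kj//; last by rewrite mulrDr addrA.
move=> i; rewrite inE negb_or => /andP[ij ijs]; rewrite hk//.
by rewrite (negbTE ij).
Qed.

End Bernstein.

Section TrigPoly.
Context {R : realType} (p : nat).

Definition trigpoly (F : 'cV[R]_p -> R) : Prop :=
  exists s : seq (R * 'cV[R]_p * R),
    forall v, F v = \sum_(t <- s) t.1.1 * cos (dotv t.1.2 v + t.2).

Lemma dotvDl (u w v : 'cV[R]_p) : dotv (u + w) v = dotv u v + dotv w v.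
Proof. by rewrite /dotv -big_split; apply: eq_bigr => i _; rewrite mxE mulrDl. Qed.

Lemma dotvZl a (u v : 'cV[R]_p) : dotv (a *: u) v = a * dotv u v.
Proof. by rewrite /dotv mulr_sumr; apply: eq_bigr => i _; rewrite mxE mulrA. Qed.

Lemma dotvC (u v : 'cV[R]_p) : dotv u v = dotv v u.
Proof. by apply: eq_bigr => i _; rewrite mulrC. Qed.

Lemma dotv0l (v : 'cV[R]_p) : dotv 0 v = 0.
Proof. by rewrite /dotv big1// => i _; rewrite mxE mul0r. Qed.

Lemma trigpoly_cst c : trigpoly (fun _ => c).
Proof.
by exists [:: (c, 0, 0)] => v; rewrite big_seq1 /= dotv0l addr0 cos0 mulr1.
Qed.

Lemma trigpolyD F G : trigpoly F -> trigpoly G -> trigpoly (fun v => F v + G v).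
Proof. by move=> [s hs] [t ht]; exists (s ++ t) => v; rewrite big_cat hs ht. Qed.

Lemma trigpoly_sum (I : Type) (s : seq I) (F : I -> 'cV[R]_p -> R) :
  (forall i, trigpoly (F i)) -> trigpoly (fun v => \sum_(i <- s) F i v).
Proof.
move=> tF; elim: s => [|i s IH].
  by under eq_fun do rewrite big_nil; exact: trigpoly_cst.
by under eq_fun do rewrite big_cons; exact: trigpolyD.
Qed.

Lemma trigpolyM F G : trigpoly F -> trigpoly G -> trigpoly (fun v => F v * G v).
Proof.
move=> [s hs] [t ht].
have -> : (fun v => F v * G v) = (fun v => \sum_(x <- s) \sum_(y <- t)
    (x.1.1 * cos (dotv x.1.2 v + x.2) * (y.1.1 * cos (dotv y.1.2 v + y.2)))).
  by apply/funext => v; rewrite hs ht mulr_suml; apply: eq_bigr => x _; rewrite mulr_sumr.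
apply: trigpoly_sum => x; apply: trigpoly_sum => y.
exists [:: (x.1.1 * y.1.1 / 2, x.1.2 + y.1.2, x.2 + y.2);
           (x.1.1 * y.1.1 / 2, x.1.2 - y.1.2, x.2 - y.2)] => v.
rewrite !big_cons big_nil /= addr0 dotvDl -scaleN1r dotvDl dotvZl mulN1r.
set a := dotv x.1.2 v; set b := dotv y.1.2 v.
have -> : a + b + (x.2 + y.2) = (a + x.2) + (b + y.2) by ring.
have -> : a - b + (x.2 - y.2) = (a + x.2) - (b + y.2) by ring.
by rewrite (cosD (a + x.2)) (cosB (a + x.2)); field.
Qed.

Lemma trigpoly_bernstein N (phi : nat -> 'cV[R]_p -> R) (u : 'cV[R]_p -> R) :
  trigpoly u -> (forall k, trigpoly (phi k)) ->
  trigpoly (fun v => bernstein N (fun k => phi k v) (u v)).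
Proof.
move=> tu; elim: N phi => [|N IH] phi tphi /=; first exact: tphi.
apply: trigpolyD; apply: trigpolyM => //; try exact: IH.
apply: trigpolyD; first exact: trigpoly_cst.
have -> : (fun v => - u v) = (fun v => (-1) * u v) by apply/funext => v; rewrite mulN1r.
by apply: trigpolyM => //; exact: trigpoly_cst.
Qed.

Lemma trigpoly_mbernstein N (js : seq 'I_p) phi (u : 'I_p -> 'cV[R]_p -> R) k :
  (forall j, trigpoly (u j)) ->
  trigpoly (fun v => mbernstein N js phi (fun j => u j v) k).
Proof.
move=> tu; elim: js k => [|j js IH] k /=; first exact: trigpoly_cst.
by apply: (trigpoly_bernstein N (phi := fun m v => mbernstein N js phi (fun j => u j v)
  (fun i => if i == j then m else k i))) => // m; exact: IH.
Qed.

Lemma trigpoly_sin j (a : R) : trigpoly (fun v => sin (v j 0 * a)).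
Proof.
exists [:: (1, a *: (delta_mx j 0), - (pi / 2))] => v.
rewrite big_seq1 /= mul1r dotvZl.
have -> : dotv (delta_mx j 0) v = v j 0.
  rewrite /dotv (bigD1 j)//= big1 ?mxE ?eqxx ?mul1r ?addr0// => i ij.
  by rewrite mxE (negbTE ij) mul0r.
by rewrite cosB cos_pihalf sin_pihalf mulr0 add0r mulr1 mulrC.
Qed.

End TrigPoly.

Section TrigApproximation.
Context {R : realType} (p : nat).

Lemma uniform_continuity_box (g : 'cV[R]_p -> R) (L e : R) : continuous g -> 0 < e ->
  exists2 eta, 0 < eta & forall v y : 'cV[R]_p, (forall j, `|v j 0| <= L) ->
    (forall j, `|y j 0 - v j 0| <= eta) -> `|g y - g v| <= e.
Proof.
move=> cg e0.
have cK : compact [set u : 'rV[R]_p | forall j, `[- L, L]%classic (u ord0 j)].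
  by apply: (@rV_compact R p (fun _ => `[- L, L]%classic)) => _; exact: segment_compact.
have /compact_near_coveringP nc := cK.
pose Pr (eta : R) (u : 'rV[R]_p) := forall y : 'cV[R]_p, (forall j, `|y j 0 - u 0 j| <= eta) ->
  `|g y - g u^T| <= e.
have : \forall eta \near 0^'+, [set u : 'rV[R]_p | forall j, `[- L, L]%classic (u ord0 j)] `<=` Pr eta.
  apply: nc => u _.
  have e20 : 0 < e / 2 by rewrite divr_gt0.
  have /cvgrPdist_lt /(_ _ e20) /nbhs_ballP [r /= r0 hr] := cg u^T.
  have r20 : 0 < r / 2 by rewrite divr_gt0.
  exists (ball u (r / 2), [set eta : R | eta < r / 2]) => /=.
    split; first exact: nbhsx_ballx.
    exact: nbhs_right_lt.
  move=> [u' eta] /= [bu' heta] y hy.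
  have bu i j : `|u i j - u' i j| < r / 2 by have := bu'.2 i j; rewrite -ball_normE.
  have h1 : `|g u^T - g u'^T| < e / 2.
    apply: hr; split => // i j; rewrite !mxE -ball_normE /=.
    by rewrite (lt_trans (bu _ _))// ltr_pdivrMr// ltr_pMr// ltr1n.
  have h2 : `|g u^T - g y| < e / 2.
    apply: hr; split => // i j; rewrite !mxE -ball_normE /= !ord1.
    rewrite (_ : u 0 i - y i 0 = (u 0 i - u' 0 i) - (y i 0 - u' 0 i)); last by ring.
    rewrite (splitr r) (le_lt_trans (ler_normB _ _))// ltr_leD//.
    exact: le_trans (hy i) (ltW heta).
  rewrite (_ : g y - g u'^T = (g u^T - g u'^T) - (g u^T - g y)); last by ring.
  by rewrite (splitr e) (le_trans (ler_normB _ _))// lerD// ltW.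
move=> h; have [eta [eta0 heta]] : exists eta, 0 < eta /\
    ([set u : 'rV[R]_p | forall j, `[- L, L]%classic (u ord0 j)] `<=` Pr eta).
  near (0 : R)^'+ => eta; exists eta; split; first by near: eta; exact: nbhs_right_gt.
  by near: eta.
exists eta => // v y vL hy; have := heta v^T _ y; rewrite trmxK; apply.
  by move=> j; rewrite /= in_itv /= mxE -ler_norml.
by move=> j; rewrite mxE.
Unshelve. all: by end_near. Qed.

(** The second-order bound at 0 gives [cos c >= 1 - c^2 >= 3 / 4] at the intermediate point. *)
Let sin_expand (x y : R) : `|x| <= 1 / 2 -> `|y| <= 1 / 2 ->
  `|x - y| <= 2 * `|sin x - sin y|.
Proof.
move=> hx hy; have [c [c1 c2 ->]] := mvt_any x y (@is_derive_sin R).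
have c12 : `|c| <= 1 / 2.
  move: hx hy c1 c2; rewrite !ler_norml; case: (lerP x y) => xy.
    move=> /andP[? ?] /andP[? ?] /andP[? ?] /andP[? ?].
    by apply/andP; split; lra.
  move=> /andP[? ?] /andP[? ?] /andP[? ?] /andP[? ?].
  by apply/andP; split; lra.
have := cos_taylor c 0; rewrite sin0 mulr0 addr0 subr0 cos0.
have c2' : c ^+ 2 <= 1 / 4.
  rewrite -(real_normK (num_real c)) (_ : 1 / 4 = (1 / 2) ^+ 2); last by field.
  by rewrite lerXn2r// nnegrE; lra.
rewrite ler_norml => /andP[h _].
rewrite normrM mulrA -[leLHS]mul1r ler_wpM2r//.
rewrite (le_trans _ (ler_wpM2l _ (ler_norm _)))//; lra.
Qed.

(** The inverse sine on [[-1/2, 1/2]], extended to all reals by clamping [x] to the range; clamping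
    cannot increase the distance to a value [sin y]. *)
Let sin_inverse (x : R) : exists t : R, `|t| <= 1 / 2 /\
  forall y, `|y| <= 1 / 2 -> `|t - y| <= 2 * `|x - sin y|.
Proof.
have mono (a b : R) : `|a| <= 1 / 2 -> `|b| <= 1 / 2 -> a <= b -> sin a <= sin b.
  move=> ha hb ab; have [//|ba] := leP (sin a) (sin b).
  have [c + h] := @MVT_segment R sin cos a b ab (fun t _ => is_derive_sin t)
    (continuous_subspaceT (@continuous_sin R)).
  rewrite in_itv /= => /andP[ac cb].
  have c12 : `|c| <= 1 / 2.
    by move: ha hb; rewrite !ler_norml => /andP[? ?] /andP[? ?]; apply/andP; split; lra.
  have := cos_taylor c 0; rewrite sin0 mulr0 addr0 subr0 cos0.
  have c2' : c ^+ 2 <= 1 / 4.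
    rewrite -(real_normK (num_real c)) (_ : 1 / 4 = (1 / 2) ^+ 2); last by field.
    by rewrite lerXn2r// nnegrE; lra.
  rewrite ler_norml => /andP[h' _].
  have hc : 0 <= cos c * (b - a) by rewrite mulr_ge0 ?subr_ge0//; lra.
  by move: h ba hc; lra.
have hN : `|- (1 / 2)| <= 1 / 2 :> R by rewrite normrN ger0_norm//; lra.
have hP : `|1 / 2| <= 1 / 2 :> R by rewrite ger0_norm//; lra.
have s0 : sin (- (1 / 2)) <= sin (1 / 2 : R) by apply: mono => //; lra.
pose x' := Num.max (sin (- (1 / 2))) (Num.min x (sin (1 / 2))).
have hx' : sin (- (1 / 2)) <= x' <= sin (1 / 2).
  by rewrite /x' le_max lexx /= ge_max s0 ge_min lexx orbT.
have c0 : - (1 / 2) <= 1 / 2 :> R by lra.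
have [t + st] : exists2 c : R, c \in `[- (1 / 2), 1 / 2] & sin c = x'.
  apply: IVT => //; first by apply: continuous_subspaceT; exact: continuous_sin.
  by rewrite min_l// max_r.
rewrite in_itv /= -ler_norml => ht; exists t; split => // y hy.
rewrite (le_trans (sin_expand ht hy))// ler_wpM2l// st.
have hy' : sin (- (1 / 2)) <= sin y <= sin (1 / 2).
  by move: (hy); rewrite ler_norml => /andP[h1 h2]; apply/andP; split; apply: mono.
move: hy' => /andP[h1 h2]; rewrite /x'.
have [k1|k1] := lerP x (sin (- (1 / 2))).
  rewrite min_l ?(le_trans k1)// max_l// ler_norml.
  by rewrite ler0_norm ?subr_le0 ?(le_trans k1)//; apply/andP; split; lra.
have [k2|k2] := lerP x (sin (1 / 2)); first by rewrite max_r// ltW.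
rewrite max_r// ler_norml ger0_norm ?subr_ge0 ?(le_trans h2) ?(ltW k2)//.
by apply/andP; split; lra.
Qed.

(* Bernstein polynomials of [g] in the variables sin (v_j / (2 L)), which are injective on the
   box; being averages of values of [g], they satisfy the same bound everywhere. *)
Lemma trig_approx (g : 'cV[R]_p -> R) (M L e : R) : continuous g ->
  (forall v, `|g v| <= M) -> 0 < L -> 0 < e ->
  exists F, [/\ trigpoly F, forall v, `|F v| <= M &
    forall v : 'cV[R]_p, (forall j, `|v j 0| <= L) -> `|F v - g v| <= e].
Proof.
move=> cg gM L0 e0; have M0 : 0 <= M := le_trans (normr_ge0 _) (gM 0).
have e20 : 0 < e / 2 by rewrite divr_gt0.
have [eta eta0 heta] := uniform_continuity_box L cg e20.
have /choice[t ht] := sin_inverse.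
pose u (j : 'I_p) (v : 'cV[R]_p) : R := 1 / 2 + 1 / 2 * sin (v j 0 * (2 * L)^-1).
(* The node at which the variables [u] would take the values [k / N], with clamping when these are
   out of range. *)
pose y (N : nat) (k : 'I_p -> nat) : 'cV[R]_p :=
  \col_j (2 * L * t (2 * ((k j)%:R / N%:R) - 1)).
have tu j : trigpoly (u j).
  apply: trigpolyD; first exact: trigpoly_cst.
  by apply: trigpolyM; [exact: trigpoly_cst|exact: trigpoly_sin].
have u01 v j : 0 <= u j v <= 1.
  rewrite /u; have := sin_max (v j 0 * (2 * L)^-1); rewrite ler_norml => /andP[? ?].
  by apply/andP; split; lra.
(* If a node is farther than [eta] from [v] in coordinate [j], then [k j / N] misses [u j v] by at
   least [eta / (8 * L)]: a factor [2 * L] from rescaling, 2 from inverting the sine and 2 from the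
   affine map. The quadratic term then exceeds the trivial bound [2 * M]. *)
pose C := 2 * M / (eta / (8 * L)) ^+ 2.
have r0 : 0 < eta / (8 * L) by rewrite divr_gt0// mulr_gt0.
have C0 : 0 <= C by rewrite divr_ge0 ?sqr_ge0// mulr_ge0.
pose N := (Num.truncn (2 * C * p%:R / e)).+1.
have N0 : (0 : R) < N%:R by rewrite ltr0n.
have HN : C * (p%:R / N%:R) <= e / 2.
  have : 2 * C * p%:R / e <= N%:R by rewrite ltW// truncnS_gt.
  rewrite ler_pdivrMr// => h.
  by rewrite mulrA ler_pdivrMr//; lra.
exists (fun v => mbernstein N (enum 'I_p) (fun k => g (y N k)) (fun j => u j v) (fun _ => 0%N)).
split.
- exact: trigpoly_mbernstein.
- by move=> v; apply: mbernstein_norm_le => // j; exact: u01.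
move=> v vL.
have szp : size (enum 'I_p) = p by rewrite size_enum_ord.
have -> : e = e / 2 + e / 2 by exact: splitr.
apply: le_trans (lerD (lexx _) HN); rewrite -[in leRHS]szp.
apply: mbernstein_dev => //; first exact: enum_uniq.
move=> k _; have [[j hj]|h] := pselect (exists j, eta < `|y N k j 0 - v j 0|); last first.
  rewrite (@le_trans _ _ (e / 2))//; last first.
    by rewrite lerDl mulr_ge0// sumr_ge0// => j _; exact: sqr_ge0.
  apply: heta => // j; rewrite leNgt; apply/negP => hj; apply: h; by exists j.
have uj : `|v j 0 * (2 * L)^-1| <= 1 / 2.
  rewrite normrM normfV (ger0_norm (_ : 0 <= 2 * L)) ?mulr_ge0 ?(ltW L0)//.
  rewrite ler_pdivrMr ?mulr_gt0// (le_trans (vL j))//.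
  lra.
have h1 := (ht (2 * ((k j)%:R / N%:R) - 1)).2 _ uj.
have h2 : `|y N k j 0 - v j 0| <= 8 * L * `|(k j)%:R / N%:R - u j v|.
  have -> : y N k j 0 - v j 0 =
      2 * L * (t (2 * ((k j)%:R / N%:R) - 1) - v j 0 * (2 * L)^-1).
    by rewrite mxE; field; rewrite gt_eqF.
  rewrite normrM (ger0_norm (_ : 0 <= 2 * L)) ?mulr_ge0 ?(ltW L0)//.
  have L20 : 0 <= 2 * L by rewrite mulr_ge0// ltW.
  rewrite (le_trans (ler_wpM2l L20 h1))//.
  have -> : 2 * ((k j)%:R / N%:R) - 1 - sin (v j 0 * (2 * L)^-1) =
     2 * ((k j)%:R / N%:R - u j v) by rewrite /u; field; rewrite gt_eqF.
  rewrite normrM (ger0_norm (_ : 0 <= 2))//.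
  by rewrite le_eqVlt; apply/orP; left; apply/eqP; ring.
have h3 : (eta / (8 * L)) ^+ 2 <= ((k j)%:R / N%:R - u j v) ^+ 2.
  rewrite -(real_normK (num_real (_ - u j v))) lerXn2r ?nnegrE ?(ltW r0)//.
  rewrite ler_pdivrMr ?mulr_gt0// mulrC; exact: ltW (lt_le_trans hj h2).
rewrite (@le_trans _ _ (2 * M))//.
  rewrite (le_trans (ler_normB _ _))//; have := gM (y N k); have := gM v; lra.
rewrite (@le_trans _ _ (C * (eta / (8 * L)) ^+ 2))//.
  by rewrite /C divfK// expf_eq0 /= gt_eqF.
rewrite (@le_trans _ _ (C * \sum_(j <- enum 'I_p) ((k j)%:R / N%:R - u j v) ^+ 2))//.
  rewrite ler_wpM2l// (le_trans h3)// (bigD1_seq j) ?mem_enum ?enum_uniq//=.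
  by rewrite lerDl sumr_ge0// => i _; exact: sqr_ge0.
by rewrite lerDr ltW.
Qed.

End TrigApproximation.

Lemma cvg_sumr (R : realType) (I : Type) (s : seq I) (u : I -> nat -> R) (l : I -> R) :
  (forall i, u i n @[n --> \oo] --> l i) ->
  \sum_(i <- s) u i n @[n --> \oo] --> \sum_(i <- s) l i.
Proof. by move=> ul; apply: cvg_big => [|i _]; [exact: add_continuous|exact: ul]. Qed.

(** * Weak convergence from cosine integrals and tightness *)

Section VectorMeasurability.
Context {R : realType} (p : nat) d (T : measurableType d).
Implicit Types (V : T -> 'cV[R]_p).

Definition measurable_vec V : Prop := forall j, measurable_fun setT (fun w => V w j 0).

Lemma measurable_dotv (c : 'cV[R]_p) V : measurable_vec V ->
  measurable_fun setT (fun w => dotv c (V w)).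
Proof. by move=> mV; apply: measurable_sum => j; exact: measurable_funM. Qed.

Lemma measurable_vnorm V : measurable_vec V -> measurable_fun setT (fun w => vnorm (V w)).
Proof.
move=> mV; apply: (measurableT_comp (f := @Num.sqrt R)).
  by apply: continuous_measurable_fun; exact: sqrt_continuous.
by apply: measurable_sum => j; exact: measurable_funM.
Qed.

Lemma measurable_vnorm_gt (M : R) V : measurable_vec V -> measurable [set w | M < vnorm (V w)].
Proof.
move=> mV; have := measurable_fun_ltr (measurable_cst M) (measurable_vnorm mV).
by move=> /(_ measurableT [set true] Logic.I); rewrite setTI.
Qed.

Lemma measurable_trigpoly F V : trigpoly F -> measurable_vec V -> measurable_fun setT (F \o V).
Proof.
move=> [s hs] mV.
have -> : F \o V = (fun w => \sum_(t <- s) t.1.1 * cos (dotv t.1.2 (V w) + t.2)).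
  by apply/funext => w /=.
apply: measurable_sum => t; apply: measurable_funM => //.
apply: (measurableT_comp measurable_cos); apply: measurable_funD => //.
exact: measurable_dotv.
Qed.

Lemma vnorm_ge0 (v : 'cV[R]_p) : 0 <= vnorm v. Proof. exact: sqrtr_ge0. Qed.

Lemma dotv_ge0 (v : 'cV[R]_p) : 0 <= dotv v v.
Proof. by apply: sumr_ge0 => j _; rewrite -expr2 sqr_ge0. Qed.

Lemma coord_le_vnorm (v : 'cV[R]_p) j : `|v j 0| <= vnorm v.
Proof.
rewrite -sqrtr_sqr ler_wsqrtr// /dotv (bigD1 j)//= -expr2 lerDl.
by apply: sumr_ge0 => i _; rewrite -expr2 sqr_ge0.
Qed.

(** Measurability of [V] is given by coordinates. This is enough for trigonometric polynomials, of
    which [g] is a pointwise limit. *)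
Lemma measurable_continuous_vec (g : 'cV[R]_p -> R) (M : R) V :
  continuous g -> (forall v, `|g v| <= M) -> measurable_vec V ->
  measurable_fun setT (g \o V).
Proof.
move=> cg gM mV.
have /choice[F hF] : forall k : nat, exists F, [/\ trigpoly F, forall v, `|F v| <= M &
    forall v : 'cV[R]_p, (forall j, `|v j 0| <= k.+1%:R) -> `|F v - g v| <= k.+1%:R^-1].
  by move=> k; apply: trig_approx; rewrite ?invr_gt0 ?ltr0n.
apply: (measurable_fun_cvg (h := fun k => F k \o V)).
  by move=> k; apply: measurable_trigpoly => //; have [] := hF k.
move=> w _ /=; apply/cvgrPdist_le => e e0.
exists (maxn (Num.truncn (vnorm (V w))) (Num.truncn e^-1)) => // k /=.
rewrite geq_max => /andP[k1 k2]; have [_ _ h] := hF k.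
rewrite distrC (le_trans (h _ _))//.
  move=> j; rewrite (le_trans (coord_le_vnorm _ _))// ltW//.
  by rewrite (lt_le_trans (truncnS_gt _))// ler_nat.
rewrite invf_ple ?posrE ?ltr0n// ltW// (lt_le_trans (truncnS_gt _))// ler_nat.
by [].
Qed.

Lemma tight_single (P : probability T R) V (eta : R) : measurable_vec V -> 0 < eta ->
  exists L : nat, (P [set w | (L%:R < vnorm (V w))%R] <= eta%:E)%E.
Proof.
move=> mV eta0; pose C (k : nat) := [set w | (k%:R < vnorm (V w))%R].
have mC k : measurable (C k) by exact: measurable_vnorm_gt.
have C0 : \bigcap_n C n = set0.
  apply/seteqP; split=> // w h.
  have := h (Num.truncn (vnorm (V w))).+1 Logic.I; rewrite /C /= => h1.
  by have := lt_trans h1 (truncnS_gt (vnorm (V w))); rewrite ltxx.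
have : P \o C @ \oo --> P (\bigcap_n C n).
  apply: nonincreasing_cvg_mu => //.
  - by rewrite (le_lt_trans (probability_le1 P (mC 0%N))) ?ltry.
  - exact: bigcap_measurable.
  - move=> a b ab; apply/subsetPset => w; rewrite /C /=; apply: le_lt_trans.
    by rewrite ler_nat.
rewrite C0 measure0 => /fine_cvgP[_ /cvgrPdist_le /(_ _ eta0) [k _ hk]].
exists k; have := hk k (leqnn k); rewrite sub0r normrN /= => h.
rewrite -/(C k) -(fineK (fin_num_measure P _ (mC k))) lee_fin.
exact: le_trans (ler_norm _) h.
Qed.

End VectorMeasurability.

Section WeakConvergence.
Context {R : realType} (p : nat) d (T : measurableType d) (P : probability T R).
Context dO (O : measurableType dO) (Q : probability O R).
Variables (V : nat -> T -> 'cV[R]_p) (Z : O -> 'cV[R]_p).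
Hypotheses (mV : forall n, measurable_vec (V n)) (mZ : measurable_vec Z).
Hypothesis tightV : bounded_prob P V.
Hypothesis cvg_cos : forall (c : 'cV[R]_p) (b : R),
  \int[P]_w cos (dotv c (V n w) + b) @[n --> \oo] --> \int[Q]_o cos (dotv c (Z o) + b).

Let mcos d' (T' : measurableType d') (Y : T' -> 'cV[R]_p) (c : 'cV[R]_p) (b : R) :
  measurable_vec Y -> measurable_fun setT (fun w => cos (dotv c (Y w) + b)).
Proof.
move=> mY; apply: (measurableT_comp measurable_cos); apply: measurable_funD => //.
exact: measurable_dotv.
Qed.

Lemma cvg_trigpoly F : trigpoly F ->
  \int[P]_w F (V n w) @[n --> \oo] --> \int[Q]_o F (Z o).
Proof.
move=> [s hs].
have E d' (T' : measurableType d') (P' : probability T' R) (Y : T' -> 'cV[R]_p) :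
    measurable_vec Y ->
    \int[P']_w F (Y w) = \sum_(t <- s) t.1.1 * \int[P']_w cos (dotv t.1.2 (Y w) + t.2).
  move=> mY; under eq_Rintegral do rewrite hs.
  have ic t : integ P' (fun w => cos (dotv t.1.2 (Y w) + t.2)).
    by apply: (integ_bounded P' (C := 1)) => [|w]; [exact: mcos|exact: cos_max].
  rewrite Rint_sum => [|t _]; last exact: integZ.
  by apply: eq_bigr => t _; rewrite RintegralZl.
rewrite E//.
have -> : (fun n => \int[P]_w F (V n w)) =
    (fun n => \sum_(t <- s) t.1.1 * \int[P]_w cos (dotv t.1.2 (V n w) + t.2)).
  by apply/funext => n; exact: E.
by apply: cvg_sumr => t; apply: cvgMr; exact: cvg_cos.
Qed.

Lemma approx_integral d' (T' : measurableType d') (P' : probability T' R)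
    (Y : T' -> 'cV[R]_p) (g F : 'cV[R]_p -> R) (M L e eta : R) : measurable_vec Y ->
  continuous g -> (forall v, `|g v| <= M) -> trigpoly F -> (forall v, `|F v| <= M) ->
  (forall v : 'cV[R]_p, (forall j, `|v j 0| <= L) -> `|F v - g v| <= e) -> 0 <= e ->
  (P' [set w | (L < vnorm (Y w))%R] <= eta%:E)%E ->
  `|(\int[P']_w F (Y w)) - \int[P']_w g (Y w)| <= e + 2 * M * eta.
Proof.
move=> mY cg gM tF FM Fg e0 tail.
have M0 : 0 <= M := le_trans (normr_ge0 _) (gM 0).
have mg := measurable_continuous_vec cg gM mY.
have mF := measurable_trigpoly tF mY.
pose B := [set w | (L < vnorm (Y w))%R].
have mB : measurable B by exact: measurable_vnorm_gt.
have ig : integ P' (g \o Y) by apply: (integ_bounded P' mg) => w; exact: gM.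
have iF : integ P' (F \o Y) by apply: (integ_bounded P' mF) => w; exact: FM.
have iB : integ P' (fun w => e + 2 * M * \1_B w).
  apply: integD; first exact: integ_cst.
  by apply: integZ; apply: sqi_integ; exact: sqi_indic.
rewrite -RintegralB// (le_trans (Rint_norm_le _ iB _))//.
- exact: measurable_funB.
- move=> w /=; have [LY|LY] := ltP L (vnorm (Y w)).
    rewrite indicE mem_set//= mulr1 (le_trans (ler_normB _ _))//.
    by have := FM (Y w); have := gM (Y w); lra.
  rewrite indicE memNset ?mulr0 ?addr0; last by rewrite /B /= => h; move: LY; rewrite leNgt h.
  by apply: Fg => j; exact: le_trans (coord_le_vnorm _ _) LY.
rewrite RintegralD//; [|exact: integ_cst|by apply: integZ; apply: sqi_integ; exact: sqi_indic].
rewrite Rint_cst lerD2l RintegralZl//; last by apply: sqi_integ; exact: sqi_indic.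
rewrite ler_wpM2l ?mulr_ge0// /Rintegral.
rewrite integral_indic// setIT -lee_fin fineK//; exact: fin_num_measure.
Qed.

(** The approximant keeps the bound [M] outside the box, so the complement of the box costs at most
    [2 * M] times its probability. *)
Lemma weak_cvg (g : 'cV[R]_p -> R) : continuous g -> (exists M : R, forall v, `|g v| <= M) ->
  \int[P]_w g (V n w) @[n --> \oo] --> \int[Q]_o g (Z o).
Proof.
move=> cg [M gM]; have M0 : 0 <= M := le_trans (normr_ge0 _) (gM 0).
apply/cvgrPdist_le => e e0.
(* For each of the two laws, [e / 5] is spent on the box and at most [e / 5] off it; the last fifth
   is for the convergence of the integrals of [F]. *)
have e50 : 0 < e / 5 by rewrite divr_gt0.
have eta0 : 0 < e / (10 * (M + 1)) by rewrite divr_gt0// mulr_gt0// ltr_wpDl.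
have [LV [N1 hN1]] := tightV eta0.
have [LZ hLZ] := tight_single Q mZ eta0.
pose L := Num.max 1 (Num.max LV LZ%:R).
have L0 : 0 < L by rewrite lt_max ltr01.
have [F [tF FM Fg]] := trig_approx cg gM L0 e50.
have mono d' (T' : measurableType d') (P' : probability T' R) (Y : T' -> 'cV[R]_p) (l : R) (x : \bar R) :
   measurable_vec Y -> l <= L -> (P' [set w | (l < vnorm (Y w))%R] <= x)%E ->
   (P' [set w | (L < vnorm (Y w))%R] <= x)%E.
  move=> mY lL; apply: le_trans; apply: le_measure; rewrite ?inE.
  - exact: measurable_vnorm_gt.
  - exact: measurable_vnorm_gt.
  - by move=> w /=; apply: le_lt_trans.
have tZ := mono _ _ Q Z LZ%:R _ mZ _ hLZ.
have /cvgrPdist_le /(_ _ e50) [N2 _ hN2] := cvg_trigpoly tF.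
exists (maxn N1 N2) => // n /=; rewrite geq_max => /andP[n1 n2].
have tV := mono _ _ P (V n) LV _ (mV n) _ (ltW (hN1 n n1)).
have aV := approx_integral (mV n) cg gM tF FM Fg (ltW e50) (tV _).
have aZ := approx_integral mZ cg gM tF FM Fg (ltW e50) (tZ _).
have {}aV : `|(\int[P]_w F (V n w)) - \int[P]_w g (V n w)| <= e / 5 + 2 * M * (e / (10 * (M + 1))).
  by apply: aV; rewrite !le_max lexx orbT.
have {}aZ : `|(\int[Q]_w F (Z w)) - \int[Q]_w g (Z w)| <= e / 5 + 2 * M * (e / (10 * (M + 1))).
  by apply: aZ; rewrite !le_max lexx !orbT.
have hM : 2 * M * (e / (10 * (M + 1))) <= e / 5.
  rewrite (_ : 2 * M * _ = e / 5 * (M / (M + 1))); last by field; rewrite gt_eqF// ltr_wpDl.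
  rewrite -[leRHS]mulr1 ler_wpM2l ?(ltW e50)//.
  by rewrite ler_pdivrMr ?ltr_wpDl// mul1r lerDl.
have h3 := hN2 n n2.
have fin (a1 b1 a2 b2 : R) : `|a1 - b1| <= e / 5 + e / 5 -> `|a2 - b2| <= e / 5 + e / 5 ->
    `|b1 - b2| <= e / 5 -> `|a1 - a2| <= e.
  by rewrite !ler_norml => /andP[? ?] /andP[? ?] /andP[? ?]; apply/andP; split; lra.
apply: (fin _ _ _ _ _ _ h3); rewrite distrC.
- exact: le_trans aZ (lerD (lexx _) hM).
- exact: le_trans aV (lerD (lexx _) hM).
Qed.

End WeakConvergence.

(** * Cosine integrals of a standard Gaussian vector *)

Section GaussianVector.
Context {R : realType} dO (O : measurableType dO) (Q : probability O R).
Context (I : eqType) (W : I -> O -> R).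
Hypothesis indW : mutually_independent Q W.
Hypothesis lawW : forall j (B : set R), measurable B -> Q (W j @^-1` B) = normal_prob 0 1 B.

Let W_cos j (s b : R) : \int[Q]_o cos (s * W j o + b) = expR (- s ^+ 2 / 2) * cos b.
Proof.
have mlin : measurable_fun setT (fun x : R => cos (s * x + b)).
  apply: (measurableT_comp measurable_cos).
  by apply: measurable_funD => //; exact: measurable_funM.
have mW : measurable_fun setT (W j : O -> measurableTypeR R) by exact (indW.1 j).
have mlin' : measurable_fun (setT : set (measurableTypeR R)) (fun x : R => cos (s * x + b)).
  exact mlin.
rewrite -(law_Rint Q mW mlin') -normal_cos /Rintegral; congr fine.
by rewrite (eq_measure_integral (normal_prob 0 1)) => [//|A mA _]; exact: lawW.
Qed.

(** The addition formula and independence split off one variable. Its sine is written as a cosine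
    with phase [- pi / 2], whose integral is 0 by [W_cos]. *)
Lemma gaussian_vector_cos (r : seq I) (s : I -> R) (b : R) : uniq r ->
  \int[Q]_o cos (\sum_(j <- r) s j * W j o + b) =
  expR (- (\sum_(j <- r) s j ^+ 2) / 2) * cos b.
Proof.
elim: r b => [|j r IH] b /=.
  move=> _; under eq_Rintegral do rewrite big_nil add0r.
  by rewrite Rint_cst big_nil oppr0 mul0r expR0 mul1r.
move=> /andP[jr ur]; rewrite big_cons.
pose G0 := [set A | exists i (B : set R), [/\ [set` r] i, measurable B & A = W i @^-1` B]].
have mg i : i \in r -> measurable_fun (setT : set (g_sigma_algebraType G0)) (W i).
  by move=> ir _ B mB; rewrite setTI; apply: sub_sigma_algebra; exists i, B.
pose Zr := fun o : O => \sum_(i <- r) s i * W i o.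
have mZ : measurable_fun (setT : set (g_sigma_algebraType G0)) Zr.
  rewrite /Zr; under eq_fun do rewrite big_seq -big_filter.
  have fr i : i \in [seq i <- r | i \in r] -> i \in r by rewrite mem_filter => /andP[].
  elim: [seq i <- r | i \in r] fr => [|k l IHl] fr.
    by under eq_fun do rewrite big_nil; exact: measurable_cst.
  under eq_fun do rewrite big_cons; apply: measurable_funD.
    by apply: measurable_funM => //; apply: mg; apply: fr; rewrite inE eqxx.
  by apply: IHl => i il; apply: fr; rewrite inE il orbT.
have mtrig (f : R -> R) c : measurable_fun setT f ->
    measurable_fun (setT : set (g_sigma_algebraType G0)) (fun o => f (Zr o + c)).
  by move=> mf; apply: (measurableT_comp mf); exact: measurable_funD.
have Gm : <<s G0 >> `<=` measurable by exact: (gen_sigma_measurable indW.1).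
have mtrigO (f : R -> R) c : measurable_fun setT f -> measurable_fun setT (fun o => f (Zr o + c)).
  by move=> mf _ B mB; rewrite setTI; apply: Gm; rewrite -[X in <<s _ >> X]setTI; exact: mtrig.
have mWj (f : R -> R) c : measurable_fun setT f -> measurable_fun setT (fun o => f (s j * W j o + c)).
  move=> mf; apply: (measurableT_comp mf); apply: measurable_funD => //.
  by apply: measurable_funM => //; exact: indW.1.
have prod (f g : R -> R) c c' : measurable_fun setT f -> measurable_fun setT g ->
    (forall x, `|f x| <= 1) -> (forall x, `|g x| <= 1) ->
    \int[Q]_o (f (s j * W j o + c) * g (Zr o + c')) =
    \int[Q]_o f (s j * W j o + c) * \int[Q]_o g (Zr o + c').
  move=> mf mg' f1 g1; apply: (indep_Rint (C := 1) (D := 1)) => //.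
  - exact: mWj.
  - exact: mtrigO.
  move=> A B mA mB.
  apply: (gen_sigma_indep indW.1 indW (J1 := [set j]) (J2 := [set` r])).
  - by move=> i /= ->; apply/negP.
  - apply: sub_sigma_algebra; exists j, ((fun x => f (s j * x + c)) @^-1` A); split => //.
    rewrite -[X in measurable X]setTI; apply: (measurableT_comp mf) => //.
    by apply: measurable_funD => //; exact: measurable_funM.
  - rewrite /gen_sigma -[X in <<s _ >> X]setTI; exact: (mtrig g c').
have ic (f g : R -> R) c c' : measurable_fun setT f -> measurable_fun setT g ->
    (forall x, `|f x| <= 1) -> (forall x, `|g x| <= 1) ->
    integ Q (fun o => f (s j * W j o + c) * g (Zr o + c')).
  move=> mf mg' f1 g1; apply: (integ_bounded Q (C := 1)) => [|o].
    by apply: measurable_funM; [exact: mWj|exact: mtrigO].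
  by rewrite normrM -[leRHS]mulr1 ler_pM.
have msin := @measurable_sin R; have mcos := @measurable_cos R.
have E o : cos (\sum_(i <- j :: r) s i * W i o + b) =
    cos (s j * W j o + 0) * cos (Zr o + b) - cos (s j * W j o + - (pi / 2)) * sin (Zr o + b).
  rewrite big_cons -addrA -/(Zr o) cosD addr0 cosB cos_pihalf sin_pihalf.
  by rewrite mulr0 add0r mulr1.
under eq_Rintegral do rewrite E.
rewrite RintegralB//; [|by apply: ic => // x; exact: cos_max|by
  apply: ic => // x; [exact: cos_max|exact: sin_max]].
rewrite !prod//; do ?[by move=> x; exact: cos_max|by move=> x; exact: sin_max].
rewrite !W_cos IH// cosN cos_pihalf mulr0 mul0r subr0 cos0 mulr1.
by rewrite mulrA -expRD; congr (expR _ * _); field.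
Qed.

End GaussianVector.

(** * The loss is asymptotically quadratic *)

Lemma sqi_norm d (T : measurableType d) (R : realType) (P : probability T R) (f : T -> R) :
  sqi P f -> sqi P (fun x => `|f x|).
Proof.
move=> [mf f2]; split; first by apply: measurableT_comp.
by move: f2; congr integrable; apply/funext => x /=; rewrite real_normK ?num_real.
Qed.

Lemma norm2_abs d (T : measurableType d) (R : realType) (P : probability T R) (f : T -> R) :
  norm2 P (fun x => `|f x|) = norm2 P f.
Proof.
by congr Num.sqrt; apply: eq_Rintegral => x _; rewrite -!expr2 real_normK ?num_real.
Qed.

Section LossExpansion.
Context {dS : measure_display} (S : measurableType dS) (R : realType).
Context d (T : measurableType d) (P : probability T R).
Variables (mu : probability S R) (X : int -> T -> S).
Hypothesis HX : iid_law P mu X.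
Local Notation nu := (past_law HX).
Local Notation U := (@shift _ S R).
Variables (rho psi : R -> R) (q : seqspace S -> R).
Hypothesis psi_sub : forall a b : R, rho a + psi a * (b - a) <= rho b.
Hypothesis psi_mono : forall a b : R, a <= b -> psi a <= psi b.
Variables (t1 B dphi : R) (dl : nat -> R).
Let f (t : R) : seqspace S -> R := fun x => psi (q x + t).
Hypothesis f_sqi : forall t, `|t| <= t1 -> sqi nu (f t).
Hypothesis f_coef : forall t j, `|t| <= t1 -> innov_coef HX j (f t) <= dl j.
Hypothesis dl_sum : forall J, \sum_(j < J) dl j <= B.
Hypothesis f_cont : forall e, 0 < e -> exists2 eta, 0 < eta <= t1 &
  forall t, `|t| <= eta -> norm2 nu (fun x => f 0 x - f t x) <= e.
Hypothesis f_mean : \int[nu]_x f 0 x = 0.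
Hypothesis f_deriv : forall e, 0 < e -> exists2 eta, 0 < eta <= t1 &
  forall t, `|t| <= eta -> `|(\int[nu]_x f t x) - dphi * t| <= e * `|t|.

Definition loss_rem (tau : R) : seqspace S -> R :=
  fun x => rho (q x - tau) - rho (q x) + tau * psi (q x).

(* Each term is a difference of two translates of [psi], to which condition (7) applies;
   [loss_rem] is only controlled through these sums. *)
Definition loss_riemann (N : nat) (tau : R) : seqspace S -> R :=
  fun x => \sum_(k < N.+1) (tau / N.+1%:R) * (f 0 x - f (- (tau * (k.+1%:R / N.+1%:R))) x).

(** The subgradient inequalities at [q x] and at [q x - tau] place the remainder between 0 and
    [tau (psi (q x) - psi (q x - tau))]. *)
Lemma loss_rem_bound tau x : `|loss_rem tau x| <= `|tau| * `|f 0 x - f (- tau) x|.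
Proof.
rewrite /loss_rem /f addr0.
have h1 := psi_sub (q x) (q x - tau); have h2 := psi_sub (q x - tau) (q x).
have h3 : 0 <= rho (q x - tau) - rho (q x) + tau * psi (q x) by lra.
by rewrite ger0_norm// -normrM (le_trans _ (ler_norm _))//; lra.
Qed.

(** The two subgradient inequalities are applied on each cell of the subdivision; the resulting
    bounds telescope to a single difference of [psi] times the mesh. *)
Lemma loss_riemann_dist N tau x :
  `|loss_rem tau x - loss_riemann N tau x| <= `|tau| / N.+1%:R * `|f 0 x - f (- tau) x|.
Proof.
pose a k := q x - tau * (k%:R / N.+1%:R).
have N0 : N.+1%:R != 0 :> R by rewrite pnatr_eq0.
have a0 : a 0%N = q x by rewrite /a mul0r mulr0 subr0.
have aN : a N.+1 = q x - tau by rewrite /a divff// mulr1.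
have aS k : a k.+1 - a k = - (tau / N.+1%:R).
  by rewrite /a -natr1; field.
have tel (u : nat -> R) : \sum_(k < N.+1) (u k.+1 - u k) = u N.+1 - u 0%N.
  by rewrite -(telescope_sumr u (leq0n N.+1)) big_mkord.
have -> : loss_rem tau x - loss_riemann N tau x = \sum_(k < N.+1)
    (rho (a k.+1) - rho (a k) + tau / N.+1%:R * psi (a k.+1)).
  rewrite big_split /= (tel (fun k => rho (a k))) a0 aN /loss_rem -addrA; congr (_ + _).
  have -> : loss_riemann N tau x =
      \sum_(k < N.+1) (tau / N.+1%:R * psi (q x) - tau / N.+1%:R * psi (a k.+1)).
    by apply: eq_bigr => k _; rewrite /f addr0 mulrBr.
  rewrite sumrB sumr_const card_ord.
  by rewrite -[_ *+ _]mulr_natr mulrAC divfK// opprB addrCA subrr addr0.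
have lo k : tau / N.+1%:R * (psi (a k.+1) - psi (a k)) <=
    rho (a k.+1) - rho (a k) + tau / N.+1%:R * psi (a k.+1).
  have := psi_sub (a k) (a k.+1); rewrite aS; move: (tau / _) => z; lra.
have hi k : rho (a k.+1) - rho (a k) + tau / N.+1%:R * psi (a k.+1) <= 0.
  have := psi_sub (a k.+1) (a k); rewrite -(opprB (a k.+1)) aS; move: (tau / _) => z; lra.
rewrite ler0_norm; last by apply: sumr_le0.
have -> : `|tau| / N.+1%:R = `|tau / N.+1%:R| by rewrite normrM [`|N.+1%:R^-1|]ger0_norm.
rewrite -normrM (le_trans _ (ler_norm _))// lerNl.
have -> : - (tau / N.+1%:R * (f 0 x - f (- tau) x)) =
    \sum_(k < N.+1) tau / N.+1%:R * (psi (a k.+1) - psi (a k)).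
  by rewrite -mulr_sumr (tel (fun k => psi (a k))) a0 aN /f addr0 -mulrN opprB.
exact: ler_sum.
Qed.

Lemma loss_step (N k : nat) (tau : R) : (k < N.+1)%N ->
  `|- (tau * (k.+1%:R / N.+1%:R))| <= `|tau|.
Proof.
move=> kN; rewrite normrN normrM ler_piMr// ger0_norm//.
by rewrite ler_pdivrMr// mul1r ler_nat.
Qed.

Let f0_sqi : sqi nu (f 0).
Proof. by have [e /andP[e0 e1] _] := f_cont ltr01; apply: f_sqi; rewrite normr0 ltW// (lt_le_trans e0). Qed.

Lemma loss_riemann_sqi N tau : `|tau| <= t1 -> sqi nu (loss_riemann N tau).
Proof.
move=> ht; apply: sqi_sum => k _; apply: sqiZ; apply: sqiB => //; apply: f_sqi.
exact: le_trans (loss_step _ (ltn_ord k)) ht.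
Qed.

Let fN_sqi tau : `|tau| <= t1 -> sqi nu (f (- tau)).
Proof. by move=> ht; apply: f_sqi; rewrite normrN. Qed.

Lemma le_archimedean (a b c : R) : 0 <= c -> (forall N : nat, a <= b + c / N.+1%:R) -> a <= b.
Proof.
move=> c0 h; apply/ler_addgt0Pr => e e0.
rewrite (le_trans (h (Num.truncn (c / e))))// lerD2l ler_pdivrMr// -ler_pdivrMl//.
by rewrite mulrC ltW// truncnS_gt.
Qed.

Lemma loss_rem_sqi tau : `|tau| <= t1 -> sqi nu (loss_rem tau).
Proof.
move=> ht; have h0 := sqiB f0_sqi (fN_sqi ht).
(* Measurability is inherited from the Riemann sums, which involve only [psi]. *)
have mh : measurable_fun setT (loss_rem tau).
  apply: (measurable_fun_cvg (h := fun N => loss_riemann N tau)) => [N|x _].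
    by have [] := loss_riemann_sqi N ht.
  apply/cvgrPdist_le => e e0; pose c := `|tau| * `|f 0 x - f (- tau) x|.
  exists (Num.truncn (c / e)) => // N /= hN.
  rewrite (le_trans (loss_riemann_dist _ _ _))// mulrAC -/c ler_pdivrMr// -ler_pdivrMl//.
  rewrite mulrC ltW// (lt_le_trans (truncnS_gt _))// ler_nat.
  by [].
apply: (sqi_le (g := fun x => `|tau| * `|f 0 x - f (- tau) x|)) => //.
  by move=> x; exact: loss_rem_bound.
by apply: sqiZ; exact: sqi_norm.
Qed.

Lemma loss_rem_norm2 N tau : `|tau| <= t1 ->
  norm2 nu (fun x => loss_rem tau x - loss_riemann N tau x) <=
  `|tau| * norm2 nu (fun x => f 0 x - f (- tau) x) / N.+1%:R.
Proof.
move=> ht; have h0 := sqiB f0_sqi (fN_sqi ht).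
have hi := sqiB (loss_rem_sqi ht) (loss_riemann_sqi N ht).
rewrite (le_trans (norm2_mono (sqi_measurable hi) (sqiZ (`|tau| / N.+1%:R) (sqi_norm h0)) _))//.
  by move=> x; exact: loss_riemann_dist.
rewrite norm2Z; last exact: sqi_norm.
by rewrite norm2_abs ger0_norm// mulrAC.
Qed.

(** Sublinearity of the coefficients gives the bound for every Riemann sum uniformly in [N]; the
    distance to the sum tends to 0 in L2, a norm that dominates each coefficient. *)
Lemma loss_rem_coef tau j w : `|tau| <= t1 ->
  (forall t, `|t| <= `|tau| -> innov_coef HX j (fun x => f 0 x - f t x) <= w) ->
  innov_coef HX j (loss_rem tau) <= `|tau| * w.
Proof.
move=> ht hw; have h0 := sqiB f0_sqi (fN_sqi ht).
apply: (@le_archimedean _ _ (`|tau| * norm2 nu (fun x => f 0 x - f (- tau) x))) => [|N].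
  by rewrite mulr_ge0// norm2_ge0.
have hR := loss_riemann_sqi N ht; have hL := loss_rem_sqi ht.
have -> : loss_rem tau = (fun x => loss_riemann N tau x - (loss_riemann N tau x - loss_rem tau x)).
  by apply/funext => x; ring.
rewrite (le_trans (innov_coefB _ _ _))//; first exact: sqiB.
apply: lerD; last first.
  rewrite (le_trans (innov_coef_le _ _))//; first exact: sqiB.
  rewrite -norm2N; last exact: sqiB.
  have -> : (fun x => - (loss_riemann N tau x - loss_rem tau x)) =
    (fun x => loss_rem tau x - loss_riemann N tau x) by apply/funext => x; rewrite opprB.
  exact: loss_rem_norm2.
rewrite (le_trans (@innov_coef_sum _ _ _ _ _ _ _ _ HX j _ _ (fun=> tau / N.+1%:R)
  (fun k : 'I_N.+1 => fun x => f 0 x - f (- (tau * (k.+1%:R / N.+1%:R))) x) _))//.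
  by move=> k; apply: sqiB => //; apply: f_sqi; exact: le_trans (loss_step _ (ltn_ord k)) ht.
rewrite (@le_trans _ _ (\sum_(k < N.+1) `|tau| / N.+1%:R * w))//.
  apply: ler_sum => k _; rewrite normrM [`|N.+1%:R^-1|]ger0_norm//.
  by rewrite ler_wpM2l// hw//; exact: loss_step.
by rewrite sumr_const card_ord -[_ *+ _]mulr_natr mulrAC divfK ?pnatr_eq0.
Qed.

Lemma loss_rem_mean e eta tau : `|tau| <= eta -> eta <= t1 -> 0 <= e ->
  (forall t, `|t| <= eta -> `|(\int[nu]_x f t x) - dphi * t| <= e * `|t|) ->
  `|(\int[nu]_x loss_rem tau x) - dphi / 2 * tau ^+ 2| <= e * tau ^+ 2.
Proof.
move=> te et e0 he; have ht := le_trans te et; have h0 := sqiB f0_sqi (fN_sqi ht).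
set D := norm2 nu (fun x => f 0 x - f (- tau) x).
have D0 : 0 <= D by exact: norm2_ge0.
apply: (@le_archimedean _ _ (`|tau| * D + `|dphi| / 2 * tau ^+ 2)) => [|N].
  by apply: addr_ge0; rewrite mulr_ge0 ?sqr_ge0 // mulr_ge0 ?invr_ge0.
have N0 : N.+1%:R != 0 :> R by rewrite pnatr_eq0.
have hR := loss_riemann_sqi N ht; have hL := loss_rem_sqi ht.
pose s k := - (tau * (k.+1%:R / N.+1%:R)).
have sI (k : 'I_N.+1) : sqi nu (f (s k)) by apply: f_sqi; exact: le_trans (loss_step _ (ltn_ord k)) ht.
have E1 : \int[nu]_x loss_riemann N tau x = \sum_(k < N.+1) (tau / N.+1%:R) * - (\int[nu]_x f (s k) x).
  rewrite Rint_sum => [|k _]; last by apply: integZ; exact: sqi_integ (sqiB f0_sqi (sI k)).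
  apply: eq_bigr => k _; rewrite RintegralZl//; last exact: sqi_integ (sqiB f0_sqi (sI k)).
  by rewrite RintegralB ?f_mean ?sub0r//; [exact: sqi_integ f0_sqi|exact: sqi_integ (sI k)].
(* For the linear part of the mean the Riemann sum is arithmetic; it yields the limit and a
   correction of order [1 / N.+1]. *)
have E2 : dphi / 2 * tau ^+ 2 + dphi / 2 * tau ^+ 2 / N.+1%:R =
    \sum_(k < N.+1) (tau / N.+1%:R) * - (dphi * s k).
  have -> : \sum_(k < N.+1) (tau / N.+1%:R) * - (dphi * s k) =
      (dphi * tau ^+ 2 / N.+1%:R ^+ 2) * \sum_(k < N.+1) k.+1%:R.
    by rewrite mulr_sumr; apply: eq_bigr => k _; rewrite /s; field.
  have -> n : \sum_(k < n) k.+1%:R = (n%:R * (n%:R + 1)) / 2 :> R.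
    elim: n => [|n IH]; first by rewrite big_ord0; field.
    by rewrite big_ord_recr /= IH -natr1; field.
  by field; rewrite addrC natr1.
have E3 : `|(\int[nu]_x loss_riemann N tau x) - (dphi / 2 * tau ^+ 2 + dphi / 2 * tau ^+ 2 / N.+1%:R)|
    <= e * tau ^+ 2.
  rewrite E1 E2 -sumrB (le_trans (ler_norm_sum _ _ _))//.
  rewrite (@le_trans _ _ (\sum_(k < N.+1) e * tau ^+ 2 / N.+1%:R))//; last first.
    by rewrite sumr_const card_ord -[_ *+ _]mulr_natr divfK.
  apply: ler_sum => k _; rewrite -mulrBr opprK addrC -opprB mulrN normrN normrM.
  have h1 := he _ (le_trans (loss_step tau (ltn_ord k)) te).
  rewrite (le_trans (ler_wpM2l _ h1))// normrM [`|N.+1%:R^-1|]ger0_norm//.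
  rewrite (le_trans (ler_wpM2l _ (ler_wpM2l e0 (loss_step tau (ltn_ord k)))))//.
  rewrite -(real_normK (num_real tau)) [leLHS](_ : _ = e * `|tau| ^+ 2 / N.+1%:R)//; ring.
have E4 : `|(\int[nu]_x loss_rem tau x) - \int[nu]_x loss_riemann N tau x| <= `|tau| * D / N.+1%:R.
  rewrite -RintegralB//; [|exact: sqi_integ..].
  by apply: le_trans (Rint_le_norm2 (sqiB hL hR)) (loss_rem_norm2 N ht).
have E5 : `|dphi / 2 * tau ^+ 2 / N.+1%:R| <= `|dphi| / 2 * tau ^+ 2 / N.+1%:R.
  have z : 0 <= tau ^+ 2 / N.+1%:R / 2 by rewrite !divr_ge0// sqr_ge0.
  have -> : dphi / 2 * tau ^+ 2 / N.+1%:R = dphi * (tau ^+ 2 / N.+1%:R / 2) by field.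
  have -> : `|dphi| / 2 * tau ^+ 2 / N.+1%:R = `|dphi| * (tau ^+ 2 / N.+1%:R / 2) by field.
  by rewrite normrM (ger0_norm z).
have fin (a b c r c1 c2 c3 : R) : `|b - (c + r)| <= c1 -> `|a - b| <= c2 -> `|r| <= c3 ->
    `|a - c| <= c1 + (c2 + c3).
  by rewrite !ler_norml => /andP[? ?] /andP[? ?] /andP[? ?]; apply/andP; split; lra.
by rewrite mulrDl; exact: fin E3 E4 E5.
Qed.

Let innov_coef_cst j (c : R) : innov_coef HX j (fun _ => c) = 0.
Proof.
rewrite /innov_coef iter_transition_cst.
have -> : innov mu (fun _ => c) = (fun _ => 0).
  by apply/funext => x; rewrite /innov /shift /transition Rint_cst subrr.
by rewrite norm2_cst normr0.
Qed.

Definition loss_excess n (tau : nat -> R) : seqspace S -> R := fun x =>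
  \sum_(k < n) iter k U (loss_rem (tau k)) x - dphi / 2 * \sum_(k < n) tau k ^+ 2.

Lemma loss_excess_sqi n tau : (forall k, `|tau k| <= t1) -> sqi nu (loss_excess n tau).
Proof.
move=> ht; apply: sqiB; last exact: sqi_cst.
by apply: sqi_sum => k _; apply: iter_shift_sqi; exact: loss_rem_sqi.
Qed.

(** The fluctuation is handled by [innov_sum_cvg] and gives the square-root term; the accumulated
    error of the means gives the sum of squares. *)
Lemma loss_excess_norm2 e : 0 < e -> exists2 eta, 0 < eta <= t1 &
  forall n (tau : nat -> R), (forall k, `|tau k| <= eta) ->
  norm2 nu (loss_excess n tau) <=
    e * (Num.sqrt (\sum_(k < n) tau k ^+ 2) + \sum_(k < n) tau k ^+ 2).
Proof.
move=> e0.
have t10 : `|0 : R| <= t1.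
  by have [a /andP[a0 a1] _] := f_cont ltr01; rewrite normr0 ltW// (lt_le_trans a0).
have dl0 j : 0 <= dl j := le_trans (innov_coef_ge0 _ _ _) (f_coef j t10).
have e4 : 0 < e / 4 by rewrite divr_gt0.
have [J HJ] := summable_tail dl0 dl_sum e4.
have e2 : 0 < e / (2 * J.+1%:R) by rewrite divr_gt0// mulr_gt0.
have [a1 /andP[a10 a1t] h1] := f_cont e2.
have [a2 /andP[a20 a2t] h2] := f_deriv e0.
exists (Num.min a1 a2); first by rewrite lt_min a10 a20 ge_min a1t.
move=> n tau ht.
have ht1 k : `|tau k| <= a1 by rewrite (le_trans (ht k))// ge_min lexx.
have ht2 k : `|tau k| <= a2 by rewrite (le_trans (ht k))// ge_min lexx orbT.
have htt k := le_trans (ht1 k) a1t.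
(* The ages below [J] contribute at most [e / 2] together, and the tail of [2 * dl j] at most
   [2 * (e / 4)]. *)
pose w j := if (j < J)%N then e / (2 * J.+1%:R) else 2 * dl j.
have w0 j : 0 <= w j by rewrite /w; case: ifP => _; [exact: ltW|rewrite mulr_ge0].
have wB L : \sum_(j < L) w j <= e.
  have -> : \sum_(j < L) w j = \sum_(j < L) (if (j < J)%N then e / (2 * J.+1%:R) else 0) +
      2 * \sum_(j < L) (if (j < J)%N then 0 else dl j).
    rewrite mulr_sumr -big_split; apply: eq_bigr => j _ /=; rewrite /w.
    by case: ifP; rewrite ?mulr0 ?addr0 ?add0r.
  rewrite [leRHS](splitr e); apply: lerD; last by have := HJ L; lra.
  rewrite -big_mkcond /= (@le_trans _ _ (J%:R * (e / (2 * J.+1%:R))))//.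
    rewrite sumr_const -[_ *+ _]mulr_natl; apply: ler_wpM2r; first exact: ltW.
    rewrite ler_nat cardE -(size_map (@nat_of_ord L)) -[leqRHS](size_iota 0).
    apply: uniq_leq_size; first by rewrite map_inj_uniq ?enum_uniq//; exact: val_inj.
    by move=> j /mapP[k]; rewrite mem_enum unfold_in => h ->; rewrite mem_iota.
  rewrite (_ : J%:R * _ = e / 2 * (J%:R / J.+1%:R)); last by field; rewrite addrC natr1 pnatr_eq0.
  by rewrite ler_piMr ?divr_ge0 ?(ltW e0)// ler_pdivrMr// mul1r ler_nat.
pose m k := \int[nu]_x loss_rem (tau k) x.
pose g k : seqspace S -> R := fun x => loss_rem (tau k) x - m k.
have gi k : sqi nu (g k) by apply: sqiB; [exact: loss_rem_sqi|exact: sqi_cst].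
have g0 k : \int[nu]_x g k x = 0.
  rewrite RintegralB// ?Rint_cst ?subrr//; last exact: integ_cst.
  by apply: sqi_integ; exact: loss_rem_sqi.
have gw k j : innov_coef HX j (g k) <= `|tau k| * w j.
  rewrite (le_trans (innov_coefB _ _ _))//; [exact: loss_rem_sqi|exact: sqi_cst|].
  rewrite innov_coef_cst addr0; apply: loss_rem_coef => // t tt.
  have ta : `|t| <= a1 := le_trans tt (ht1 k); have tt1 := le_trans ta a1t.
  rewrite /w; case: ifP => _.
    by apply: le_trans (h1 t ta); apply: innov_coef_le; apply: sqiB; exact: f_sqi.
  rewrite (le_trans (innov_coefB _ _ _))//; [exact: f_sqi..|].
  by rewrite [2 * _]mulr_natl mulr2n lerD// f_coef.
have main := innov_sum_cvg n gi g0 (fun k => normr_ge0 (tau k)) w0 gw wB.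
have sq : \sum_(k < n) `|tau k| ^+ 2 = \sum_(k < n) tau k ^+ 2.
  by apply: eq_bigr => k _; rewrite real_normK ?num_real.
rewrite sq in main.
have gs : sqi nu (fun x => \sum_(k < n) iter k U (g k) x).
  by apply: sqi_sum => k _; exact: iter_shift_sqi.
have -> : loss_excess n tau = (fun x => (\sum_(k < n) iter k U (g k) x) +
    \sum_(k < n) (m k - dphi / 2 * tau k ^+ 2)).
  apply/funext => x; rewrite /loss_excess -big_split mulr_sumr -sumrB /=.
  by apply: eq_bigr => k _; rewrite !iter_shiftE /g; ring.
rewrite (le_trans (norm2D gs (sqi_cst _ _)))// norm2_cst mulrDr lerD//.
  by rewrite mulrC.
rewrite (le_trans (ler_norm_sum _ _ _))// mulr_sumr ler_sum// => k _.
exact: loss_rem_mean (ht2 k) a2t (ltW e0) h2.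
Qed.

End LossExpansion.

(** * Minimizers of convex processes *)

Section ConvexArgmin.
Context {R : realType} {p : nat}.
Implicit Types (u v y th : 'cV[R]_p) (C A : 'cV[R]_p -> R).

Definition convexv C := forall y v (t : R), 0 <= t <= 1 ->
  C (t *: y + (1 - t) *: v) <= t * C y + (1 - t) * C v.

Lemma convexv_mean C (I : Type) (s : seq I) y (x : I -> 'cV[R]_p) B : convexv C ->
  C y <= B -> (forall i, C (x i) <= B) ->
  C ((size s).+1%:R^-1 *: (y + \sum_(i <- s) x i)) <= B.
Proof.
move=> cC yB xB; elim: s => [|a s IH]; first by rewrite big_nil addr0 invr1 scale1r.
pose t : R := (size s).+2%:R^-1.
have t1 : 0 <= t <= 1 by rewrite invr_ge0 ler0n invf_le1 ?ltr0n// ler1n.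
have -> : (size (a :: s)).+1%:R^-1 *: (y + \sum_(i <- a :: s) x i) =
    t *: x a + (1 - t) *: ((size s).+1%:R^-1 *: (y + \sum_(i <- s) x i)).
  rewrite big_cons addrCA scalerDr scalerA; congr (_ + _ *: _).
  rewrite /t -(natr1 (size s).+1); move: (size s).+1%:R (ltr0Sn R (size s)) => m m0.
  by field; rewrite !gt_eqF// ltr_wpDr// ltW.
rewrite (le_trans (cC _ _ _ t1))//; case/andP: t1 => t0 t1.
have h1 := ler_wpM2l t0 (xB a).
have h2 : (1 - t) * C ((size s).+1%:R^-1 *: (y + \sum_(i <- s) x i)) <= (1 - t) * B.
  by rewrite ler_wpM2l// subr_ge0.
by lra.
Qed.

Lemma convexv_segment C v y (a H B : R) : convexv C -> 0 < H -> `|a| <= H ->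
  C (v + H *: y) <= B -> C (v - H *: y) <= B -> C (v + a *: y) <= B.
Proof.
move=> cC H0 aH h1 h2; pose t := (1 + a / H) / 2.
have aH1 : `|a / H| <= 1 by rewrite normrM normfV (gtr0_norm H0) ler_pdivrMr// mul1r.
have t01 : 0 <= t <= 1 by move: aH1; rewrite ler_norml /t; lra.
have -> : v + a *: y = t *: (v + H *: y) + (1 - t) *: (v - H *: y).
  by apply/colP => j; rewrite !mxE /t; field; rewrite gt_eqF.
rewrite (le_trans (cC _ _ _ t01))//; case/andP: t01 => t0 t1.
have h3 := ler_wpM2l t0 h1; have h4 : (1 - t) * C (v - H *: y) <= (1 - t) * B.
  by rewrite ler_wpM2l// subr_ge0.
by lra.
Qed.

(** [th] is the average of [v] and the [p] points obtained from [v] by moving one coordinate [p.+1]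
    times as far as [th] does; each of them lies on an axis of the cross polytope. *)
Lemma convexv_cube C v th (h B : R) : convexv C -> 0 < h ->
  (forall j, `|th j 0 - v j 0| <= h) -> C v <= B ->
  (forall j, C (v + (p.+1%:R * h) *: delta_mx j 0) <= B) ->
  (forall j, C (v - (p.+1%:R * h) *: delta_mx j 0) <= B) -> C th <= B.
Proof.
move=> cC h0 hth vB pB mB; have p0 : p.+1%:R != 0 :> R by rewrite pnatr_eq0.
pose x (j : 'I_p) : 'cV[R]_p := v + (p.+1%:R * (th j 0 - v j 0)) *: delta_mx j 0.
have -> : th = (size (index_enum 'I_p)).+1%:R^-1 *: (v + \sum_j x j).
  have -> : size (index_enum 'I_p) = p by rewrite -[RHS](card_ord p) cardT enumT.
  apply/colP => i; rewrite !mxE summxE.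
  have -> : \sum_j x j i 0 = p%:R * v i 0 + p.+1%:R * (th i 0 - v i 0).
    rewrite /x; under eq_bigr do rewrite !mxE; rewrite big_split /= sumr_const card_ord mulr_natl.
    congr (_ + _); rewrite (bigD1 i)//= !eqxx mulr1 big1 ?addr0// => j ji.
    by rewrite eq_sym (negPf ji) mulr0.
  by move: p0; rewrite -natr1 => p0; field.
apply: convexv_mean => // j; apply: (convexv_segment (H := p.+1%:R * h)) => //.
  by rewrite mulr_gt0.
by rewrite normrM ger0_norm// ler_wpM2l.
Qed.

Lemma dotv_diff_le u v (eta L : R) : (forall j, `|u j 0 - v j 0| <= eta) ->
  (forall j, `|v j 0| <= L) ->
  `|dotv u u - dotv v v| <= p%:R * (eta * (2 * L + eta)).
Proof.
move=> h1 h2; rewrite /dotv -sumrB (le_trans (ler_norm_sum _ _ _))//.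
rewrite (@le_trans _ _ (\sum_(j < p) eta * (2 * L + eta)))//; last first.
  by rewrite sumr_const card_ord -[leLHS]mulr_natl.
apply: ler_sum => j _.
rewrite (_ : _ - _ = (u j 0 - v j 0) * ((u j 0 - v j 0) + 2 * v j 0)); last by ring.
rewrite normrM ler_pM// (le_trans (ler_normD _ _))// addrC lerD//.
by rewrite normrM ger0_norm// ler_wpM2l.
Qed.

(* Pointwise closeness on a finite net suffices: the upper bound comes from the cross
   polytope around a net point, the lower one by reflecting [th] through that point. *)
Lemma convexv_net (L kappa a : R) : 0 < L -> 0 < kappa -> 0 < a ->
  exists (I : finType) (x : I -> 'cV[R]_p) (kappa0 : R), 0 < kappa0 /\
  forall C, convexv C -> (forall i, `|C (x i) - a * dotv (x i) (x i)| <= kappa0) ->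
  forall th, (forall j, `|th j 0| <= L) -> `|C th - a * dotv th th| <= kappa.
Proof.
move=> L0 k0 a0.
(* The net point is within [h] of [th] in each coordinate and the vertices of its cross polytope
   within a further [p.+1%:R * h], so [q * h] covers all net points in use. For [h <= 1], such a
   displacement changes the quadratic by at most [h * c]. *)
pose q : R := p.+2%:R; pose c := a * p%:R * q * (2 * L + q).
have q0 : 0 < q by rewrite ltr0n.
have c0 : 0 <= c by rewrite /c !mulr_ge0 ?(ltW a0) ?(ltW q0)// addr_ge0 ?mulr_ge0 ?(ltW L0) ?(ltW q0).
pose h := Num.min 1 (kappa / (6 * (c + 1))).
have h0 : 0 < h by rewrite lt_min ltr01 divr_gt0// mulr_gt0// ltr_wpDl.
have h1 : h <= 1 by rewrite ge_min lexx.
have hc : h * c <= kappa / 6.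
  have : h <= kappa / (6 * (c + 1)) by rewrite ge_min lexx orbT.
  move=> /(ler_wpM2r c0) /le_trans; apply.
  rewrite (_ : _ * c = kappa / 6 * (c / (c + 1))); last by field; rewrite gt_eqF// ltr_wpDl.
  by rewrite ler_piMr ?divr_ge0 ?(ltW k0)// ler_pdivrMr ?ltr_wpDl// mul1r lerDl.
pose N := (Num.truncn (2 * L / h)).+1.
pose g (s : {ffun 'I_p -> 'I_N}) : 'cV[R]_p := \col_j (h * (s j)%:R - L).
pose x (i : {ffun 'I_p -> 'I_N} * option ('I_p * bool)) : 'cV[R]_p :=
  if i.2 is Some jb then g i.1 + ((-1) ^+ jb.2 * (p.+1%:R * h)) *: delta_mx jb.1 0 else g i.1.
exists _, x, (kappa / 6); split; first by rewrite divr_gt0.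
move=> C cC hC th hth.
have [s hs] : exists s, forall j, `|th j 0 - g s j 0| <= h.
  have thL j : 0 <= (th j 0 + L) / h.
    by rewrite divr_ge0 ?(ltW h0)//; have := hth j; rewrite ler_norml; lra.
  have sN j : (Num.truncn ((th j 0 + L) / h)%R < N)%N.
    rewrite ltnS; apply: le_truncn; rewrite ler_pM2r ?invr_gt0//.
    by have := hth j; rewrite ler_norml; lra.
  exists [ffun j => Ordinal (sN j)] => j; rewrite /g mxE ffunE /=.
  have /andP[b1 b2] := truncn_itv (thL j).
  set K := Num.truncn _ in b1 b2 *.
  rewrite (_ : _ - _ = h * ((th j 0 + L) / h - K%:R)); last by field; rewrite gt_eqF.
  rewrite normrM (gtr0_norm h0).
  rewrite -[leRHS]mulr1 ler_wpM2l ?(ltW h0)// ger0_norm ?subr_ge0//.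
  by rewrite lerBlDl natr1 ltW.
have [v vE] : exists v, v = g s by exists (g s).
rewrite -vE in hs.
pose B := a * dotv th th + kappa / 6 + kappa / 6.
have near y : (forall j, `|y j 0 - th j 0| <= q * h) ->
    `|a * dotv y y - a * dotv th th| <= kappa / 6.
  move=> hy; rewrite -mulrBr normrM (gtr0_norm a0).
  rewrite (le_trans (ler_wpM2l (ltW a0) (dotv_diff_le hy hth)))// (le_trans _ hc)//.
  rewrite (_ : a * _ = h * (a * p%:R * q * (2 * L + q * h))); last by ring.
  rewrite ler_wpM2l ?(ltW h0)// ler_wpM2l ?mulr_ge0 ?(ltW a0) ?(ltW q0)//.
  by rewrite lerD2l ler_piMr// ltW.
have nv : `|a * dotv v v - a * dotv th th| <= kappa / 6.
  apply: near => j; rewrite distrC (le_trans (hs j))// ler_peMl ?(ltW h0)//.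
  by rewrite ler1n.
have Cv : `|C v - a * dotv v v| <= kappa / 6 by have := hC (s, None); rewrite /x /= -vE.
have upper th' : (forall j, `|th' j 0 - v j 0| <= h) -> C th' <= B.
  move=> h'; have shift j (b : bool) :
      C (v + ((-1) ^+ b * (p.+1%:R * h)) *: delta_mx j 0) <= B.
    have := hC (s, Some (j, b)); rewrite /x /= -vE.
    set y := (v + _) => hy.
    have : `|a * dotv y y - a * dotv th th| <= kappa / 6.
      apply: near => i.
      have -> : y i 0 - th i 0 =
          (v i 0 - th i 0) + (-1) ^+ b * (p.+1%:R * h) * (delta_mx j 0 : 'cV[R]_p) i 0.
        by rewrite /y !mxE addrAC.
      have -> : q * h = h + p.+1%:R * h by rewrite /q -(natr1 p.+1); ring.
      rewrite (le_trans (ler_normD _ _))//; apply: lerD; first by rewrite distrC.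
      rewrite !normrM normr_sign mul1r [`|p.+1%:R|]ger0_norm// (gtr0_norm h0).
      rewrite ler_piMr ?mulr_ge0 ?(ltW h0)// mxE.
      by case: (_ && _); rewrite ?normr1 ?normr0.
    by move: hy; rewrite /B !ler_norml => /andP[? ?] /andP[? ?]; lra.
  apply: (convexv_cube (h := h) cC h0 h').
  - by move: nv Cv; rewrite /B !ler_norml => /andP[? ?] /andP[? ?]; lra.
  - by move=> j; have := shift j false; rewrite expr0 mul1r.
  - by move=> j; have := shift j true; rewrite expr1 mulN1r scaleNr.
have Cth := upper th hs.
have Crf : C (2 *: v - th) <= B.
  apply: upper => j; rewrite !mxE (_ : _ - _ = v j 0 - th j 0); last by ring.
  by rewrite distrC.
have mid : C v <= 2^-1 * C th + (1 - 2^-1) * C (2 *: v - th).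
  have -> : v = 2^-1 *: th + (1 - 2^-1) *: (2 *: v - th).
    by apply/colP => j; rewrite !mxE; field.
  have -> : 2 *: (2^-1 *: th + (1 - 2^-1) *: (2 *: v - th)) - th = 2 *: v - th.
    by apply/colP => j; rewrite !mxE; field.
  by apply: cC; rewrite invr_ge0 ler0n invf_le1// ler1n.
move: Cth Crf mid nv Cv; rewrite /B !ler_norml => ? ? ? /andP[? ?] /andP[? ?].
by apply/andP; split; lra.
Qed.

(** If [th] were farther than [delta] from the centre [u], then at the point [y] at distance [delta]
    on the segment from [u] to [th], convexity and minimality would give [A y <= A u], whereas the
    quadratic has grown by [d * delta ^+ 2 / 2], more than two errors [kappa]. *)
Lemma argmin_close A (S th : 'cV[R]_p) (d L delta kappa : R) : convexv A ->
  (forall b, A th <= A b) -> 0 < d -> 0 < delta ->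
  (forall y, (forall j, `|y j 0| <= L) ->
     `|A y + dotv S y - d / 2 * dotv y y| <= kappa) ->
  vnorm (d^-1 *: S) + delta <= L -> kappa < d * delta ^+ 2 / 4 ->
  vnorm (th - d^-1 *: S) <= delta.
Proof.
move=> cA hmin d0 delta0 hA hL hk; rewrite leNgt; apply/negP => hr.
set u := d^-1 *: S in hL hr; set r := vnorm _ in hr.
have r0 : 0 < r by exact: lt_trans hr.
pose t := delta / r.
have t01 : 0 <= t <= 1 by rewrite divr_ge0 ?(ltW delta0) ?(ltW r0)//= ler_pdivrMr// mul1r ltW.
pose y := t *: th + (1 - t) *: u.
have yu j : y j 0 - u j 0 = t * (th j 0 - u j 0) by rewrite !mxE; ring.
have uL j : `|u j 0| <= L.
  by rewrite (le_trans (coord_le_vnorm _ _))// (le_trans _ hL)// lerDl ltW.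
have r2 : dotv (th - u) (th - u) = r ^+ 2 by rewrite sqr_sqrtr// dotv_ge0.
have yL j : `|y j 0| <= L.
  rewrite -(subrK (u j 0) (y j 0)) addrC (le_trans (ler_normD _ _))// (le_trans _ hL)//.
  rewrite lerD ?coord_le_vnorm// yu normrM ger0_norm; last by case/andP: t01.
  rewrite -[leRHS](divfK (lt0r_neq0 r0)) -/t ler_wpM2l//; first by case/andP: t01.
  by have := coord_le_vnorm (th - u) j; rewrite !mxE.
have Ay : A y <= A u.
  have := cA th u t t01; have /(ler_wpM2l (proj1 (andP t01))) := hmin u.
  by rewrite -/y; lra.
have := hA y yL; have := hA u uL; rewrite !ler_norml => /andP[_ h1] /andP[h2 _].
have hS v : dotv S v = d * dotv u v.
  by rewrite /u dotvZl mulrA divff ?mul1r// gt_eqF.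
have q : dotv y y - 2 * dotv u y + dotv u u = delta ^+ 2.
  have <- : t ^+ 2 * r ^+ 2 = delta ^+ 2 by rewrite -exprMn /t divfK// gt_eqF.
  rewrite -r2 /dotv !mulr_sumr -sumrB -big_split /=; apply: eq_bigr => j _.
  rewrite (_ : _ + _ = (y j 0 - u j 0) ^+ 2); last by ring.
  by rewrite yu !mxE; ring.
move: h1 h2; rewrite !hS => h1 h2.
have : d / 2 * delta ^+ 2 <= 2 * kappa by rewrite -q; lra.
by lra.
Qed.

End ConvexArgmin.

Lemma prob_norm_gt_le d (T : measurableType d) (R : realType) (P : probability T R)
    (f : T -> R) (k : R) : sqi P f -> 0 < k ->
  (P [set w | (k < `|f w|)%R] <= (norm2 P f ^+ 2 / k ^+ 2)%:E)%E.
Proof.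
move=> fi k0; have [mf f2] := fi.
pose B := [set w | (k < `|f w|)%R].
have mB : measurable B.
  have := measurable_fun_ltr (measurable_cst k) (measurableT_comp (@normr_measurable R setT) mf).
  by move=> /(_ measurableT [set true] Logic.I); rewrite setTI.
rewrite -(fineK (fin_num_measure P _ mB)) lee_fin.
have -> : fine (P B) = \int[P]_w \1_B w by rewrite /Rintegral integral_indic// setIT.
rewrite ler_pdivlMr ?exprn_gt0// mulrC -RintegralZl//; last by apply: sqi_integ; exact: sqi_indic.
rewrite norm2_sqr; apply: Rint_le => [||w].
- by apply: integZ; apply: sqi_integ; exact: sqi_indic.
- exact: sqi_mul_integ.
rewrite indicE; have [kw|kw] := boolP (k < `|f w|).
  rewrite mem_set// mulr1 -expr2 -(real_normK (num_real (f w))).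
  by rewrite ler_sqr ?nnegrE// ltW.
by rewrite memNset ?mulr0 -?expr2 ?sqr_ge0//; exact/negP.
Qed.

Lemma norm2_vnorm d (T : measurableType d) (R : realType) (P : probability T R) p
    (V : T -> 'cV[R]_p) : (forall j, sqi P (fun w => V w j 0)) ->
  sqi P (fun w => vnorm (V w)) /\
  norm2 P (fun w => vnorm (V w)) ^+ 2 = \sum_j norm2 P (fun w => V w j 0) ^+ 2.
Proof.
move=> hV; have sq w : vnorm (V w) ^+ 2 = \sum_j V w j 0 * V w j 0.
  by rewrite sqr_sqrtr// dotv_ge0.
split.
  split; first by apply: measurable_vnorm => j; case: (hV j).
  have -> : (fun w => vnorm (V w) ^+ 2) = (fun w => \sum_j V w j 0 * V w j 0) by exact/funext.
  by apply: integ_sum => j _; exact: sqi_mul_integ.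
rewrite norm2_sqr /inner; under eq_Rintegral do rewrite -expr2 sq.
rewrite Rint_sum => [|j _]; last exact: sqi_mul_integ.
by apply: eq_bigr => j _; rewrite norm2_sqr.
Qed.

Lemma vnormD_le (R : realType) p (u v : 'cV[R]_p) (a : R) :
  vnorm u <= a -> vnorm v <= a -> vnorm (u + v) <= 2 * a.
Proof.
move=> ua va; have a0 := le_trans (vnorm_ge0 u) ua.
have sq (y : 'cV[R]_p) : vnorm y <= a -> dotv y y <= a ^+ 2.
  by move=> ya; rewrite -[leLHS]sqr_sqrtr ?dotv_ge0// ler_sqr ?nnegrE// sqrtr_ge0.
have h : dotv (u + v) (u + v) <= 2 * dotv u u + 2 * dotv v v.
  rewrite /dotv !mulr_sumr -big_split /=; apply: ler_sum => j _; rewrite !mxE.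
  by have := sqr_ge0 (u j 0 - v j 0); rewrite expr2; lra.
rewrite /vnorm -[leRHS]ger0_norm ?mulr_ge0// -sqrtr_sqr ler_wsqrtr//.
by have := sq u ua; have := sq v va; rewrite !expr2; lra.
Qed.

Lemma vnormZ (R : realType) p (c : R) (v : 'cV[R]_p) : vnorm (c *: v) = `|c| * vnorm v.
Proof.
rewrite /vnorm; have -> : dotv (c *: v) (c *: v) = c ^+ 2 * dotv v v.
  by rewrite /dotv mulr_sumr; apply: eq_bigr => j _; rewrite !mxE; ring.
by rewrite sqrtrM ?sqr_ge0// sqrtr_sqr.
Qed.

(** * Minimizers of random convex functions, in probability *)

Section ArgminInProbability.
Context d (T : measurableType d) (R : realType) (P : probability T R) (p : nat).
Variables (A : nat -> T -> 'cV[R]_p -> R) (S th : nat -> T -> 'cV[R]_p) (c B : R) (N0 : nat).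
Hypothesis mth : forall n, measurable_vec (th n).
Hypothesis c0 : 0 < c.
Hypothesis convA : forall n w, convexv (A n w).
Hypothesis minA : forall n w b, (N0 <= n)%N -> A n w (th n w) <= A n w b.
Hypothesis S_sqi : forall n j, sqi P (fun w => S n w j 0).
Hypothesis S_bound : forall n, (N0 <= n)%N -> norm2 P (fun w => vnorm (S n w)) <= B.
Hypothesis excess : forall v e, 0 < e -> exists N, forall n, (N <= n)%N ->
  sqi P (fun w => A n w v + dotv (S n w) v - c / 2 * dotv v v) /\
  norm2 P (fun w => A n w v + dotv (S n w) v - c / 2 * dotv v v) <= e.

Let mS n : measurable_vec (S n). Proof. by move=> j; case: (S_sqi n j). Qed.

Let mD n : measurable_vec (fun w => c *: th n w - S n w).
Proof.
move=> j; have -> : (fun w => (c *: th n w - S n w) j 0) = (fun w => c * th n w j 0 - S n w j 0).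
  by apply/funext => w; rewrite !mxE.
by apply: measurable_funB; [apply: measurable_funM => //; exact: mth|exact: mS].
Qed.

Lemma prob_vnorm_gt n (M : R) : (N0 <= n)%N -> 0 < M ->
  (P [set w | (M < vnorm (S n w))%R] <= (B ^+ 2 / M ^+ 2)%:E)%E.
Proof.
move=> n0 M0; have [si _] := norm2_vnorm (S_sqi n).
have := prob_norm_gt_le si M0.
under eq_set do rewrite (ger0_norm (vnorm_ge0 _)).
move=> /le_trans; apply; rewrite lee_fin ler_wpM2r ?invr_ge0 ?sqr_ge0//.
by rewrite ler_sqr ?nnegrE ?norm2_ge0 ?S_bound//; exact: le_trans (norm2_ge0 _ _) (S_bound n0).
Qed.

(** Outside two events of probability at most [eta / 2] each, [S n] is bounded by [M] and the excess
    is small on the whole finite net; the conclusion is then deterministic. *)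
Lemma argmin_prob (delta eta : R) : 0 < delta -> 0 < eta ->
  exists N, forall n, (N <= n)%N ->
    (P [set w | (delta < vnorm (c *: th n w - S n w))%R] <= eta%:E)%E.
Proof.
move=> delta0 eta0; pose B1 := `|B| + 1; have B0 : 0 < B1 by rewrite ltr_wpDl.
pose M := 2 * B1 / Num.sqrt eta.
have se0 : 0 < Num.sqrt eta by rewrite sqrtr_gt0.
have M0 : 0 < M by rewrite divr_gt0// mulr_gt0.
have hM : B ^+ 2 / M ^+ 2 <= eta / 2.
  rewrite /M expr_div_n sqr_sqrtr ?(ltW eta0)// invf_div.
  have B2 : B ^+ 2 <= B1 ^+ 2.
    by rewrite -(real_normK (num_real B)) ler_sqr ?nnegrE ?(ltW B0)// /B1 lerDl.
  rewrite (_ : _ * _ = eta / 2 * (B ^+ 2 / B1 ^+ 2 / 2)); last by field; rewrite gt_eqF.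
  rewrite ler_piMr ?divr_ge0 ?(ltW eta0)//.
  have : B ^+ 2 / B1 ^+ 2 <= 1 by rewrite ler_pdivrMr ?exprn_gt0// mul1r.
  by lra.
pose L := M / c + delta / c.
have dc0 : 0 < delta / c by rewrite divr_gt0.
have L0 : 0 < L by rewrite addr_gt0// divr_gt0.
(* Half of the threshold in [argmin_close] for the distance [delta / c]. *)
pose kappa := c * (delta / c) ^+ 2 / 8.
have k0 : 0 < kappa by rewrite divr_gt0// mulr_gt0// exprn_gt0.
have c20 : 0 < c / 2 by rewrite divr_gt0.
have [I [x [k1 [k10 hnet]]]] := @convexv_net R p L kappa (c / 2) L0 k0 c20.
pose X i n w := A n w (x i) + dotv (S n w) (x i) - c / 2 * dotv (x i) (x i).
(* Summed over the net, the norms stay below [k1 * Num.sqrt (eta / 2)]; Chebyshev's inequality at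
   level [k1] turns this into probability [eta / 2]. *)
pose e1 := k1 * Num.sqrt (eta / 2) / #|I|.+1%:R.
have e10 : 0 < e1 by rewrite divr_gt0// mulr_gt0// sqrtr_gt0 divr_gt0.
have /choice[K hK] : forall i, exists N, forall n, (N <= n)%N -> sqi P (X i n) /\ norm2 P (X i n) <= e1.
  by move=> i; have [N hN] := excess (x i) e10; exists N.
exists (maxn N0 (\max_i K i)) => n; rewrite geq_max => /andP[n0 nK].
have hi i : sqi P (X i n) /\ norm2 P (X i n) <= e1.
  by apply: hK; apply: leq_trans nK; exact: leq_bigmax.
pose f w := \sum_i `|X i n w|.
have si i : sqi P (fun w => `|X i n w|) by apply: sqi_norm; case: (hi i).
have fi : sqi P f by apply: sqi_sum => i _.
have f0 w : 0 <= f w by apply: sumr_ge0 => i _.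
have fle : norm2 P f ^+ 2 / k1 ^+ 2 <= eta / 2.
  rewrite ler_pdivrMr ?exprn_gt0// -[eta / 2]sqr_sqrtr ?divr_ge0 ?(ltW eta0)// -exprMn.
  rewrite ler_sqr ?nnegrE ?norm2_ge0 ?mulr_ge0 ?sqrtr_ge0 ?(ltW k10)//.
  rewrite (le_trans (norm2_sum _ (fun i _ => si i)))//.
  rewrite (@le_trans _ _ (\sum_(i : I) e1))//.
    by apply: ler_sum => i _; rewrite norm2_abs; case: (hi i).
  rewrite sumr_const -[_ *+ _]mulr_natl /e1 mulrC.
  rewrite (_ : _ * _ = Num.sqrt (eta / 2) * k1 * (#|I|%:R / #|I|.+1%:R)); last by ring.
  by rewrite ler_piMr ?mulr_ge0 ?sqrtr_ge0 ?(ltW k10)// ler_pdivrMr// mul1r ler_nat.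
have mfB : measurable [set w | k1 < `|f w|].
  have := measurable_fun_ltr (measurable_cst k1) (measurableT_comp (@normr_measurable R setT) (sqi_measurable fi)).
  by move=> /(_ measurableT [set true] Logic.I); rewrite setTI.
apply: (@le_trans _ _ (P ([set w | M < vnorm (S n w)] `|` [set w | k1 < `|f w|]))).
  apply: le_measure; rewrite ?inE.
  - exact: (measurable_vnorm_gt delta (mD n)).
  - by apply: measurableU => //; exact: measurable_vnorm_gt.
  move=> w /= hw; apply: contrapT => /not_orP[/negP + /negP]; rewrite -!leNgt => hS hf.
  have : vnorm (th n w - c^-1 *: S n w) <= delta / c.
    apply: (@argmin_close _ _ (A n w) _ _ c L _ kappa) => //.
    - by move=> b; exact: minA.
    - move=> y hy; apply: (hnet (fun y => A n w y + dotv (S n w) y)) => //.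
        move=> y1 y2 t ht; have := convA n w y1 y2 ht.
        have -> : dotv (S n w) (t *: y1 + (1 - t) *: y2) =
            t * dotv (S n w) y1 + (1 - t) * dotv (S n w) y2.
          by rewrite dotvC dotvDl !dotvZl !(dotvC (S n w)).
        by rewrite !mulrDr; lra.
      move=> i; rewrite (le_trans _ hf)// (ger0_norm (f0 w)) /f (bigD1 i)//= -/(X i n w) lerDl.
      by apply: sumr_ge0 => j _.
    - rewrite vnormZ ger0_norm ?invr_ge0 ?(ltW c0)// /L lerD2r mulrC ler_wpM2r//.
      by rewrite invr_ge0 ltW.
    - have : 0 < c * (delta / c) ^+ 2 by rewrite mulr_gt0// exprn_gt0.
      by rewrite /kappa; lra.
  have -> : th n w - c^-1 *: S n w = c^-1 *: (c *: th n w - S n w).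
    by rewrite scalerBr scalerA mulVf ?scale1r// gt_eqF.
  rewrite vnormZ ger0_norm ?invr_ge0 ?(ltW c0)// mulrC ler_pM2r ?invr_gt0//.
  by rewrite leNgt hw.
apply: le_trans (measureU2 _ _ _) _ => //; first exact: measurable_vnorm_gt.
rewrite [leRHS](_ : _ = (eta / 2)%:E + (eta / 2)%:E)%E; last by rewrite -EFinD -splitr.
apply: leeD.
  by apply: le_trans (prob_vnorm_gt n0 M0) _; rewrite lee_fin.
by apply: le_trans (prob_norm_gt_le fi k10) _; rewrite lee_fin.
Qed.

Lemma argmin_cvg_prob0 : cvg_prob0 P (fun n w => c *: th n w - S n w).
Proof.
move=> delta delta0.
have fin n : P [set w | delta < vnorm (c *: th n w - S n w)] \is a fin_num.
  by apply: fin_num_measure; exact: (measurable_vnorm_gt delta (mD n)).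
apply/fine_cvgP; split; first by apply: nearW.
apply/cvgrPdist_le => e e0; have [N hN] := argmin_prob delta0 e0.
exists N => // n /= Nn; rewrite sub0r normrN ger0_norm; last exact: fine_ge0.
by rewrite -lee_fin fineK ?fin ?hN.
Qed.

Lemma argmin_bounded_prob : bounded_prob P th.
Proof.
move=> eta eta0; have eta4 : 0 < eta / 4 by rewrite divr_gt0.
pose B1 := `|B| + 1; have B0 : 0 < B1 by rewrite ltr_wpDl.
pose M := Num.max 1 (2 * B1 / Num.sqrt eta).
have se0 : 0 < Num.sqrt eta by rewrite sqrtr_gt0.
have M0 : 0 < M by rewrite lt_max ltr01.
have hM : B ^+ 2 / M ^+ 2 <= eta / 4.
  have h : (2 * B1 / Num.sqrt eta) ^+ 2 <= M ^+ 2.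
    rewrite ler_sqr ?nnegrE ?(ltW M0) ?divr_ge0 ?mulr_ge0 ?(ltW B0) ?(ltW se0)//.
    by rewrite le_max lexx orbT.
  have B2 : B ^+ 2 <= B1 ^+ 2.
    by rewrite -(real_normK (num_real B)) ler_sqr ?nnegrE ?(ltW B0)// /B1 lerDl.
  rewrite ler_pdivrMr ?exprn_gt0// (le_trans B2)//.
  move: h; rewrite expr_div_n sqr_sqrtr ?(ltW eta0)// ler_pdivrMr//.
  by rewrite exprMn; lra.
have [N hN] := argmin_prob ltr01 eta4.
exists (2 * M / c), (maxn N N0) => n; rewrite geq_max => /andP[nN n0].
apply: (@le_lt_trans _ _ (P ([set w | 1 < vnorm (c *: th n w - S n w)] `|` [set w | M < vnorm (S n w)]))).
  apply: le_measure; rewrite ?inE.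
  - exact: measurable_vnorm_gt.
  - by apply: measurableU; [exact: (measurable_vnorm_gt _ (mD n))|exact: measurable_vnorm_gt].
  move=> w /= hw; apply: contrapT => /not_orP[/negP + /negP]; rewrite -!leNgt => h1 h2.
  have h1' : vnorm (c *: th n w - S n w) <= M by rewrite (le_trans h1)// le_max lexx.
  have := vnormD_le h1' h2; rewrite subrK vnormZ (gtr0_norm c0) mulrC -ler_pdivlMr//.
  by rewrite leNgt hw.
apply: le_lt_trans (measureU2 _ _ _) _.
- exact: (measurable_vnorm_gt _ (mD n)).
- exact: measurable_vnorm_gt.
apply: (@le_lt_trans _ _ ((eta / 4)%:E + (eta / 4)%:E)%E).
  apply: leeD; first exact: hN.
  by apply: le_trans (prob_vnorm_gt n0 M0) _; rewrite lee_fin.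
by rewrite -EFinD lte_fin; lra.
Qed.

End ArgminInProbability.

(** * Long-run covariance *)

Section SymmetricSums.
Context {R : realType}.
Implicit Types (h a : int -> R) (b : nat -> R).

Definition symsum K h : R := \sum_(0 <= j < (2 * K).+1) h (j%:Z - K%:Z).

Lemma symsumE K h : symsum K h = h 0 + \sum_(m < K) (h m.+1%:Z + h (- m.+1%:Z)).
Proof.
elim: K => [|K IH]; first by rewrite /symsum muln0 big_nat1 big_ord0 subrr [RHS]addr0.
rewrite big_ord_recr /= addrA -IH /symsum.
have -> : ((2 * K.+1).+1 = (2 * K).+1.+2)%N by lia.
rewrite big_nat_recl// big_nat_recr//=.
have -> : \sum_(0 <= j < (2 * K).+1) h (j.+1%:Z - K.+1%:Z) =
    \sum_(0 <= j < (2 * K).+1) h (j%:Z - K%:Z).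
  by apply: eq_big_nat => j _; congr (h _); lia.
have -> : (2 * K).+2%:Z - K.+1%:Z = K.+1%:Z by lia.
by rewrite sub0r; ring.
Qed.

Lemma symsum_tail J K h b e : (forall k, `|h k| <= b `|k|%N) ->
  (forall L, \sum_(j < L) (if (j < J)%N then 0 else b j) <= e) -> (J <= K)%N ->
  `|symsum K h - symsum J h| <= 2 * e.
Proof.
move=> hb be JK.
have -> : symsum K h - symsum J h = \sum_(J <= m < K) (h m.+1%:Z + h (- m.+1%:Z)).
  rewrite !symsumE -!(big_mkord xpredT (fun m => h m.+1%:Z + h (- m.+1%:Z))).
  by rewrite (big_cat_nat (leq0n J) JK)//=; ring.
rewrite (le_trans (ler_norm_sum _ _ _))// (@le_trans _ _ (\sum_(J <= m < K) 2 * b m.+1))//.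
  apply: ler_sum => m _; rewrite [2 * _]mulr_natl mulr2n (le_trans (ler_normD _ _))//.
  by apply: lerD; [exact: hb|rewrite (le_trans (hb _))// abszN].
rewrite -mulr_sumr ler_wpM2l// (le_trans _ (be K.+1))//.
have b0 j : 0 <= b j by apply: le_trans (hb j%:Z).
pose t j := if (j < J)%N then 0 else b j.
have t0 j : 0 <= t j by rewrite /t; case: ifP.
rewrite -(big_mkord xpredT t) big_nat_recl// (big_cat_nat (leq0n J) JK)//=.
have -> : \sum_(J <= m < K) t m.+1 = \sum_(J <= m < K) b m.+1.
  apply: eq_big_nat => m /andP[Jm _]; rewrite /t ltnNge.
  by rewrite (leq_trans Jm (leqnSn m)).
by rewrite addrA lerDr addr_ge0// sumr_ge0.
Qed.

(** Dominated convergence for series, where the range of lags grows together with [n]: finitely many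
    lags converge termwise, and [b] controls all others uniformly in [n]. *)
Lemma tannery (an : nat -> int -> R) a b (B s : R) : (forall m, 0 <= b m) ->
  (forall M, \sum_(m < M) b m <= B) ->
  (exists N, forall n k, (N <= n)%N -> `|an n k| <= b `|k|%N) ->
  (forall k, an n k @[n --> \oo] --> a k) ->
  symsum K a @[K --> \oo] --> s -> symsum n (an n) @[n --> \oo] --> s.
Proof.
move=> b0 bB [N hN] ha hs; apply/cvgrPdist_le => e e0.
have e8 : 0 < e / 8 by rewrite divr_gt0.
have e2 : 0 < e / 2 by rewrite divr_gt0.
have [J HJ] := summable_tail b0 bB e8.
have cJ : symsum J (an n) @[n --> \oo] --> symsum J a.
  have -> : symsum J a = \sum_(j <- iota 0 (2 * J).+1) a (j%:Z - J%:Z).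
    by rewrite /symsum /index_iota subn0.
  have -> : (fun n => symsum J (an n)) =
      (fun n => \sum_(j <- iota 0 (2 * J).+1) an n (j%:Z - J%:Z)).
    by apply/funext => n; rewrite /symsum /index_iota subn0.
  by apply: cvg_sumr => j; exact: ha.
have ab k : `|a k| <= b `|k|%N.
  apply: (@cvg_norm_le R (fun n => an (n + N)%N k)) => [|n].
    by have := ha k; rewrite -(cvg_shiftn N).
  by apply: hN; rewrite leq_addl.
have /cvgrPdist_le /(_ _ e8) [N1 _ h1] := cJ.
have /cvgrPdist_le /(_ _ e8) [N2 _ h2] := hs.
have JN := leq_maxl J N2; have := h2 _ (leq_maxr J N2); have := symsum_tail ab HJ JN.
move: (maxn J N2) => K2 hK2 hK3.
exists (maxn (maxn N N1) J) => // n /=; rewrite !geq_max => /andP[/andP[n1 n2] n3].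
have h3 := symsum_tail (fun k => hN n k n1) HJ n3.
have h4 := h1 n n2.
move: hK2 hK3 h3 h4; rewrite !ler_norml => /andP[? ?] /andP[? ?] /andP[? ?] /andP[? ?].
by apply/andP; split; lra.
Qed.

Lemma symsum_cvg h b (B : R) : (forall m, 0 <= b m) -> (forall M, \sum_(m < M) b m <= B) ->
  (forall k, `|h k| <= b `|k|%N) -> exists s : R, symsum K h @[K --> \oo] --> s.
Proof.
move=> b0 bB hb; suff /cvg_ex[l hl] : cvgn (symsum ^~ h) by exists l.
apply: cauchy_cvg; apply/cauchy_exP => e e0.
have e8 : 0 < e / 8 by rewrite divr_gt0.
have [J HJ] := summable_tail b0 bB e8.
exists (symsum J h), J => // K /= JK; rewrite -ball_normE /= distrC.
by rewrite (le_lt_trans (symsum_tail hb HJ JK))//; lra.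
Qed.

End SymmetricSums.

(** * Summability of autocovariances *)

Section Autocovariance.
Context {dS : measure_display} (S : measurableType dS) (R : realType).
Context d (T : measurableType d) (P : probability T R).
Variables (mu : probability S R) (X : int -> T -> S).
Hypothesis HX : iid_law P mu X.
Local Notation nu := (past_law HX).
Local Notation K := (transition mu).
Local Notation U := (@shift _ S R).
Implicit Types f g h : seqspace S -> R.

Lemma inner_innov g h : sqi nu g -> sqi nu h ->
  inner nu g h = inner nu (innov mu g) (innov mu h) + inner nu (K g) (K h).
Proof.
move=> gi hi; have Kg := transition_sqi gi; have Kh := transition_sqi hi.
have Qg := innov_sqi gi; have UKg := shift_sqi Kg; have UKh := shift_sqi Kh.
rewrite (innerC _ (innov mu g)) {1}/innov innerBl// (innerC _ (U (K h))) innov_orth// subr0.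
rewrite (innerC _ h) {1}/innov innerBl// (innerC _ (U (K g))).
by rewrite -transition_adjoint// (innerC _ (K h)) subrK.
Qed.

Lemma inner_innov_iter J g h : sqi nu g -> sqi nu h ->
  inner nu g h = \sum_(j < J) inner nu (innov mu (iter j K g)) (innov mu (iter j K h)) +
    inner nu (iter J K g) (iter J K h).
Proof.
move=> gi hi; elim: J => [|J IH]; first by rewrite big_ord0 add0r.
rewrite big_ord_recr /= -addrA -inner_innov ?IH//; exact: iter_transition_sqi.
Qed.

Definition autocov f m : R := inner nu f (iter m U f).

(** Expanded in innovations, the covariance at lag [m] is at most the sum over [j] of
    [p j * p (j + m)], up to a vanishing remainder; summed over [m] as well, this is at most
    [B ^+ 2]. The absolute convergence of the long-run covariance rests on it. *)
Lemma autocov_sum f (B : R) M : sqi nu f -> \int[nu]_x f x = 0 ->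
  (forall J, \sum_(j < J) innov_coef HX j f <= B) -> \sum_(m < M) `|autocov f m| <= B ^+ 2.
Proof.
move=> fi f0 fB; set p := fun j => innov_coef HX j f.
have B0 : 0 <= B by have := fB 0%N; rewrite big_ord0.
have p0 j : 0 <= p j := innov_coef_ge0 _ _ _.
have bnd J m : `|autocov f m| <= \sum_(j < J) p j * p (j + m)%N + norm2 nu f * norm2 nu (iter J K f).
  have Km k : sqi nu (iter k K f) := iter_transition_sqi k fi.
  rewrite /autocov -iter_transition_adjoint// (inner_innov_iter J)//.
  rewrite (le_trans (ler_normD _ _))//; apply: lerD.
    rewrite (le_trans (ler_norm_sum _ _ _))//; apply: ler_sum => j _.
    rewrite mulrC -iterD; apply: inner_le; exact: innov_sqi.
  rewrite -iterD (le_trans (inner_le _ _))// ler_wpM2r ?norm2_ge0//.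
  exact: iter_transition_norm2.
have cat (u : nat -> R) (a l : nat) :
    \sum_(i < a + l) u i = \sum_(i < a) u i + \sum_(i < l) u (a + i)%N.
  by rewrite big_split_ord.
apply/ler_addgt0Pr => e e0.
pose c := M%:R * norm2 nu f + 1.
have c0 : 0 < c by rewrite ltr_wpDl// mulr_ge0// norm2_ge0.
have [J /(_ J (leqnn J)) hJ] := iter_transition_cvg0 fi f0 (divr_gt0 e0 c0).
rewrite (le_trans (ler_sum _ (fun m _ => bnd J (m : 'I_M))))// big_split /=; apply: lerD.
  rewrite exchange_big /= (@le_trans _ _ (\sum_(j < J) p j * B))//.
    apply: ler_sum => j _; rewrite -mulr_sumr ler_wpM2l//.
    apply: le_trans (fB (j + M)%N).
    rewrite (cat p).
    by rewrite lerDr sumr_ge0.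
  by rewrite -mulr_suml expr2 ler_wpM2r.
rewrite sumr_const card_ord -[_ *+ _]mulr_natl mulrA.
rewrite (le_trans (ler_wpM2l _ hJ)) ?mulr_ge0 ?norm2_ge0//.
rewrite mulrCA ler_piMr ?(ltW e0)// ler_pdivrMr// mul1r /c lerDl//.
Qed.

Lemma past_autocov f (i k : int) : measurable_fun setT f ->
  \int[P]_w (f (past X i w) * f (past X k w)) = autocov f `|i - k|%N.
Proof.
move=> mf; wlog ki : i k / k <= i.
  move=> H; have [/H//|/ltW ik] := lerP k i.
  by rewrite distnC -H//; apply: eq_Rintegral => w _; rewrite mulrC.
rewrite /autocov /inner -(past_Rint HX i); last first.
  apply: measurable_funM => //; have -> : iter `|i - k|%N U f = f \o iter `|i - k|%N (@stail _ S).
    by apply/funext => x; rewrite iter_shiftE.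
  exact (measurableT_comp mf (@measurable_iter_stail _ S _)).
apply: eq_Rintegral => w _; rewrite iter_shiftE iter_stail_past; congr (_ * f _).
by congr (past X _ w); lia.
Qed.

End Autocovariance.

(** For fixed [i], the lags that keep the second index between 1 and [n] form a block of [n]
    consecutive values of [j]; the blocks before and after it are empty sums. *)
Lemma sum_by_lag (V : nmodType) n (F : nat -> nat -> V) :
  \sum_(1 <= i < n.+1) \sum_(1 <= k < n.+1) F i k =
  \sum_(0 <= j < (2 * n).+1)
    \sum_(1 <= i < n.+1 | (1 <= i%:Z + (j%:Z - n%:Z) <= n%:Z)%R) F i (absz (i%:Z + (j%:Z - n%:Z))%R).
Proof.
under [RHS]eq_bigr do rewrite big_mkcond.
rewrite [RHS]exchange_big; apply: eq_big_nat => i /andP[i1 i2] /=.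
rewrite (@big_cat_nat _ _ _ (n.+1 - i)%N _ (2 * n).+1)//=; try lia.
rewrite [X in _ = (X + _)%R]big_nat [X in _ = (X + _)%R]big1 ?add0r => [|j hj]; last by rewrite ifF//; lia.
rewrite (@big_cat_nat _ _ _ ((2 * n).+1 - i)%N (n.+1 - i)%N)//=; try lia.
rewrite [X in _ = (_ + X)%R]big_nat [X in _ = (_ + X)%R]big1 ?addr0 => [|j hj]; last by rewrite ifF//; lia.
have -> : (n.+1 - i = 1 + (n - i))%N by lia.
rewrite big_addn; have -> : ((2 * n).+1 - i - (n - i) = n.+1)%N by lia.
apply: eq_big_nat => k hk; rewrite ifT; last by lia.
by congr F; lia.
Qed.

(** * The linear model *)

Section Conditions.
Context {R : realType} d (T : measurableType d) (P : probability T R).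
Context {dS : measure_display} (S : measurableType dS).

Lemma iid_law_exists (I : eqType) (X : I -> T -> S) (i0 : I) :
  mutually_independent P X -> identically_distributed P X ->
  exists mu : probability S R, iid_law P mu X.
Proof.
by move=> ind idd; exists (law P (ind.1 i0)); split=> // i B mB; exact: idd.
Qed.

Lemma seq_measurable_fun (G : (nat -> S) -> R) : seq_measurable G ->
  measurable_fun setT (G : seqspace S -> R).
Proof. by move=> hG _ B mB; rewrite setTI; exact: hG. Qed.

Lemma derive_at_zero (phi : R -> R) (c : R) : phi 0 = 0 -> is_derive (0 : R) (1 : R) phi c ->
  forall e, 0 < e -> exists2 eta, 0 < eta & forall t, `|t| <= eta -> `|phi t - c * t| <= e * `|t|.
Proof.
move=> phi0 [dphi <-] e e0.
have := dphi => /cvgrPdist_le /(_ _ e0) /nbhs_ballP[r /= r0 hr].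
exists (r / 2); first by rewrite divr_gt0.
move=> t tr; have [->|t0] := eqVneq t 0; first by rewrite phi0 mulr0 subr0 normr0 mulr0.
have := hr t; rewrite -ball_normE /= sub0r normrN => /(_ _ t0).
have tr' : `|t| < r by rewrite (le_lt_trans tr)// ltr_pdivrMr// ltr_pMr// ltr1n.
move=> /(_ tr'); rewrite phi0 subr0 addr0 [t *: 1]mulr1 -/('D_1 phi 0) => h.
rewrite -ler_pdivrMr ?normr_gt0// -normfV -normrM.
move: h; rewrite distrC; congr (`|_| <= _); rewrite mulrBl mulfK//.
by congr (_ - _); [exact: mulrC|rewrite /derive phi0].
Qed.

Variables (mu : probability S R) (X : int -> T -> S).
Hypothesis HX : iid_law P mu X.
Variables (G : (nat -> S) -> R) (psi : R -> R).
Hypothesis HG : seq_measurable G.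
Hypothesis psi_mono : forall a b : R, a <= b -> psi a <= psi b.
Local Notation nu := (past_law HX).
Local Notation e1 := (shift_proc G X 1).
Let f (t : R) : seqspace S -> R := fun x => psi (G x + t).

Lemma measurable_score t : measurable_fun setT (f t).
Proof.
apply: (measurableT_comp (f := psi)).
  by apply: nondecreasing_measurable => // a b; exact: psi_mono.
by apply: measurable_funD => //; exact: seq_measurable_fun.
Qed.

Lemma score_sqi_zero : (L2norm P (fun w => psi (e1 w)) < +oo)%E -> sqi nu (f 0).
Proof.
have m0 := measurable_score 0.
move=> h; apply/(past_sqi HX 1 m0); apply: L2norm_sqi.
  exact (measurableT_comp m0 (measurable_past HX 1)).
move: h; congr (L2norm P _ < _)%E; apply/funext => w.
by rewrite /f /= addr0.
Qed.

(** Convergence to 0 in the extended reals makes the norm finite near 0, and this is what provides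
    square integrability of the translates, for small [t] only. *)
Lemma score_cvg : (L2norm P (fun w => psi (e1 w)) < +oo)%E ->
  L2norm P (fun w => psi (e1 w + t) - psi (e1 w)) @[t --> (0 : R)] --> 0%E ->
  forall e, 0 < e -> exists2 eta, 0 < eta & forall t, `|t| <= eta ->
    sqi nu (f t) /\ norm2 nu (fun x => f 0 x - f t x) <= e.
Proof.
move=> h0 /fine_cvgP[hf hc] e e0; have f0 := score_sqi_zero h0.
move/cvgrPdist_le : hc => /(_ _ e0) hc.
have hb : \forall t \near (0 : R),
    L2norm P (fun w => psi (e1 w + t) - psi (e1 w)) \is a fin_num /\
    `|0 - fine (L2norm P (fun w => psi (e1 w + t) - psi (e1 w)))| <= e.
  by apply: filterI.
move/nbhs_ballP : hb => [r /= r0 hr].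
exists (r / 2); first by rewrite divr_gt0.
move=> t tr; have tb : ball (0 : R) r t.
  by rewrite -ball_normE /= sub0r normrN (le_lt_trans tr)// ltr_pdivrMr// ltr_pMr// ltr1n.
have [/= h1 h2] := hr t tb.
have mt := measurable_score t; have m0 := measurable_score 0.
have mD : measurable_fun setT (fun x => f t x - f 0 x) by exact: measurable_funB.
have E : (fun w => psi (e1 w + t) - psi (e1 w)) = (fun x => f t x - f 0 x) \o past X 1.
  by apply/funext => w; rewrite /f /= addr0.
have Di : sqi nu (fun x => f t x - f 0 x).
  apply/(past_sqi HX 1 mD); apply: L2norm_sqi.
    exact (measurableT_comp mD (measurable_past HX 1)).
  by rewrite -E ltey_eq h1.
split.
  have -> : f t = (fun x => (f t x - f 0 x) + f 0 x) by apply/funext => x; rewrite subrK.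
  exact: sqiD.
have -> : (fun x => f 0 x - f t x) = (fun x => - (f t x - f 0 x)).
  by apply/funext => x; rewrite opprB.
rewrite norm2N// -(past_norm2 HX 1 mD).
move: h2; rewrite E L2norm_norm2/=; last exact/(past_sqi HX 1 mD).
by rewrite sub0r normrN ger0_norm// norm2_ge0.
Qed.

Lemma score_mean t : \int[P]_w psi (e1 w + t) = \int[nu]_x f t x.
Proof. by rewrite -(past_Rint HX 1 (measurable_score t)). Qed.

End Conditions.

(** * The dependence condition as a bound on innovation coefficients *)

Section Dependence.
Context {R : realType} d (T : measurableType d) (P : probability T R).
Context {dS : measure_display} (S : measurableType dS).
Variables (mu : probability S R) (eps eps' : int -> T -> S).
Hypothesis HZ : iid_law P mu (fun ib : bool * int => if ib.1 then eps' ib.2 else eps ib.2).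
Variables (G : (nat -> S) -> R) (psi : R -> R) (eps0 : R).
Hypothesis eps0_ge0 : 0 <= eps0.
Let f (t : R) : seqspace S -> R := fun x => psi (G x + t).

Lemma score_coef :
  (exists CE CEs : nat -> R -> T -> R,
     (forall (i : nat) (t : R), `|t| <= eps0 ->
        is_cond_exp P (gen_sigma eps [set j : int | j <= 0])
          (fun w => psi (shift_proc G eps i%:Z w + t)) (CE i t) /\
        is_cond_exp P (gen_sigma (star_innov eps eps') [set j : int | j <= 0])
          (fun w => psi (shift_proc G (star_innov eps eps') i%:Z w + t)) (CEs i t)) /\
     (\sum_(0 <= i <oo)
         ereal_sup [set L2norm P (fun w => (CE i t w - CEs i t w)%R) | t in [set t : R | (`|t| <= eps0)%R]]
       < +oo)%E) ->
  exists (dl : nat -> R) (B : R), (forall J, \sum_(j < J) dl j <= B) /\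
    forall t j, `|t| <= eps0 -> sqi (past_law (iid_eps HZ)) (f t) ->
      innov_coef (iid_eps HZ) j (f t) <= dl j.
Proof.
move=> [CE [CEs [hC hs]]].
pose s i := ereal_sup [set L2norm P (fun w => (CE i t w - CEs i t w)%R) | t in [set t : R | (`|t| <= eps0)%R]].
have s_ub i t : `|t| <= eps0 -> (L2norm P (fun w => (CE i t w - CEs i t w)%R) <= s i)%E.
  by move=> ht; apply: ereal_sup_ubound; exists t.
have s0 i : (0 <= s i)%E.
  by apply: le_trans (s_ub i 0 _); [exact: Lnorm_ge0|rewrite normr0].
have part J : (\sum_(0 <= i < J) s i <= \sum_(0 <= i <oo) s i)%E.
  by apply: nneseries_lim_ge => i _ _.
have sf i : s i \is a fin_num.
  rewrite ge0_fin_numE// (le_lt_trans _ hs)//; apply: le_trans (part i.+1).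
  by rewrite big_nat_recr//= leeDr// sume_ge0.
exists (fun i => fine (s i)), (fine (\sum_(0 <= i <oo) s i)%E); split.
  move=> J; rewrite -lee_fin fineK; last first.
    by rewrite ge0_fin_numE// nneseries_ge0.
  apply: le_trans (part J); rewrite big_mkord -sumEFin lee_sum// => i _.
  by rewrite fineK.
move=> t j ht fi; have [h1 h2] := hC j t ht.
apply: (innov_coef_le_cond_exp (C := CE j t) (Cs := CEs j t)) => //.
by rewrite fineK// s_ub.
Qed.

End Dependence.

Lemma eq_seq_cvg (R : realType) (u v : nat -> R) (l : R) : v =1 u ->
  u n @[n --> \oo] --> l -> v n @[n --> \oo] --> l.
Proof. by move=> /funext ->. Qed.

(** * Quadratic forms and lagged sums of the design *)

Section Design.
Context {R : realType} {p : nat}.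
Implicit Types (c v : 'cV[R]_p) (M : 'M[R]_p).

Definition quadform c M : R := \sum_a \sum_b c a 0 * M a b * c b 0.

Lemma quadform_outer c v u : quadform c (v *m u^T) = dotv v c * dotv u c.
Proof.
rewrite /quadform /dotv mulr_suml; apply: eq_bigr => a _; rewrite mulr_sumr.
by apply: eq_bigr => b _; rewrite !mxE big_ord1 !mxE; ring.
Qed.

Lemma quadform_sum c (I : Type) (s : seq I) (Q : pred I) (F : I -> 'M[R]_p) :
  quadform c (\sum_(i <- s | Q i) F i) = \sum_(i <- s | Q i) quadform c (F i).
Proof.
rewrite /quadform [RHS]exchange_big; apply: eq_bigr => a _; rewrite [RHS]exchange_big.
by apply: eq_bigr => b _; rewrite summxE mulr_sumr mulr_suml.
Qed.

Lemma quadform1 c : quadform c 1%:M = dotv c c.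
Proof.
apply: eq_bigr => a _; rewrite (bigD1 a)//= big1 ?addr0 => [|b ba].
  by rewrite mxE eqxx mulr1.
by rewrite mxE eq_sym (negPf ba) mulr0 mul0r.
Qed.

Lemma quadformZ c a M : quadform c (a *: M) = a * quadform c M.
Proof.
rewrite /quadform mulr_sumr; apply: eq_bigr => i _; rewrite mulr_sumr.
by apply: eq_bigr => j _; rewrite mxE; ring.
Qed.

Lemma quadform_gram c (A : 'M[R]_p) : quadform c (A *m A^T) = \sum_j (A^T *m c) j 0 ^+ 2.
Proof.
transitivity (\sum_j \sum_a \sum_b (c a 0 * A a j) * (c b 0 * A b j)).
  rewrite [RHS]exchange_big; apply: eq_bigr => a _; rewrite [RHS]exchange_big.
  by apply: eq_bigr => b _; rewrite mxE mulr_sumr mulr_suml; apply: eq_bigr => j _; rewrite mxE; ring.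
apply: eq_bigr => j _; rewrite expr2 mxE mulr_suml; apply: eq_bigr => a _.
by rewrite mulr_sumr; apply: eq_bigr => b _; rewrite !mxE; ring.
Qed.

Lemma dotv_tr u v : dotv u v = (u^T *m v) 0 0.
Proof. by rewrite mxE; apply: eq_bigr => j _; rewrite mxE. Qed.

Lemma dotv_le_vnorm u c : `|dotv u c| <= vnorm u * \sum_j `|c j 0|.
Proof.
rewrite (le_trans (ler_norm_sum _ _ _))// mulr_sumr ler_sum// => j _.
by rewrite normrM ler_wpM2r// coord_le_vnorm.
Qed.

Lemma psd_sqrt_unit (Q M : 'M[R]_p) : is_psd_sqrt Q M -> M \in unitmx -> Q \in unitmx.
Proof. by move=> [_ _ <-]; rewrite unitmx_mul => /andP[]. Qed.

Lemma standardized_gram (I : Type) (s : seq I) (x : I -> 'cV[R]_p) (Q : 'M[R]_p) :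
  is_psd_sqrt Q (\sum_(i <- s) x i *m (x i)^T) ->
  \sum_(i <- s) x i *m (x i)^T \in unitmx ->
  \sum_(i <- s) (invmx Q *m x i) *m (invmx Q *m x i)^T = 1%:M.
Proof.
move=> hQ uM; have uQ := psd_sqrt_unit hQ uM; have [QT _ QQ] := hQ.
have -> : \sum_(i <- s) (invmx Q *m x i) *m (invmx Q *m x i)^T =
    invmx Q *m (\sum_(i <- s) x i *m (x i)^T) *m invmx Q.
  rewrite mulmx_sumr mulmx_suml; apply: eq_bigr => i _.
  by rewrite trmx_mul trmx_inv QT !mulmxA.
by rewrite -QQ mulmxA mulVmx// mul1mx mulmxV.
Qed.

Lemma standardized_dotv (Q : 'M[R]_p) u v : Q^T = Q -> Q \in unitmx ->
  dotv (invmx Q *m u) (Q *m v) = dotv u v.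
Proof. by move=> QT uQ; rewrite !dotv_tr trmx_mul trmx_inv QT -mulmxA (mulmxA _ Q) mulVmx// mul1mx. Qed.

Lemma vnorm_max n (z : nat -> 'cV[R]_p) i : (1 <= i <= n)%N ->
  vnorm (z i) <= \big[Num.max/0]_(1 <= i < n.+1) vnorm (z i).
Proof. by move=> hi; apply: (le_bigmax_seq 0 i xpredT (fun i => vnorm (z i))) => //; rewrite mem_index_iota ltnS. Qed.

Lemma cvg_mxP (F : nat -> 'M[R]_p) M :
  F n @[n --> \oo] --> M <-> forall a b, F n a b @[n --> \oo] --> M a b.
Proof.
split=> [h a b|h]; first exact: cvg_comp h (@coord_continuous _ _ _ a b M).
apply/cvg_ballP => e e0.
have /choice[N hN] : forall ab : 'I_p * 'I_p, exists N, forall n, (N <= n)%N ->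
    ball (M ab.1 ab.2) e (F n ab.1 ab.2).
  by move=> [a b]; move/cvg_ballP : (h a b) => /(_ _ e0) [N _ hN]; exists N => n /hN.
exists (\max_ab N ab) => // n /= Nn; split=> // a b.
by apply: (hN (a, b)); apply: leq_trans Nn; exact: leq_bigmax.
Qed.

Lemma quadform_cvg c (F : nat -> 'M[R]_p) M : F n @[n --> \oo] --> M ->
  quadform c (F n) @[n --> \oo] --> quadform c M.
Proof.
move=> /cvg_mxP h; apply: cvg_sumr => a; apply: cvg_sumr => b.
by apply: cvgMl; apply: cvgMr; exact: h.
Qed.

Lemma le_sum_subset (I : eqType) (s t : seq I) (F : I -> R) : uniq s -> uniq t ->
  {subset s <= t} -> (forall i, 0 <= F i) -> \sum_(i <- s) F i <= \sum_(i <- t) F i.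
Proof.
move=> us ut st F0; rewrite [leRHS](bigID (mem s)) /=.
have -> : \sum_(i <- s) F i = \sum_(i <- t | i \in s) F i.
  rewrite -[RHS]big_filter; apply: perm_big; apply: uniq_perm; rewrite ?filter_uniq// => i.
  by rewrite mem_filter; case: (boolP (i \in s)) => // /st ->.
by rewrite lerDl; apply: sumr_ge0 => i _.
Qed.

(** By [|a b| <= a^2 + b^2] and injectivity of the shift by [k] on the admissible indices, each sum
    of squares is part of a full one. The bound is uniform in [n] and [k], as domination over lags
    requires. *)
Lemma lag_sum_le (z : nat -> 'cV[R]_p) n (k : int) c v :
  (forall v, \sum_(1 <= i < n.+1) dotv (z i) v ^+ 2 = dotv v v) ->
  `|\sum_(1 <= i < n.+1 | (1 <= i%:Z + k <= n%:Z)%R) dotv (z i) c * dotv (z (absz (i%:Z + k))) v|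
    <= dotv c c + dotv v v.
Proof.
move=> hz; rewrite (le_trans (ler_norm_sum _ _ _))//.
rewrite (@le_trans _ _ (\sum_(1 <= i < n.+1 | (1 <= i%:Z + k <= n%:Z)%R)
   (dotv (z i) c ^+ 2 + dotv (z (absz (i%:Z + k))) v ^+ 2)))//.
  apply: ler_sum => i _; rewrite normrM.
  rewrite -(real_normK (num_real (dotv (z i) c))) -(real_normK (num_real (dotv (z (absz (i%:Z + k))) v))).
  move: `|_| `|_| (normr_ge0 (dotv (z i) c)) (normr_ge0 (dotv (z (absz (i%:Z + k))) v)) => r s r0 s0.
  by have := sqr_ge0 (r - s); have := mulr_ge0 r0 s0; rewrite !expr2; lra.
rewrite big_split /=; apply: lerD.
  rewrite -hz [leRHS](bigID (fun i : nat => (1 <= i%:Z + k <= n%:Z)%R)) /= lerDl.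
  by apply: sumr_ge0 => i _; exact: sqr_ge0.
rewrite -hz -big_filter -(big_map (fun i => absz (i%:Z + k)) xpredT (fun i => dotv (z i) v ^+ 2)).
apply: le_sum_subset => [|||i]; last exact: sqr_ge0.
- rewrite map_inj_in_uniq ?filter_uniq ?iota_uniq// => i j.
  by rewrite !mem_filter => /andP[hi _] /andP[hj _]; lia.
- exact: iota_uniq.
- by move=> i /mapP[j]; rewrite mem_filter => /andP[hj _] ->; rewrite mem_index_iota; lia.
Qed.

End Design.

Lemma cos_integral_close d (T : measurableType d) (R : realType) (P : probability T R) p
    (V Y : T -> 'cV[R]_p) (c : 'cV[R]_p) (b delta : R) :
  measurable_vec V -> measurable_vec Y -> 0 <= delta ->
  `|(\int[P]_w cos (dotv c (V w) + b)) - \int[P]_w cos (dotv c (Y w) + b)| <=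
  delta * \sum_j `|c j 0| + 2 * fine (P [set w | delta < vnorm (V w - Y w)]).
Proof.
move=> mV mY d0.
have mVY : measurable_vec (fun w => V w - Y w).
  move=> j; have -> : (fun w => (V w - Y w) j 0) = (fun w => V w j 0 - Y w j 0).
    by apply/funext => w; rewrite !mxE.
  by apply: measurable_funB; [exact: mV|exact: mY].
pose Bd := [set w | delta < vnorm (V w - Y w)].
have mB : measurable Bd := measurable_vnorm_gt delta mVY.
have mc (Z : T -> 'cV[R]_p) : measurable_vec Z -> measurable_fun setT (fun w => cos (dotv c (Z w) + b)).
  move=> mZ; apply: (measurableT_comp measurable_cos); apply: measurable_funD => //.
  exact: measurable_dotv.
have ic (Z : T -> 'cV[R]_p) : measurable_vec Z -> integ P (fun w => cos (dotv c (Z w) + b)).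
  by move=> mZ; apply: (integ_bounded P (C := 1)) => [|w]; [exact: mc|exact: cos_max].
have iB : integ P (fun w => 2 * \1_Bd w) by apply: integZ; apply: sqi_integ; exact: sqi_indic.
have s0 : 0 <= \sum_j `|c j 0| by apply: sumr_ge0.
rewrite -RintegralB//; [|exact: ic..].
apply: le_trans (Rint_norm_le (g := fun w => delta * \sum_j `|c j 0| + 2 * \1_Bd w) _ _ _) _.
- by apply: measurable_funB; exact: mc.
- by apply: integD => //; exact: integ_cst.
- move=> w; have [h|h] := boolP (delta < vnorm (V w - Y w)).
    rewrite indicE mem_set//= mulr1 (le_trans (ler_normB _ _))//.
    have := cos_max (dotv c (V w) + b); have := cos_max (dotv c (Y w) + b).
    by have := mulr_ge0 d0 s0; lra.
  rewrite indicE memNset; last exact/negP.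
  rewrite mulr0 addr0 (le_trans (cos_lip _ _))//.
  rewrite (_ : _ - _ = dotv (V w - Y w) c); last first.
    rewrite opprD addrACA subrr addr0 /dotv -sumrB; apply: eq_bigr => j _.
    by rewrite !mxE; ring.
  by rewrite (le_trans (dotv_le_vnorm _ _))// ler_wpM2r// leNgt.
rewrite RintegralD//; last exact: integ_cst.
rewrite Rint_cst lerD2l RintegralZl//; last by apply: sqi_integ; exact: sqi_indic.
by rewrite /Rintegral integral_indic// setIT.
Qed.

(** * The standardised linear model *)

Section ScoreModel.
Context {dS : measure_display} (S : measurableType dS) (R : realType).
Context d (T : measurableType d) (P : probability T R).
Variables (mu : probability S R) (X : int -> T -> S).
Hypothesis HX : iid_law P mu X.
Local Notation nu := (past_law HX).
Local Notation U := (@shift _ S R).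
Variables (rho psi : R -> R) (q : seqspace S -> R).
Hypothesis rho_convex : forall (a b t : R), 0 <= t <= 1 ->
  rho (t * a + (1 - t) * b) <= t * rho a + (1 - t) * rho b.
Hypothesis psi_sub : forall a b : R, rho a + psi a * (b - a) <= rho b.
Variables (t1 B dphi : R) (dl : nat -> R).
Local Notation f := (fun (t : R) (x : seqspace S) => psi (q x + t)).
Hypothesis dphi0 : 0 < dphi.
Hypothesis f_sqi : forall t, `|t| <= t1 -> sqi nu (f t).
Hypothesis f_coef : forall t j, `|t| <= t1 -> innov_coef HX j (f t) <= dl j.
Hypothesis dl_sum : forall J, \sum_(j < J) dl j <= B.
Hypothesis f_cont : forall e, 0 < e -> exists2 eta, 0 < eta <= t1 &
  forall t, `|t| <= eta -> norm2 nu (fun x => f 0 x - f t x) <= e.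
Hypothesis f_mean : \int[nu]_x f 0 x = 0.
Hypothesis f_deriv : forall e, 0 < e -> exists2 eta, 0 < eta <= t1 &
  forall t, `|t| <= eta -> `|(\int[nu]_x f t x) - dphi * t| <= e * `|t|.
Variables (p : nat) (z : nat -> nat -> 'cV[R]_p) (N0 : nat).
Hypothesis gram : forall n, (N0 <= n)%N ->
  \sum_(1 <= i < n.+1) z n i *m (z n i)^T = 1%:M.
Hypothesis z_small : forall e, 0 < e -> exists N, forall n i, (N <= n)%N ->
  (1 <= i <= n)%N -> vnorm (z n i) <= e.

Definition score n w : 'cV[R]_p := \sum_(1 <= i < n.+1) psi (q (past X i%:Z w)) *: z n i.
(** Subtracting the values at [v = 0] leaves the minimizers unchanged and makes the objective a sum
    of increments of [rho]. *)
Definition loss n w v : R :=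
  \sum_(1 <= i < n.+1) (rho (q (past X i%:Z w) - dotv (z n i) v) - rho (q (past X i%:Z w))).

(* Weights in reversed time: position [k] of the past of time [n] is time [n - k]. *)
Definition weight n v k : R := if (k < n)%N then dotv (z n (n - k)%N) v else 0.

Lemma sum_rev (V : nmodType) n (a : nat -> V) :
  \sum_(1 <= i < n.+1) a i = \sum_(k < n) a (n - k)%N.
Proof.
rewrite big_add1 big_mkord (reindex_inj rev_ord_inj); apply: eq_bigr => k _ /=.
by rewrite subnSK // ltn_ord.
Qed.

Lemma gram_sum n v : (N0 <= n)%N -> \sum_(1 <= i < n.+1) dotv (z n i) v ^+ 2 = dotv v v.
Proof.
move=> n0; rewrite -quadform1 -(gram n0) quadform_sum; apply: eq_bigr => i _.
by rewrite quadform_outer expr2.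
Qed.

Lemma weight_sum n v : (N0 <= n)%N -> \sum_(k < n) weight n v k ^+ 2 = dotv v v.
Proof.
move=> n0; rewrite -(gram_sum v n0) sum_rev; apply: eq_bigr => k _.
by rewrite /weight ltn_ord.
Qed.

Lemma weight_small v eta : 0 < eta -> exists N, forall n k, (N <= n)%N -> `|weight n v k| <= eta.
Proof.
move=> eta0; pose L := \sum_j `|v j 0|; have L0 : 0 <= L by apply: sumr_ge0.
have [N hN] := z_small (divr_gt0 eta0 (ltr_wpDl L0 (@ltr01 R))).
exists N => n k Nn; rewrite /weight; case: ifP => kn; last by rewrite normr0 ltW.
rewrite (le_trans (dotv_le_vnorm _ _))// (le_trans (ler_wpM2r L0 (hN n _ Nn _)))//.
  by apply/andP; split; lia.
by rewrite -/L mulrAC ler_pdivrMr ?ltr_wpDl// ler_pM2l// lerDl.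
Qed.

Lemma past_rev n k w (g : seqspace S -> R) : (k < n)%N ->
  g (past X (n - k)%N%:Z w) = iter k U g (past X n%:Z w).
Proof.
move=> kn; rewrite iter_shiftE iter_stail_past; congr (g (past X _ w)); lia.
Qed.

Lemma score_wsum n c w : dotv c (score n w) = wsum (f 0) n (weight n c) (past X n%:Z w).
Proof.
rewrite /score sum_rev /wsum /dotv.
transitivity (\sum_(k < n) psi (q (past X (n - k)%N%:Z w)) * dotv (z n (n - k)%N) c).
  under eq_bigr do rewrite summxE mulr_sumr.
  rewrite exchange_big; apply: eq_bigr => k _; rewrite mulr_sumr.
  by apply: eq_bigr => j _; rewrite !mxE; ring.
apply: eq_bigr => k _; rewrite /weight ltn_ord mulrC; congr (_ * _).
by rewrite -(past_rev w (f 0) (ltn_ord k)) addr0.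
Qed.

Lemma loss_excessE n v w : (N0 <= n)%N ->
  loss n w v + dotv (score n w) v - dphi / 2 * dotv v v =
  loss_excess rho psi q dphi n (weight n v) (past X n%:Z w).
Proof.
move=> n0; rewrite /loss_excess weight_sum//; congr (_ - _).
have -> : dotv (score n w) v = \sum_(1 <= i < n.+1) psi (q (past X i%:Z w)) * dotv (z n i) v.
  rewrite dotvC score_wsum sum_rev; apply: eq_bigr => k _.
  rewrite -(past_rev w (f 0) (ltn_ord k)) addr0 /weight ltn_ord mulrC//.
rewrite /loss -big_split sum_rev; apply: eq_bigr => k _ /=.
by rewrite -past_rev// /loss_rem /weight ltn_ord; ring.
Qed.

Lemma f0_sqi : sqi nu (f 0).
Proof. by have [a /andP[a0 a1] _] := f_cont ltr01; apply: f_sqi; rewrite normr0 ltW// (lt_le_trans a0). Qed.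

Lemma f0_coef J : \sum_(j < J) innov_coef HX j (f 0) <= B.
Proof.
apply: le_trans (dl_sum J); apply: ler_sum => j _; apply: f_coef.
by have [a /andP[a0 a1] _] := f_cont ltr01; rewrite normr0 ltW// (lt_le_trans a0).
Qed.

Lemma score_pastE n c : (fun w => dotv c (score n w)) = wsum (f 0) n (weight n c) \o past X n%:Z.
Proof. by apply/funext => w; rewrite score_wsum. Qed.

Lemma dotv_score_sqi n c : sqi P (fun w => dotv c (score n w)).
Proof. by have h := wsum_sqi n (weight n c) f0_sqi; rewrite score_pastE; exact/(past_sqi HX n%:Z h.1). Qed.

Lemma score_sqi n j : sqi P (fun w => score n w j 0).
Proof.
have := dotv_score_sqi n (delta_mx j 0); congr square_integrable; apply/funext => w.
rewrite /dotv (bigD1 j)//= big1 ?addr0 => [|i ij]; rewrite !mxE ?eqxx ?mul1r//.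
by rewrite (negPf ij) mul0r.
Qed.

Lemma dotv_score_norm2 n c : norm2 P (fun w => dotv c (score n w)) = norm2 nu (wsum (f 0) n (weight n c)).
Proof. by have [h _] := wsum_sqi n (weight n c) f0_sqi; rewrite score_pastE (past_norm2 HX n%:Z h). Qed.

Lemma score_norm2 n : (N0 <= n)%N ->
  norm2 P (fun w => vnorm (score n w)) <= Num.sqrt p%:R * B.
Proof.
move=> n0; have B0 : 0 <= B by have := dl_sum 0%N; rewrite big_ord0.
apply: (@le_trans _ _ (Num.sqrt (p%:R * B ^+ 2))); last first.
  by rewrite sqrtrM// sqrtr_sqr ger0_norm.
have [_ hN] := norm2_vnorm (score_sqi n).
rewrite -[leLHS]ger0_norm ?norm2_ge0// -sqrtr_sqr ler_wsqrtr// hN.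
rewrite -[p in p%:R]card_ord mulr_natl -sumr_const; apply: ler_sum => j _.
rewrite ler_sqr ?nnegrE ?norm2_ge0//.
have -> : (fun w => score n w j 0) = (fun w => dotv (delta_mx j 0) (score n w)).
  apply/funext => w; rewrite /dotv (bigD1 j)//= big1 ?addr0 => [|i ij]; rewrite !mxE ?eqxx ?mul1r//.
  by rewrite (negPf ij) mul0r.
rewrite dotv_score_norm2 (le_trans (norm2_wsum_le _ _ f0_sqi f_mean f0_coef))//.
rewrite weight_sum// /dotv (bigD1 j)//= big1 ?addr0 => [|i ij]; rewrite !mxE ?eqxx ?mul1r ?sqrtr1 ?mul1r//.
by rewrite (negPf ij) mul0r.
Qed.

Lemma loss_convex n w : convexv (loss n w).
Proof.
move=> u v t t01; rewrite /loss !mulr_sumr -big_split; apply: ler_sum => i _ /=.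
set y := q _.
have -> : y - dotv (z n i) (t *: u + (1 - t) *: v) =
    t * (y - dotv (z n i) u) + (1 - t) * (y - dotv (z n i) v).
  by rewrite dotvC dotvDl !dotvZl !(dotvC (z n i)); ring.
by have := rho_convex (y - dotv (z n i) u) (y - dotv (z n i) v) t01; lra.
Qed.

(** For large [n] the squared weights sum to [dotv v v], while each weight becomes uniformly small;
    [loss_excess_norm2] therefore applies with arbitrarily small constant. *)
Lemma loss_quadratic v e : 0 < e -> exists N, forall n, (N <= n)%N ->
  sqi P (fun w => loss n w v + dotv (score n w) v - dphi / 2 * dotv v v) /\
  norm2 P (fun w => loss n w v + dotv (score n w) v - dphi / 2 * dotv v v) <= e.
Proof.
move=> e0; pose L := Num.sqrt (dotv v v) + dotv v v.
have L0 : 0 <= L by rewrite addr_ge0 ?sqrtr_ge0 ?dotv_ge0.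
have e1 : 0 < e / (L + 1) by rewrite divr_gt0// ltr_wpDl.
have [eta /andP[eta0 etat] hq] :=
  @loss_excess_norm2 _ _ _ _ _ _ _ _ HX rho psi q psi_sub t1 B dphi dl f_sqi f_coef dl_sum f_cont f_mean f_deriv _ e1.
have [N hN] := weight_small v eta0.
exists (maxn N N0) => n; rewrite geq_max => /andP[Nn n0].
have hw k := hN n k Nn; have hwt k := le_trans (hw k) etat.
have -> : (fun w => loss n w v + dotv (score n w) v - dphi / 2 * dotv v v) =
    loss_excess rho psi q dphi n (weight n v) \o past X n%:Z.
  by apply/funext => w; rewrite loss_excessE.
have hsn := @loss_excess_sqi _ _ _ _ _ _ _ _ HX rho psi q psi_sub t1 dphi f_sqi f_cont n _ hwt.
split; first exact/(past_sqi HX n%:Z hsn.1).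
rewrite (past_norm2 HX n%:Z hsn.1).
rewrite (le_trans (hq n _ hw))// weight_sum// -/L mulrAC.
by rewrite ler_pdivrMr ?ltr_wpDl// ler_pM2l// lerDl.
Qed.

Variable th : nat -> T -> 'cV[R]_p.
Hypothesis mth : forall n, measurable_vec (th n).
Hypothesis th_min : forall n w v, (N0 <= n)%N -> loss n w (th n w) <= loss n w v.

Lemma estimator_cvg_prob0 : cvg_prob0 P (fun n w => dphi *: th n w - score n w).
Proof.
exact: (argmin_cvg_prob0 mth dphi0 loss_convex th_min score_sqi score_norm2 loss_quadratic).
Qed.

Lemma estimator_bounded_prob : bounded_prob P th.
Proof.
exact: (argmin_bounded_prob mth dphi0 loss_convex th_min score_sqi score_norm2 loss_quadratic).
Qed.

Definition lag_cov n c k : R :=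
  \sum_(1 <= i < n.+1 | (1 <= i%:Z + k <= n%:Z)%R)
    dotv (z n i) c * dotv (z n (absz (i%:Z + k))) c.

Lemma score_variance n c : norm2 nu (wsum (f 0) n (weight n c)) ^+ 2 =
  symsum n (fun k => autocov HX (f 0) `|k|%N * lag_cov n c k).
Proof.
have mf : measurable_fun setT (f 0) by case: f0_sqi.
have gi i : sqi P (fun w => f 0 (past X i w)) by exact ((past_sqi HX i mf).2 f0_sqi).
pose y i := dotv (z n i) c.
have E : (fun w => dotv c (score n w)) = (fun w => \sum_(1 <= i < n.+1) y i * f 0 (past X i%:Z w)).
  apply/funext => w; rewrite score_wsum sum_rev; apply: eq_bigr => k _.
  by rewrite -(past_rev w (f 0) (ltn_ord k)) /weight ltn_ord.
rewrite -dotv_score_norm2 norm2_sqr E inner_suml; last 2 first.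
- by move=> i _; exact: sqiZ.
- by apply: sqi_sum => i _; exact: sqiZ.
transitivity (\sum_(1 <= i < n.+1) \sum_(1 <= k < n.+1)
    (y i * y k * autocov HX (f 0) `|i%:Z - k%:Z|%N)).
  apply: eq_bigr => i _; rewrite innerC inner_suml; last 2 first.
  - by move=> k _; exact: sqiZ.
  - exact: sqiZ.
  apply: eq_bigr => k _; rewrite innerZl//; last exact: sqiZ.
  by rewrite innerC innerZl// -(past_autocov HX _ _ mf) /inner; ring.
rewrite sum_by_lag; apply: eq_bigr => j _; rewrite /lag_cov mulr_sumr.
apply: eq_bigr => i hi; rewrite mulrC; congr (autocov _ _ _ * _); lia.
Qed.

Variable Dk : int -> 'M[R]_p.
Hypothesis Dk_cvg : forall k : int,
  (\sum_(1 <= i < n.+1 | (1 <= i%:Z + k <= n%:Z)%R) z n i *m (z n (absz (i%:Z + k)))^T)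
    @[n --> \oo] --> Dk k.

Lemma lag_cov_cvg c k : lag_cov n c k @[n --> \oo] --> quadform c (Dk k).
Proof.
apply: eq_seq_cvg (quadform_cvg (c := c) (@Dk_cvg k)) => n.
by rewrite quadform_sum; apply: eq_bigr => i _; rewrite quadform_outer.
Qed.

Lemma autocov_bound (a : R) M : 0 <= a ->
  \sum_(m < M) `|autocov HX (f 0) m| * a <= B ^+ 2 * a.
Proof.
move=> a0; rewrite -mulr_suml ler_wpM2r//.
exact: (autocov_sum _ f0_sqi f_mean f0_coef).
Qed.

Let Dsum K : 'M[R]_p := \sum_(0 <= j < (2 * K).+1)
  autocov HX (f 0) `|j%:Z - K%:Z|%N *: Dk (j%:Z - K%:Z).

Lemma longrun_cov_cvg : exists D : 'M[R]_p, Dsum K @[K --> \oo] --> D.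
Proof.
have ent a b : exists s : R, symsum K (fun k => autocov HX (f 0) `|k|%N * Dk k a b) @[K --> \oo] --> s.
  (* The constant 2 comes from [lag_sum_le] at two unit vectors; the bound holds from [N0] on and
     passes to the limit [Dk k]. *)
  apply: (@symsum_cvg _ _ (fun m => `|autocov HX (f 0) m| * 2) (B ^+ 2 * 2)).
  - by move=> m; rewrite mulr_ge0.
  - by move=> M; exact: autocov_bound.
  - move=> k; rewrite normrM ler_wpM2l//.
    have hk := (cvg_mxP _ _).1 (@Dk_cvg k) a b.
    apply: (@cvg_norm_le R (fun n => (\sum_(1 <= i < (n + N0).+1 | (1 <= i%:Z + k <= (n + N0)%N%:Z)%R)
      z (n + N0)%N i *m (z (n + N0)%N (absz (i%:Z + k)))^T) a b)).
      by move: hk; rewrite -(cvg_shiftn N0).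
    move=> n; have n0 : (N0 <= n + N0)%N by rewrite leq_addl.
    have dl1 (u : 'cV[R]_p) (i : 'I_p) : dotv u (delta_mx i 0) = u i 0.
      rewrite /dotv (bigD1 i)//= big1 ?addr0 => [|j ji]; rewrite !mxE ?eqxx ?mulr1//.
      by rewrite (negPf ji) mulr0.
    rewrite summxE (eq_bigr (fun i => dotv (z (n + N0)%N i) (delta_mx a 0) *
      dotv (z (n + N0)%N (absz (i%:Z + k))) (delta_mx b 0))); last first.
      by move=> i _; rewrite !dl1 mxE big_ord1 !mxE.
    rewrite (le_trans (lag_sum_le k (delta_mx a 0) (delta_mx b 0) (fun v => gram_sum v n0)))//.
    by rewrite !dl1 !mxE !eqxx.
have /choice[D hD] : forall ab : 'I_p * 'I_p, exists s : R,
    symsum K (fun k => autocov HX (f 0) `|k|%N * Dk k ab.1 ab.2) @[K --> \oo] --> s.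
  by move=> [a b]; exact: ent.
exists (\matrix_(a, b) D (a, b)); apply/cvg_mxP => a b; rewrite mxE.
apply: eq_seq_cvg (hD (a, b)) => K.
by rewrite /Dsum summxE; apply: eq_bigr => j _; rewrite mxE.
Qed.

Variable D : 'M[R]_p.
Hypothesis D_cvg : Dsum K @[K --> \oo] --> D.

Lemma variance_cvg c : norm2 nu (wsum (f 0) n (weight n c)) ^+ 2 @[n --> \oo] --> quadform c D.
Proof.
have -> : (fun n => norm2 nu (wsum (f 0) n (weight n c)) ^+ 2) =
    (fun n => symsum n (fun k => autocov HX (f 0) `|k|%N * lag_cov n c k)).
  by apply/funext => n; exact: score_variance.
apply: (@tannery _ _ (fun k => autocov HX (f 0) `|k|%N * quadform c (Dk k))
  (fun m => `|autocov HX (f 0) m| * (dotv c c + dotv c c)) (B ^+ 2 * (dotv c c + dotv c c))).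
- by move=> m; rewrite mulr_ge0// addr_ge0 ?dotv_ge0.
- by move=> M; apply: autocov_bound; rewrite addr_ge0 ?dotv_ge0.
- exists N0 => n k n0; rewrite normrM ler_wpM2l//.
  exact: lag_sum_le (fun v => gram_sum v n0).
- by move=> k; apply: cvgMr; exact: lag_cov_cvg.
apply: eq_seq_cvg (quadform_cvg (c := c) D_cvg) => K.
by rewrite quadform_sum; apply: eq_bigr => j _; rewrite quadformZ.
Qed.

Lemma score_cos_cvg c b :
  \int[P]_w cos (dotv c (score n w) + b) @[n --> \oo] --> expR (- quadform c D / 2) * cos b.
Proof.
have vs e : 0 < e -> exists N, forall n k, (N <= n)%N -> (k < n)%N -> `|weight n c k| <= e.
  by move=> /(weight_small c)[N hN]; exists N => n k Nn _; exact: hN.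
have vV n : (N0 <= n)%N -> \sum_(k < n) weight n c k ^+ 2 <= dotv c c.
  by move=> n0; rewrite weight_sum.
have h1 := weighted_clt b f0_sqi f_mean f0_coef vV vs.
have h2 : expR (- norm2 nu (wsum (f 0) n (weight n c)) ^+ 2 / 2) * cos b @[n --> \oo] -->
    expR (- quadform c D / 2) * cos b.
  apply: cvgMl; apply: continuous_cvg; first exact: continuous_expR.
  by apply: cvgMl; apply: cvgN; exact: variance_cvg.
rewrite -[_ * cos b]add0r; apply: eq_seq_cvg (cvgD h1 h2) => n /=; rewrite subrK.
have hw := wsum_sqi n (weight n c) f0_sqi.
rewrite -(past_Rint HX n%:Z (f := fun x => cos (wsum (f 0) n (weight n c) x + b))).
  by apply: eq_Rintegral => w _; rewrite score_wsum.
apply: (measurableT_comp measurable_cos); apply: measurable_funD => //; exact: hw.1.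
Qed.

Lemma measurable_score_vec n : measurable_vec (score n).
Proof. by move=> j; case: (score_sqi n j). Qed.

Lemma measurable_scaled n : measurable_vec (fun w => dphi *: th n w).
Proof.
move=> j; have -> : (fun w => (dphi *: th n w) j 0) = (fun w => dphi * th n w j 0).
  by apply/funext => w; rewrite mxE.
by apply: measurable_funM => //; exact: mth.
Qed.

Lemma estimator_cos_cvg c b : \int[P]_w cos (dotv c (dphi *: th n w) + b) @[n --> \oo] -->
  expR (- quadform c D / 2) * cos b.
Proof.
pose L := \sum_j `|c j 0|; have L0 : 0 <= L by apply: sumr_ge0.
have h1 : (\int[P]_w cos (dotv c (dphi *: th n w) + b)) -
    (\int[P]_w cos (dotv c (score n w) + b)) @[n --> \oo] --> (0 : R).
  apply/cvgrPdist_le => e e0.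
  have de : 0 < e / (2 * (L + 1)) by rewrite divr_gt0// mulr_gt0// ltr_wpDl.
  have e4 : 0 < e / 4 by rewrite divr_gt0.
  have /fine_cvgP[_ /cvgrPdist_le /(_ _ e4) [N _ hN]] := estimator_cvg_prob0 de.
  exists N => // n Nn; rewrite sub0r normrN.
  have := hN n Nn; rewrite sub0r normrN => /(le_trans (ler_norm _)) hP.
  rewrite (le_trans (cos_integral_close P c b (measurable_scaled n) (measurable_score_vec n) (ltW de)))//.
  have hL : e / (2 * (L + 1)) * L <= e / 2.
    rewrite (_ : _ * L = e / 2 * (L / (L + 1))); last by field; rewrite gt_eqF// ltr_wpDl.
    by rewrite ler_piMr ?divr_ge0 ?(ltW e0)// ler_pdivrMr ?ltr_wpDl// mul1r lerDl.
  by rewrite -/L; move: hL hP => /=; lra.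
rewrite -(add0r (expR (- quadform c D / 2) * cos b)).
by apply: eq_seq_cvg (cvgD h1 (@score_cos_cvg c b)) => n /=; rewrite subrK.
Qed.

(** The limiting cosine integrals are those of [A W]: its variance in direction [c] is the squared
    length of [A^T *m c], which is the quadratic form of [D] at [c]. *)
Lemma estimator_cvg_normal : cvg_normal P (fun n w => dphi *: th n w) D.
Proof.
move=> A AD dO O Q W indW lawW g cg gM.
have mW j : measurable_fun setT (W j) := indW.1 j.
have mZ : measurable_vec (fun o => A *m \col_j W j o).
  move=> a; have -> : (fun o => (A *m \col_j W j o) a 0) = (fun o => \sum_j A a j * W j o).
    by apply/funext => o; rewrite mxE; apply: eq_bigr => j _; rewrite mxE.
  by apply: measurable_sum => j; exact: measurable_funM.
apply: (weak_cvg (V := fun n w => dphi *: th n w) (Z := fun o => A *m \col_j W j o)) => //.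
- exact: measurable_scaled.
- move=> eta eta0; have [M [N hN]] := estimator_bounded_prob eta0.
  exists (dphi * M), N => n Nn; have := hN n Nn; congr (P _ < _)%E.
  by apply/seteqP; split=> w /=; rewrite vnormZ (gtr0_norm dphi0) ltr_pM2l.
move=> c b.
have -> : (fun o => cos (dotv c (A *m \col_j W j o) + b)) =
    (fun o => cos (\sum_(j <- index_enum 'I_p) (A^T *m c) j 0 * W j o + b)).
  apply/funext => o; congr (cos (_ + _)); rewrite dotv_tr mulmxA mxE; apply: eq_bigr => j _.
  by rewrite -[c]trmxK -trmx_mul !mxE; congr (_ * _); rewrite trmxK.
rewrite gaussian_vector_cos ?index_enum_uniq// -quadform_gram AD.
exact: estimator_cos_cvg.
Qed.

End ScoreModel.

Unset Implicit Arguments.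
Set Strict Implicit.
Set Printing Implicit Defensive.

Theorem theorem1
  (R : realType) (dT : measure_display) (T : measurableType dT)
  (P : probability T R)
  (dS : measure_display) (S : measurableType dS)
  (eps eps' : int -> T -> S)
  (* (eps_k) and (eps'_k) : jointly i.i.d. (eps' an independent copy of eps) *)
  (Hind : mutually_independent P
            (fun ib : bool * int => if ib.1 then eps' ib.2 else eps ib.2))
  (Hid : identically_distributed P
            (fun ib : bool * int => if ib.1 then eps' ib.2 else eps ib.2))
  (G : (nat -> S) -> R) (HG : seq_measurable G)
  (* design: x_i, i >= 1 (x 0 is unused) *)
  (p : nat) (x : nat -> 'cV[R]_p)
  (* Sigma_n nonsingular for large n; Ssq n is its symmetric psd square root *)
  (HSig : exists N0 : nat, forall n : nat, (N0 <= n)%N ->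
            (\sum_(1 <= i < n.+1) x i *m (x i)^T) \in unitmx)
  (Ssq : nat -> 'M[R]_p)
  (HSsq : forall n : nat, (\sum_(1 <= i < n.+1) x i *m (x i)^T) \in unitmx ->
            is_psd_sqrt (Ssq n) (\sum_(1 <= i < n.+1) x i *m (x i)^T))
  (* rho convex, psi a nondecreasing version of its derivative (a subgradient) *)
  (rho psi : R -> R)
  (Hrho : forall (a b t : R), 0 <= t <= 1 ->
            rho (t * a + (1 - t) * b) <= t * rho a + (1 - t) * rho b)
  (Hpsi_sub : forall a b : R, rho a + psi a * (b - a) <= rho b)
  (Hpsi_mono : forall a b : R, a <= b -> psi a <= psi b)
  (* beta_hat_n : any (measurable) minimizer of sum_i rho(y_i - x_i' beta), y_i = e_i *)
  (betahat : nat -> T -> 'cV[R]_p)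
  (Hbeta_meas : forall n (j : 'I_p), measurable_fun setT (fun w => betahat n w j 0))
  (Hbeta_min : forall n w (b : 'cV[R]_p),
     \sum_(1 <= i < n.+1) rho (shift_proc G eps i%:Z w - dotv (x i) (betahat n w))
     <= \sum_(1 <= i < n.+1) rho (shift_proc G eps i%:Z w - dotv (x i) b))
  (* (A1) *)
  (HA1_int : P.-integrable setT (EFin \o (fun w => psi (shift_proc G eps 1 w))))
  (HA1_mean : (\int[P]_w (psi (shift_proc G eps 1 w))%:E = 0)%E)
  (HA1_pos : (0 < L2norm P (fun w => psi (shift_proc G eps 1 w)))%E)
  (HA1_fin : (L2norm P (fun w => psi (shift_proc G eps 1 w)) < +oo)%E)
  (* (A2): d = phi'(0) > 0 *)
  (d : R)
  (HA2 : is_derive (0 : R) (1 : R)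
           (fun t : R => Rintegral P setT (fun w => psi (shift_proc G eps 1 w + t))) d)
  (HA2_pos : 0 < d)
  (* (A3) *)
  (HA3 : L2norm P (fun w => psi (shift_proc G eps 1 w + t) - psi (shift_proc G eps 1 w))
           @[t --> (0 : R)] --> 0%E)
  (* (A4) *)
  (HA4 : (\big[Num.max/0]_(1 <= i < n.+1) vnorm (invmx (Ssq n) *m x i))
           @[n --> \oo] --> (0 : R))
  (* condition (7) *)
  (eps0 : R) (Heps0 : 0 < eps0)
  (H7 : exists CE CEs : nat -> R -> T -> R,
     (forall (i : nat) (t : R), `|t| <= eps0 ->
        is_cond_exp P (gen_sigma eps [set j : int | j <= 0])
          (fun w => psi (shift_proc G eps i%:Z w + t)) (CE i t) /\
        is_cond_exp P (gen_sigma (star_innov eps eps') [set j : int | j <= 0])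
          (fun w => psi (shift_proc G (star_innov eps eps') i%:Z w + t)) (CEs i t)) /\
     (\sum_(0 <= i <oo)
         ereal_sup [set L2norm P (fun w => (CE i t w - CEs i t w)%R) | t in [set t : R | (`|t| <= eps0)%R]]
       < +oo)%E) :
  cvg_prob0 P (fun n w => d *: (Ssq n *m betahat n w)
                          - \sum_(1 <= i < n.+1)
                              psi (shift_proc G eps i%:Z w) *: (invmx (Ssq n) *m x i)) /\
  bounded_prob P (fun n w => Ssq n *m betahat n w) /\
  (forall Dk : int -> 'M[R]_p,
     (forall k : int,
        (\sum_(1 <= i < n.+1 | (1 <= i%:Z + k <= n%:Z)%R)
            (invmx (Ssq n) *m x i) *m (invmx (Ssq n) *m x (absz (i%:Z + k)))^T)
          @[n --> \oo] --> Dk k) ->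
   exists D : 'M[R]_p,
     (\sum_(0 <= j < (2 * K).+1)
          Rintegral P setT (fun w => psi (shift_proc G eps 0 w)
                                     * psi (shift_proc G eps (j%:Z - K%:Z) w))
          *: Dk (j%:Z - K%:Z)) @[K --> \oo] --> D /\
     cvg_normal P (fun n w => d *: (Ssq n *m betahat n w)) D).
Proof.
have [mu HZ] := iid_law_exists (false, 0) Hind Hid.
pose HX := iid_eps HZ.
pose f (t : R) : seqspace S -> R := fun y => psi (G y + t).
have sc := score_cvg HX HG Hpsi_mono HA1_fin HA3.
have [dl [B [dlB dlc]]] := score_coef HZ (ltW Heps0) H7.
have [eta1 eta10 h1] := sc 1 ltr01.
(* Within [t1] the translates are square integrable and the dependence condition covers them. *)
pose t1 := Num.min eta1 eps0.
have t10 : 0 < t1 by rewrite lt_min eta10.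
have t1eta t : `|t| <= t1 -> `|t| <= eta1 by move=> /le_trans; apply; rewrite ge_min lexx.
have t1eps t : `|t| <= t1 -> `|t| <= eps0 by move=> /le_trans; apply; rewrite ge_min lexx orbT.
have f_sqi t : `|t| <= t1 -> sqi (past_law HX) (f t) by move=> /t1eta /h1[].
have f_coef t j : `|t| <= t1 -> innov_coef HX j (f t) <= dl j.
  by move=> ht; apply: dlc; [exact: t1eps|exact: f_sqi].
have f_cont e : 0 < e -> exists2 eta, 0 < eta <= t1 &
    forall t, `|t| <= eta -> norm2 (past_law HX) (fun y => f 0 y - f t y) <= e.
  move=> /sc[eta eta0 h]; exists (Num.min eta t1); first by rewrite lt_min eta0 t10 ge_min lexx orbT.
  by move=> t ht; apply: (h t _).2; rewrite (le_trans ht)// ge_min lexx.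
have mean t := score_mean HX HG Hpsi_mono t.
pose phi t : R := \int[P]_w psi (shift_proc G eps 1 w + t).
have phi0 : phi 0 = 0.
  by rewrite /phi /Rintegral; under eq_integral do rewrite addr0; rewrite HA1_mean.
have f_mean : \int[past_law HX]_y f 0 y = 0 by rewrite -mean.
have f_deriv e : 0 < e -> exists2 eta, 0 < eta <= t1 &
    forall t, `|t| <= eta -> `|(\int[past_law HX]_y f t y) - d * t| <= e * `|t|.
  move=> /(derive_at_zero phi0 HA2)[eta eta0 h].
  exists (Num.min eta t1); first by rewrite lt_min eta0 t10 ge_min lexx orbT.
  by move=> t ht; rewrite -mean; apply: h; rewrite (le_trans ht)// ge_min lexx.
have [N0 hN0] := HSig.
pose z n i := invmx (Ssq n) *m x i.
have gram n : (N0 <= n)%N -> \sum_(1 <= i < n.+1) z n i *m (z n i)^T = 1%:M.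
  by move=> /hN0 un; apply: standardized_gram => //; exact: HSsq.
have z_small e : 0 < e -> exists N, forall n i, (N <= n)%N -> (1 <= i <= n)%N -> vnorm (z n i) <= e.
  move=> e0; move/cvgrPdist_le : HA4 => /(_ _ e0)[N _ hN]; exists N => n i Nn hi.
  rewrite (le_trans (vnorm_max (z n) hi))//; have := hN n Nn.
  by rewrite sub0r normrN => /(le_trans (ler_norm _)).
pose th n w := Ssq n *m betahat n w.
have mth n : measurable_vec (th n).
  move=> j; have -> : (fun w => th n w j 0) = (fun w => \sum_k Ssq n j k * betahat n w k 0).
    by apply/funext => w; rewrite mxE.
  by apply: measurable_sum => k; exact: measurable_funM.
(* Standardising preserves the fitted values: [z n i] against [Ssq n *m b] is [x i] against [b].
   Since [Ssq n] is invertible, every [v] has this form and the minimizers correspond. *)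
have th_min n w v : (N0 <= n)%N ->
    loss eps rho G z n w (th n w) <= loss eps rho G z n w v.
  move=> /hN0 un; have hS := HSsq n un; have uS := psd_sqrt_unit hS un; have [ST _ _] := hS.
  have E b : \sum_(1 <= i < n.+1) rho (shift_proc G eps i%:Z w - dotv (z n i) (Ssq n *m b)) =
      \sum_(1 <= i < n.+1) rho (shift_proc G eps i%:Z w - dotv (x i) b).
    by apply: eq_bigr => i _; rewrite standardized_dotv.
  rewrite /loss !sumrB lerD2r E -[v](mulKVmx uS) E.
  exact: Hbeta_min.
split; first exact: (@estimator_cvg_prob0 _ _ _ _ _ _ _ _ HX rho psi G Hrho Hpsi_sub t1 B d dl HA2_pos
  f_sqi f_coef dlB f_cont f_mean f_deriv p z N0 gram z_small th mth th_min).
split; first exact: (@estimator_bounded_prob _ _ _ _ _ _ _ _ HX rho psi G Hrho Hpsi_sub t1 B d dl HA2_pos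
  f_sqi f_coef dlB f_cont f_mean f_deriv p z N0 gram z_small th mth th_min).
move=> Dk hDk.
have [D hD] := @longrun_cov_cvg _ _ _ _ _ _ _ _ HX psi G t1 B dl f_sqi f_coef dlB f_cont f_mean p z N0 gram Dk hDk.
exists D; split; last first.
  exact: (@estimator_cvg_normal _ _ _ _ _ _ _ _ HX rho psi G Hrho Hpsi_sub t1 B d dl HA2_pos
    f_sqi f_coef dlB f_cont f_mean f_deriv p z N0 gram z_small th mth th_min Dk hDk D hD).
have mf : measurable_fun setT (f 0) by exact: (measurable_score HG Hpsi_mono 0).
have E k : \int[P]_w (psi (shift_proc G eps 0 w) * psi (shift_proc G eps k w)) =
    autocov HX (f 0) `|k|%N.
  rewrite -[k in RHS]opprK abszN -[- k]sub0r -(past_autocov HX 0 k mf).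
  by apply: eq_Rintegral => w _; rewrite /f !addr0.
have -> : (fun K => \sum_(0 <= j < (2 * K).+1)
    Rintegral P setT (fun w => psi (shift_proc G eps 0 w) *
      psi (shift_proc G eps (j%:Z - K%:Z) w)) *: Dk (j%:Z - K%:Z)) =
  (fun K => \sum_(0 <= j < (2 * K).+1) autocov HX (f 0) `|j%:Z - K%:Z|%N *: Dk (j%:Z - K%:Z)).
  by apply/funext => K; apply: eq_bigr => j _; rewrite E.
exact: hD.
Qed.
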